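(* Let $N\ge 1$, $p\in(0,1]$, $q=1-p$, and consider the $N$-particle asymmetric simple exclusion process (ASEP) on $\mathbb{Z}$ started from the configuration $Y=\{y_1<y_2<\cdots<y_N\}$, and let $x_1(t)<\cdots<x_N(t)$ be the particle positions at time $t\ge 0$. Let $1\le m\le N$ and let $x_1<x_2<\cdots<x_m$ be integers. Then \[ \mathbb{P}_Y\big(x_i(t)=x_i,\ i=1,\dots,m\big)=\sum_{\Lambda}(-1)^{\sum_{i<m}(\ell_i-i)}\,\mathrm{sgn}\,\Lambda\ p^{(N-m+1)(N-m)/2} \int_{\mathcal{C}_r}\!\!\cdots\!\int_{\mathcal{C}_r} \frac{\prod_{i\in\Lambda,\,j\notin\Lambda}f(\xi_i,\xi_j)\ \prod_{1\le i<j\le m-1}f(\xi_{\ell_i},\xi_{\ell_j})}{\prod_{1\le i<j\le N}f(\xi_i,\xi_j)} \] \[ \times\Big(1-\prod_{j\notin\Lambda}\xi_j\Big)\,\frac{\prod_{i<j,\ i,j\notin\Lambda}(\xi_j-\xi_i)}{\prod_{j\notin\Lambda}(1-\xi_j)}\ \prod_{i<m}\xi_{\ell_i}^{x_i}\ \prod_{j\notin\Lambda}\xi_j^{x_m}\ \prod_{i=1}^N\xi_i^{-y_i-1}\ e^{\sum_{i=1}^N\varepsilon(\xi_i)t}\,d\xi_1\cdots d\xi_N, \] where the sum runs over all ordered $(m-1)$-tuples $\Lambda=(\ell_1,\dots,\ell_{m-1})$ of distinct elements of $\{1,\dots,N\}$, and $\mathcal{C}_r$ is the circle centered at $0$ of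 radius $r>0$ so small that all nonzero poles of the integrand lie outside $\mathcal{C}_r$.
   Context: ASEP: each particle independently waits an exponential time (rate 1); then with probability $p$ it attempts to jump one step right and with probability $q=1-p$ one step left, the jump being executed only if the target site is unoccupied. $\mathbb{P}_Y$ denotes probability for the process started from $Y$. Notation: $f(\xi,\xi')=p+q\xi\xi'-\xi$ and $\varepsilon(\xi)=p\xi^{-1}+q\xi-1$. Every contour integral carries a factor $1/(2\pi i)$. All indices range over $\{1,\dots,N\}$; in conditions such as $i\in\Lambda$, $j\notin\Lambda$, $\Lambda$ is regarded as the set $\{\ell_1,\dots,\ell_{m-1}\}$. $\mathrm{sgn}\,\Lambda=(-1)^{\#\{(i,j):\,i<j,\ \ell_i>\ell_j\}}$ (the sign of the ordering of $\Lambda$). In a product $\prod$ the product symbol applies only to the factor immediately following it. *)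

(* Defs.v *)
From Stdlib Require Import Reals Lra Lia ZArith Arith List Bool.
From Coquelicot Require Import Coquelicot.
Import ListNotations.
Open Scope R_scope.

Definition cexp (z : C) : C :=
  (exp (Re z) * cos (Im z), exp (Re z) * sin (Im z)).

Definition Cpowz (z : C) (n : Z) : C :=
  match n with
  | Z0 => RtoC 1
  | Zpos k => Cpow z (Pos.to_nat k)
  | Zneg k => Cinv (Cpow z (Pos.to_nat k))
  end.

Definition sgnZ (s : Z) : C := if Z.even s then RtoC 1 else RtoC (-1).

Definition Cprod {A} (l : list A) (F : A -> C) : C :=
  fold_right (fun a acc => Cmult (F a) acc) (RtoC 1) l.
Definition Csum {A} (l : list A) (F : A -> C) : C :=
  fold_right (fun a acc => Cplus (F a) acc) (RtoC 0) l.
Definition Rsum {A} (l : list A) (F : A -> R) : R :=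
  fold_right (fun a acc => F a + acc) 0 l.

Fixpoint pairs_lt (l : list nat) : list (nat * nat) :=
  match l with
  | [] => []
  | a :: l' => map (fun b => (a, b)) l' ++ pairs_lt l'
  end.

(* The ASEP (labelled positions, list of length N, increasing)          *)

Definition asep_move (X : list Z) (k : nat) (d : Z) : list Z :=
  let target := (nth k X 0 + d)%Z in
  if existsb (Z.eqb target) X then X
  else firstn k X ++ target :: skipn (S k) X.

(* Jump-chain (uniformization) kernel: at each ring of the superposed
   rate-N Poisson clock a uniformly chosen particle attempts a jump right
   (prob p) or left (prob 1-p).
   asep_steps p N n X E = probability that after n attempts the
   configuration lies in the event E. *)
Fixpoint asep_steps (p : R) (N : nat) (n : nat) (X : list Z)
    (E : list Z -> bool) : R :=
  match n with
  | O => if E X then 1 else 0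
  | S n' =>
      Rsum (seq 0 N) (fun k =>
        / INR N * (p * asep_steps p N n' (asep_move X k 1) E
                   + (1 - p) * asep_steps p N n' (asep_move X k (-1)) E))
  end.

(* P_Y( X(t) in E ) for the continuous-time N-particle ASEP:
   each particle carries an independent rate-1 exponential clock, so the
   number of attempted jumps up to time t is Poisson(N t). *)
Definition asep_prob (p : R) (N : nat) (Y : list Z) (t : R)
    (E : list Z -> bool) : R :=
  Series (fun n => exp (- (INR N * t)) * (INR N * t) ^ n / INR (fact n)
                   * asep_steps p N n Y E).

Definition first_positions_event (xs : list Z) (X : list Z) : bool :=
  if list_eq_dec Z.eq_dec (firstn (length xs) X) xs then true else false.

Definition fpq (p : R) (a b : C) : C :=
  Cminus (Cplus (RtoC p) (Cmult (RtoC (1 - p)) (Cmult a b))) a.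
Definition epsq (p : R) (z : C) : C :=
  Cminus (Cplus (Cmult (RtoC p) (Cinv z)) (Cmult (RtoC (1 - p)) z)) (RtoC 1).

Fixpoint tuples (dom : list nat) (k : nat) : list (list nat) :=
  match k with
  | O => [[]]
  | S k' => flat_map (fun a => map (cons a) (tuples dom k')) dom
  end.

Fixpoint nodupb (l : list nat) : bool :=
  match l with
  | [] => true
  | a :: l' => negb (existsb (Nat.eqb a) l') && nodupb l'
  end.

Definition Lambdas (N k : nat) : list (list nat) :=
  filter nodupb (tuples (seq 1 N) k).

Fixpoint inversions (l : list nat) : nat :=
  match l with
  | [] => O
  | a :: l' => length (filter (fun b => Nat.ltb b a) l') + inversions l'
  end.

Definition sgnLambda (L : list nat) : C :=
  if Nat.even (inversions L) then RtoC 1 else RtoC (-1).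

Definition inL (L : list nat) (i : nat) : bool := existsb (Nat.eqb i) L.

Definition upd (env : nat -> C) (k : nat) (z : C) : nat -> C :=
  fun j => if Nat.eqb j k then z else env j.

Definition circ (r th : R) : C := (r * cos th, r * sin th).

(* one contour integral  (1/(2 pi i)) \oint_{|xi|=r} g(xi) dxi,
   parametrised xi = r e^{i th}, dxi = i r e^{i th} dth *)
Definition contour (r : R) (g : C -> C) : C :=
  Cmult (Cinv (Cmult (RtoC (2 * PI)) Ci))
    (@RInt C_R_CompleteNormedModule
       (fun th => Cmult (g (circ r th)) (Cmult Ci (circ r th))) 0 (2 * PI)).

Fixpoint contour_n (r : R) (n : nat) (F : (nat -> C) -> C) : C :=
  match n with
  | O => F (fun _ => RtoC 0)
  | S n' => contour_n r n' (fun env => contour r (fun z => F (upd env n z)))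
  end.

Definition integrand (p t : R) (N m : nat) (Y xs : list Z) (L : list nat)
    (xi : nat -> C) : C :=
  let idx := seq 1 N in
  let f := fpq p in
  let ell i := nth (i - 1) L O in
  let notL := filter (fun j => negb (inL L j)) idx in
  let xm := nth (m - 1) xs 0%Z in
  let num1 := Cprod (filter (inL L) idx) (fun i =>
                Cprod notL (fun j => f (xi i) (xi j))) in
  let num2 := Cprod (pairs_lt (seq 1 (m - 1)))
                (fun ij => f (xi (ell (fst ij))) (xi (ell (snd ij)))) in
  let den := Cprod (pairs_lt idx) (fun ij => f (xi (fst ij)) (xi (snd ij))) in
  let fac1 := Cminus (RtoC 1) (Cprod notL (fun j => xi j)) in
  let vdm := Cprod (pairs_lt notL) (fun ij => Cminus (xi (snd ij)) (xi (fst ij))) in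
  let den2 := Cprod notL (fun j => Cminus (RtoC 1) (xi j)) in
  let pw1 := Cprod (seq 1 (m - 1)) (fun i => Cpowz (xi (ell i)) (nth (i - 1) xs 0%Z)) in
  let pw2 := Cprod notL (fun j => Cpowz (xi j) xm) in
  let pw3 := Cprod idx (fun i => Cpowz (xi i) (- nth (i - 1) Y 0%Z - 1)%Z) in
  let ex := cexp (Cmult (Csum idx (fun i => epsq p (xi i))) (RtoC t)) in
  Cmult (Cdiv (Cmult num1 num2) den)
   (Cmult fac1 (Cmult (Cdiv vdm den2) (Cmult pw1 (Cmult pw2 (Cmult pw3 ex))))).

Definition lambda_sign (m : nat) (L : list nat) : C :=
  sgnZ (fold_right Z.add 0%Z
          (map (fun i => (Z.of_nat (nth (i - 1) L O) - Z.of_nat i)%Z)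
               (seq 1 (m - 1)))).

Definition asep_formula (p t r : R) (N m : nat) (Y xs : list Z) : C :=
  Csum (Lambdas N (m - 1)) (fun L =>
    Cmult (Cmult (lambda_sign m L) (sgnLambda L))
      (Cmult (RtoC (p ^ ((N - m + 1) * (N - m) / 2)))
             (contour_n r N (integrand p t N m Y xs L)))).

(* "r so small that all nonzero poles of the integrand lie outside C_r":
   the only denominators producing nonzero poles are f(xi_i,xi_j) and
   1 - xi_j; we require them not to vanish on the closed disc |xi| <= r. *)
Definition small_radius (p r : R) : Prop :=
  0 < r /\ r < 1 /\
  forall a b : C, Cmod a <= r -> Cmod b <= r -> fpq p a b <> RtoC 0.

(* Main.v *)
(** Expand [e^{eps t}] as a Poisson mixture of powers of [1 + (sum of eps) / N]: this reduces the
    formula to the discrete-time jump chain. There the integral solves the free backward recursion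
    in [Y]. At [y_(k+1) = y_k + 1] the boundary terms put a factor [f(xi_k, xi_(k+1))] in the
    integrand, which cancels its denominator and leaves an integrand antisymmetric under
    [xi_k <-> xi_(k+1)], so that exclusion holds automatically. The initial condition follows by
    induction on [N], integrating out [xi_N]: a term in which the exponent of [xi_N] does not
    exceed that of some other [xi_b] vanishes because [y_b < y_N], and modulo such terms, by
    partial fractions of the Vandermonde product over the factors [f(xi_b, xi_N)], the integrand
    becomes the one for [N - 1] particles. Contour integrals are handled on uniform limits of
    Laurent polynomials on the torus, where only the coefficient of [prod xi_i^(-1)] survives. *)
Require Import Defs.
From Stdlib Require Import Reals ZArith List Sorting.
From Coquelicot Require Import Coquelicot.
From Stdlib Require Import Lra Lia ZArith Arith List Sorting Permutation Bool IndefiniteDescription.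
Import ListNotations.
Open Scope R_scope.

(** The single terms of the sum over [Lambda] are in general not antisymmetric; only the whole sum
    is, so it is taken under the integral sign. Over the common denominator of all f(xi_i, xi_j), i
    < j, and all 1 - xi_i, it is built like a Laplace expansion that chooses the entries of [Lambda]
    one by one. Target positions are measured from x_1, which makes this sum a polynomial; being
    antisymmetric it is divisible by the Vandermonde product, and that factor keeps the weights of
    the partial fractions polynomial.

    Terms vanish by a count of degrees. Smallness of r gives r + (1-p) r^2 < p, so 1/f(xi_b, xi_z)
    is a power series in xi_b and xi_b xi_z, in which the degree in xi_z never exceeds that in xi_b.

    The power of p stems from f(b, 1) = p (1 - b). Removing one of k + 1 variables outside [Lambda]
    compares a product of k factors f(xi_b, xi_z) with its value p^k prod (1 - xi_b) at xi_z = 1;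
    the exponents k add up to 1 + ... + (N-m) = (N-m+1)(N-m)/2. *)

(** * Finite sums and products over lists *)

Lemma Csum_cons {A} (a : A) l F : Csum (a :: l) F = (F a + Csum l F)%C.
Proof. reflexivity. Qed.

Lemma Cprod_cons {A} (a : A) l F : Cprod (a :: l) F = (F a * Cprod l F)%C.
Proof. reflexivity. Qed.

Lemma Cprod_nil {A} (F : A -> C) : Cprod [] F = 1%C.
Proof. reflexivity. Qed.

Lemma Csum_ext {A} (l : list A) (F G : A -> C) :
  (forall a, In a l -> F a = G a) -> Csum l F = Csum l G.
Proof.
  induction l as [|a l IH]; intros H; [reflexivity|].
  rewrite !Csum_cons, IH by (intros; apply H; now right).
  now rewrite H by now left.
Qed.

Lemma Cprod_ext {A} (l : list A) (F G : A -> C) :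
  (forall a, In a l -> F a = G a) -> Cprod l F = Cprod l G.
Proof.
  induction l as [|a l IH]; intros H; [reflexivity|].
  rewrite !Cprod_cons, IH by (intros; apply H; now right).
  now rewrite H by now left.
Qed.

Lemma Csum_app {A} (l1 l2 : list A) (F : A -> C) :
  Csum (l1 ++ l2) F = (Csum l1 F + Csum l2 F)%C.
Proof.
  induction l1 as [|a l IH]; simpl app; rewrite ?Csum_cons, ?IH.
  - unfold Csum at 2; simpl; ring.
  - ring.
Qed.

Lemma Cprod_app {A} (l1 l2 : list A) (F : A -> C) :
  Cprod (l1 ++ l2) F = (Cprod l1 F * Cprod l2 F)%C.
Proof.
  induction l1 as [|a l IH]; simpl app; rewrite ?Cprod_cons, ?IH.
  - unfold Cprod at 2; simpl; ring.
  - ring.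
Qed.

Lemma Csum_map {A B} (g : A -> B) l (F : _ -> C) :
  Csum (map g l) F = Csum l (fun a => F (g a)).
Proof.
  induction l as [|a l IH]; [reflexivity|].
  simpl map; now rewrite !Csum_cons, IH.
Qed.

Lemma Cprod_map {A B} (g : A -> B) l (F : _ -> C) :
  Cprod (map g l) F = Cprod l (fun a => F (g a)).
Proof.
  induction l as [|a l IH]; [reflexivity|].
  simpl map; now rewrite !Cprod_cons, IH.
Qed.

Lemma Csum_flat_map {A B} (g : A -> list B) l (F : _ -> C) :
  Csum (flat_map g l) F = Csum l (fun a => Csum (g a) F).
Proof.
  induction l as [|a l IH]; [reflexivity|].
  simpl flat_map; now rewrite Csum_app, Csum_cons, IH.
Qed.

Lemma Csum_plus {A} (l : list A) (F G : A -> C) :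
  Csum l (fun a => F a + G a)%C = (Csum l F + Csum l G)%C.
Proof.
  induction l as [|a l IH].
  - unfold Csum; simpl; ring.
  - rewrite !Csum_cons, IH; ring.
Qed.

Lemma Csum_scal {A} (l : list A) (c : C) F :
  Csum l (fun a => c * F a)%C = (c * Csum l F)%C.
Proof.
  induction l as [|a l IH].
  - unfold Csum; simpl; ring.
  - rewrite !Csum_cons, IH; ring.
Qed.

Lemma Csum_zero {A} (l : list A) (F : A -> C) :
  (forall a, In a l -> F a = 0%C) -> Csum l F = 0%C.
Proof.
  induction l as [|a l IH]; intros H; [reflexivity|].
  rewrite Csum_cons, H, IH; [ring | intros; apply H; now right | now left].
Qed.

Lemma Csum_minus {A} (l : list A) (F G : A -> C) :
  Csum l (fun a => F a - G a)%C = (Csum l F - Csum l G)%C.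
Proof.
  induction l as [|a l IH].
  - unfold Csum; simpl; ring.
  - rewrite !Csum_cons, IH; ring.
Qed.

Lemma Csum_exchange {A B} (l : list A) (l' : list B) (F : A -> B -> C) :
  Csum l (fun a => Csum l' (F a)) = Csum l' (fun b => Csum l (fun a => F a b)).
Proof.
  induction l as [|a l IH].
  - symmetry; now apply Csum_zero.
  - rewrite Csum_cons, IH, <- Csum_plus; now apply Csum_ext.
Qed.

Lemma Cprod_mult {A} (l : list A) (F G : A -> C) :
  Cprod l (fun a => F a * G a)%C = (Cprod l F * Cprod l G)%C.
Proof.
  induction l as [|a l IH].
  - unfold Cprod; simpl; ring.
  - rewrite !Cprod_cons, IH; ring.
Qed.

Lemma Cprod_perm {A} (l l' : list A) (F : A -> C) :
  Permutation l l' -> Cprod l F = Cprod l' F.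
Proof.
  induction 1; rewrite ?Cprod_cons; try congruence; ring.
Qed.

Lemma Csum_perm {A} (l l' : list A) (F : A -> C) :
  Permutation l l' -> Csum l F = Csum l' F.
Proof.
  induction 1; rewrite ?Csum_cons; try congruence; ring.
Qed.

Lemma Cprod_nz {A} (l : list A) (F : A -> C) :
  (forall a, In a l -> F a <> 0%C) -> Cprod l F <> 0%C.
Proof.
  induction l as [|a l IH]; intros H.
  - apply C1_nz.
  - rewrite Cprod_cons; apply Cmult_neq_0;
      [apply H; now left | apply IH; intros; apply H; now right].
Qed.

Lemma Cprod_inv {A} (l : list A) (F : A -> C) :
  (forall a, In a l -> F a <> 0%C) ->
  Cprod l (fun a => / F a)%C = (/ Cprod l F)%C.
Proof.
  induction l as [|a l IH]; intros H.
  - unfold Cprod; simpl; field.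
  - rewrite !Cprod_cons, IH by (intros; apply H; now right).
    field; split; [apply Cprod_nz; intros; apply H; now right | apply H; now left].
Qed.

(** * Integer powers *)

Lemma Cpowz_1 (z : C) : Cpowz z 1 = z.
Proof. unfold Cpowz; simpl; ring. Qed.

Lemma Cpowz_of_nat (z : C) n : Cpowz z (Z.of_nat n) = (z ^ n)%C.
Proof.
  destruct n; [reflexivity|].
  unfold Cpowz; cbn [Z.of_nat]; now rewrite SuccNat2Pos.id_succ.
Qed.

Lemma Cpowz_opp_nat (z : C) n : z <> 0%C -> Cpowz z (- Z.of_nat n) = (/ z ^ n)%C.
Proof.
  intros Hz; destruct n.
  - change (RtoC 1 = / RtoC 1)%C; field.
  - unfold Cpowz; cbn [Z.of_nat Z.opp]; now rewrite SuccNat2Pos.id_succ.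
Qed.

Lemma Cpowz_succ (z : C) n : z <> 0%C -> Cpowz z (n + 1) = (Cpowz z n * z)%C.
Proof.
  intros Hz; destruct (Z_lt_le_dec n 0) as [Hn|Hn].
  - replace n with (- Z.of_nat (S (Z.to_nat (- n - 1))))%Z by lia.
    replace (- Z.of_nat (S (Z.to_nat (- n - 1))) + 1)%Z
      with (- Z.of_nat (Z.to_nat (- n - 1)))%Z by lia.
    rewrite !Cpowz_opp_nat, Cpow_S by assumption.
    field; split; [now apply Cpow_nz | assumption].
  - replace n with (Z.of_nat (Z.to_nat n)) by lia.
    replace (Z.of_nat (Z.to_nat n) + 1)%Z with (Z.of_nat (S (Z.to_nat n))) by lia.
    rewrite !Cpowz_of_nat, Cpow_S; ring.
Qed.

Lemma Cpowz_add_nat (z : C) n k :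
  z <> 0%C -> Cpowz z (n + Z.of_nat k) = (Cpowz z n * z ^ k)%C.
Proof.
  intros Hz; induction k as [|k IH].
  - rewrite Z.add_0_r; simpl; ring.
  - replace (n + Z.of_nat (S k))%Z with (n + Z.of_nat k + 1)%Z by lia.
    rewrite Cpowz_succ, IH, Cpow_S by assumption; ring.
Qed.

Lemma Cpowz_add (z : C) n k : z <> 0%C -> Cpowz z (n + k) = (Cpowz z n * Cpowz z k)%C.
Proof.
  intros Hz; destruct (Z_lt_le_dec k 0) as [Hk|Hk].
  - set (j := Z.to_nat (- k)).
    assert (E : Cpowz z n = (Cpowz z (n + k) * z ^ j)%C).
    { rewrite <- Cpowz_add_nat by assumption; f_equal; lia. }
    rewrite E; replace k with (- Z.of_nat j)%Z at 3 by lia.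
    rewrite Cpowz_opp_nat by assumption.
    field; now apply Cpow_nz.
  - rewrite <- (Z2Nat.id k) by lia; now rewrite Cpowz_add_nat, Cpowz_of_nat.
Qed.

Lemma Cpowz_neg1 (z : C) : z <> 0%C -> Cpowz z (-1) = (/ z)%C.
Proof. intros Hz; simpl; f_equal; ring. Qed.

Lemma Cmod_Cpowz (z w : C) n : Cmod z = Cmod w -> z <> 0%C ->
  Cmod (Cpowz z n) = Cmod (Cpowz w n).
Proof.
  intros E Hz.
  assert (Hw : w <> 0%C).
  { intros H; apply Hz, Cmod_eq_0; rewrite E, H; apply Cmod_0. }
  destruct n; simpl.
  - reflexivity.
  - now rewrite !Cmod_pow, E.
  - rewrite !Cmod_inv by now apply Cpow_nz. now rewrite !Cmod_pow, E.
Qed.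

Lemma Cprod_Cpowz_add {A} (l : list A) (x : A -> C) e k :
  (forall a, In a l -> x a <> 0%C) ->
  Cprod l (fun a => Cpowz (x a) (e a + k a)) =
  (Cprod l (fun a => Cpowz (x a) (e a)) * Cprod l (fun a => Cpowz (x a) (k a)))%C.
Proof.
  intros H; rewrite <- Cprod_mult; apply Cprod_ext; intros; now apply Cpowz_add, H.
Qed.

(** * Contour integrals *)

(** Powers of a point of the circle leave the circle, so the modulus is a parameter. The body is
    that of [circ], and the two are exchanged by conversion. *)
Definition polar (rho phi : R) : C := (rho * cos phi, rho * sin phi).

Lemma polar_mult r1 r2 a b : (polar r1 a * polar r2 b)%C = polar (r1 * r2) (a + b).
Proof.
  unfold polar, Cmult; simpl; rewrite cos_plus, sin_plus; f_equal; ring.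
Qed.

Lemma Cmod_polar r a : 0 <= r -> Cmod (polar r a) = r.
Proof.
  intros Hr; unfold Cmod, polar; simpl fst; simpl snd.
  replace ((r * cos a) ^ 2 + (r * sin a) ^ 2)
    with (r ^ 2 * (Rsqr (sin a) + Rsqr (cos a))) by (unfold Rsqr; ring).
  rewrite sin2_cos2, Rmult_1_r; now apply sqrt_pow2.
Qed.

Lemma Cmod_nz (z : C) r : 0 < r -> Cmod z = r -> z <> 0%C.
Proof. intros Hr H E; rewrite E, Cmod_0 in H; lra. Qed.

Lemma polar_nz r a : 0 < r -> polar r a <> 0%C.
Proof. intros Hr; apply (Cmod_nz _ r Hr), Cmod_polar; lra. Qed.

Lemma polar_pow r a n : (polar r a ^ n)%C = polar (r ^ n) (INR n * a).
Proof.
  induction n as [|n IH].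
  - unfold polar; simpl; rewrite Rmult_0_l, cos_0, sin_0.
    unfold RtoC; f_equal; ring.
  - rewrite Cpow_S, IH, polar_mult, S_INR; f_equal; ring.
Qed.

Lemma polar_inv r a : 0 < r -> (/ polar r a)%C = polar (/ r) (- a).
Proof.
  intros Hr.
  assert (E : (polar r a * polar (/ r) (- a) = 1)%C).
  { rewrite polar_mult, Rinv_r by lra; replace (a + - a) with 0 by ring.
    unfold polar; rewrite cos_0, sin_0; unfold RtoC; f_equal; ring. }
  rewrite <- (Cmult_1_l (polar (/ r) (- a))),
    <- (Cinv_l (polar r a)), <- Cmult_assoc, E by now apply polar_nz.
  ring.
Qed.

(** The modulus [rho] stays existential: for a nonzero frequency the integral over a full turn
    vanishes whatever its value. *)
Lemma polar_Cpowz r n : 0 < r ->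
  exists rho, forall b, Cpowz (polar r b) n = polar rho (IZR n * b).
Proof.
  intros Hr; destruct (Z_lt_le_dec n 0) as [Hn|Hn].
  - exists (/ (r ^ Z.to_nat (- n))); intros b.
    assert (Hp : 0 < r ^ Z.to_nat (- n)) by now apply pow_lt.
    replace n with (- Z.of_nat (Z.to_nat (- n)))%Z at 1 by lia.
    rewrite Cpowz_opp_nat, polar_pow, polar_inv by (try apply polar_nz; easy).
    f_equal; rewrite INR_IZR_INZ, Z2Nat.id, opp_IZR by lia; ring.
  - exists (r ^ Z.to_nat n); intros b.
    replace n with (Z.of_nat (Z.to_nat n)) at 1 by lia.
    rewrite Cpowz_of_nat, polar_pow.
    f_equal; rewrite INR_IZR_INZ, Z2Nat.id by lia; ring.
Qed.

Lemma cos_sin_IZR_2PI n : cos (IZR n * (2 * PI)) = 1 /\ sin (IZR n * (2 * PI)) = 0.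
Proof.
  assert (H : forall k, cos (INR k * (2 * PI)) = 1 /\ sin (INR k * (2 * PI)) = 0).
  { intros k; replace (INR k * (2 * PI)) with (0 + 2 * INR k * PI) by ring.
    now rewrite cos_period, sin_period, cos_0, sin_0. }
  destruct (Z_lt_le_dec n 0) as [Hn|Hn].
  - destruct (H (Z.to_nat (- n))) as [H1 H2].
    rewrite INR_IZR_INZ, Z2Nat.id, opp_IZR in H1, H2 by lia.
    rewrite Ropp_mult_distr_l_reverse in H1, H2.
    rewrite cos_neg in H1; rewrite sin_neg in H2; split; lra.
  - destruct (H (Z.to_nat n)) as [H1 H2].
    now rewrite INR_IZR_INZ, Z2Nat.id in H1, H2 by lia.
Qed.

(** Relational form of [contour], with 2 pi i moved to the other side; it carries the existence of
    the integral along, on which linearity depends. *)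
Definition is_contour (r : R) (g : C -> C) (v : C) : Prop :=
  @is_RInt C_R_NormedModule (fun th => (g (circ r th) * (Ci * circ r th))%C)
    0 (2 * PI) (RtoC (2 * PI) * Ci * v)%C.

Lemma two_pi_i_nz : (RtoC (2 * PI) * Ci)%C <> 0%C.
Proof.
  intros H; apply (f_equal snd) in H; simpl in H.
  generalize PI_RGT_0; lra.
Qed.

Lemma contour_unique r g v : is_contour r g v -> contour r g = v.
Proof.
  intros H; unfold contour.
  rewrite (@is_RInt_unique C_R_CompleteNormedModule _ _ _ _ H).
  generalize two_pi_i_nz; intros Hp.
  rewrite Cmult_assoc, Cinv_l by assumption; ring.
Qed.

Lemma is_contour_ext r g h v :
  (forall th, g (circ r th) = h (circ r th)) -> is_contour r g v -> is_contour r h v.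
Proof.
  intros E; apply is_RInt_ext; intros th _; now rewrite E.
Qed.

Lemma is_contour_plus r g h v w :
  is_contour r g v -> is_contour r h w ->
  is_contour r (fun z => g z + h z)%C (v + w)%C.
Proof.
  intros H1 H2; unfold is_contour.
  replace (RtoC (2 * PI) * Ci * (v + w))%C
    with (RtoC (2 * PI) * Ci * v + RtoC (2 * PI) * Ci * w)%C by ring.
  generalize (is_RInt_plus _ _ _ _ _ _ H1 H2); apply is_RInt_ext; intros th _.
  change (g (circ r th) * (Ci * circ r th) + h (circ r th) * (Ci * circ r th) =
    (g (circ r th) + h (circ r th)) * (Ci * circ r th))%C; ring.
Qed.

Lemma is_contour_0 r : is_contour r (fun _ => 0%C) 0%C.
Proof.
  unfold is_contour.
  replace (RtoC (2 * PI) * Ci * 0)%C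
    with (@scal R_AbsRing C_R_NormedModule (2 * PI - 0) (RtoC 0)).
  - generalize (@is_RInt_const C_R_NormedModule 0 (2 * PI) (RtoC 0)).
    apply is_RInt_ext; intros; change (RtoC 0 = 0 * (Ci * circ r x))%C; ring.
  - apply (f_equal2 (@pair R R)); unfold scal, mult; simpl; unfold mult; simpl; ring.
Qed.

(** The scalars of [C_R_NormedModule] are real, so the product with a complex constant is split into
    real and imaginary parts. *)
Lemma is_RInt_Cscal (c : C) (f : R -> C) a b (v : C) :
  @is_RInt C_R_NormedModule f a b v ->
  @is_RInt C_R_NormedModule (fun t => c * f t)%C a b (c * v)%C.
Proof.
  intros H.
  assert (H1 : is_RInt (fun t => fst (f t)) a b (fst v))
    by exact (@is_RInt_fct_extend_fst R_NormedModule R_NormedModule f a b v H).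
  assert (H2 : is_RInt (fun t => snd (f t)) a b (snd v))
    by exact (@is_RInt_fct_extend_snd R_NormedModule R_NormedModule f a b v H).
  apply (@is_RInt_fct_extend_pair R_NormedModule R_NormedModule
    (fun t => c * f t)%C a b (fst (c * v)%C) (snd (c * v)%C)); simpl.
  - exact (is_RInt_minus _ _ _ _ _ _ (is_RInt_scal _ _ _ (fst c) _ H1)
             (is_RInt_scal _ _ _ (snd c) _ H2)).
  - exact (is_RInt_plus _ _ _ _ _ _ (is_RInt_scal _ _ _ (fst c) _ H2)
             (is_RInt_scal _ _ _ (snd c) _ H1)).
Qed.

Lemma is_contour_scal r (c : C) g v :
  is_contour r g v -> is_contour r (fun z => c * g z)%C (c * v)%C.
Proof.
  intros H; unfold is_contour.
  replace (RtoC (2 * PI) * Ci * (c * v))%C with (c * (RtoC (2 * PI) * Ci * v))%C by ring.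
  generalize (is_RInt_Cscal c _ _ _ _ H); apply is_RInt_ext; intros th _.
  change (c * (g (circ r th) * (Ci * circ r th)) = c * g (circ r th) * (Ci * circ r th))%C; ring.
Qed.

Lemma is_contour_Csum {A} r (l : list A) (g : A -> C -> C) v :
  (forall a, In a l -> is_contour r (g a) (v a)) ->
  is_contour r (fun z => Csum l (fun a => g a z)) (Csum l v).
Proof.
  induction l as [|a l IH]; intros H.
  - apply is_contour_0.
  - apply is_contour_plus.
    + apply H; now left.
    + apply IH; intros; apply H; now right.
Qed.

(** The residue computation: on the circle z^n dz becomes i z^(n+1) dth, which is constant for n =
    -1 and otherwise a pure oscillation of nonzero integer frequency with a periodic primitive. *)
Lemma is_contour_Cpowz r n : 0 < r ->
  is_contour r (fun z => Cpowz z n) (if Z.eqb n (-1) then 1%C else 0%C).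
Proof.
  intros Hr; unfold is_contour.
  assert (E : forall th, (Cpowz (circ r th) n * (Ci * circ r th) =
    Ci * Cpowz (circ r th) (n + 1))%C).
  { intros th; rewrite Cpowz_succ by now apply (polar_nz r th). ring. }
  destruct (Z.eqb_spec n (-1)) as [Hn|Hn].
  - subst n; replace (RtoC (2 * PI) * Ci * 1)%C with (scal (2 * PI - 0) Ci).
    + generalize (@is_RInt_const C_R_NormedModule 0 (2 * PI) Ci); apply is_RInt_ext.
      intros th _; rewrite E; change (Ci = Ci * 1)%C; ring.
    + apply (f_equal2 (@pair R R)); unfold scal, mult; simpl; unfold mult; simpl; ring.
  - destruct (polar_Cpowz r (n + 1) Hr) as (rho & H).
    assert (Hk : IZR (n + 1) <> 0) by (apply not_0_IZR; lia).
    set (k := IZR (n + 1)) in *.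
    rewrite Cmult_0_r.
    apply (@is_RInt_ext C_R_NormedModule
             (fun th => (- (rho * sin (k * th)), rho * cos (k * th)))).
    { intros th _; rewrite E; change (circ r th) with (polar r th); rewrite H.
      unfold polar, Cmult, Ci; simpl; f_equal; ring. }
    destruct (cos_sin_IZR_2PI (n + 1)) as [C1 S1]; fold k in C1, S1.
    apply (@is_RInt_fct_extend_pair R_NormedModule R_NormedModule _ 0 (2 * PI) 0 0); simpl.
    + replace 0 with (minus (rho / k * cos (k * (2 * PI))) (rho / k * cos (k * 0))) at 2.
      * apply (is_RInt_derive (fun th => rho / k * cos (k * th))).
        -- intros x _; auto_derive; [easy | now field].
        -- intros x _; apply (ex_derive_continuous (fun t => - (rho * sin (k * t)))).
           auto_derive; easy.
      * rewrite C1, Rmult_0_r, cos_0; unfold minus, plus, opp; simpl; ring.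
    + replace 0 with (minus (rho / k * sin (k * (2 * PI))) (rho / k * sin (k * 0))) at 2.
      * apply (is_RInt_derive (fun th => rho / k * sin (k * th))).
        -- intros x _; auto_derive; [easy | now field].
        -- intros x _; apply (ex_derive_continuous (fun t => (rho * cos (k * t)))).
           auto_derive; easy.
      * rewrite S1, (Rmult_0_r k), sin_0; unfold minus, plus, opp; simpl; ring.
Qed.

Lemma Cmod_Ci_circ r th : 0 < r -> Cmod (Ci * circ r th)%C = r.
Proof.
  intros Hr; change (circ r th) with (polar r th); rewrite Cmod_mult, Cmod_polar by lra.
  unfold Cmod, Ci; simpl; replace (0 * (0 * 1) + 1 * (1 * 1)) with 1 by ring.
  rewrite sqrt_1; ring.
Qed.

Lemma contour_bound r g v M : 0 < r ->
  (forall th, Cmod (g (circ r th)) <= M) -> is_contour r g v -> Cmod v <= r * M.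
Proof.
  intros Hr HM H.
  assert (Hpi := PI_RGT_0).
  assert (B : Cmod (RtoC (2 * PI) * Ci * v)%C <= (2 * PI - 0) * (M * r)).
  { rewrite Cmod_norm.
    apply (@norm_RInt_le_const C_R_NormedModule _ 0 (2 * PI) _ (M * r)) with (3 := H); [lra|].
    intros th _.
    apply Rle_trans with (Cmod (g (circ r th) * (Ci * circ r th))%C);
      [right; exact (eq_sym (Cmod_norm _))|].
    rewrite Cmod_mult, Cmod_Ci_circ by easy; apply Rmult_le_compat_r; [lra | apply HM]. }
  rewrite !Cmod_mult in B.
  replace (Cmod Ci) with 1 in B.
  2:{ assert (H1 := Cmod_Ci_circ 1 0 Rlt_0_1); rewrite Cmod_mult in H1.
      change (circ 1 0) with (polar 1 0) in H1; rewrite Cmod_polar in H1; lra. }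
  rewrite Cmod_R, Rabs_right in B by lra.
  apply (Rmult_le_reg_l (2 * PI)); lra.
Qed.

(** A uniform limit of integrable functions is integrable; tolerance 1/(n+1) provides the sequence,
    and each Laurent polynomial is integrated term by term. *)
Lemma ex_contour_lim r (g : C -> C) : 0 < r ->
  (forall eps, 0 < eps -> exists l : list (C * Z), forall th,
     Cmod (g (circ r th) - Csum l (fun cn => fst cn * Cpowz (circ r th) (snd cn)))%C <= eps) ->
  exists v, is_contour r g v.
Proof.
  intros Hr H.
  destruct (functional_choice (fun n l => forall th, Cmod (g (circ r th) -
      Csum l (fun cn => fst cn * Cpowz (circ r th) (snd cn)))%C <= / INR (S n)))
    as [l Hl].
  { intros n; apply H, Rinv_0_lt_compat, lt_0_INR; lia. }
  pose (G := fun (n : nat) z => Csum (l n) (fun cn => fst cn * Cpowz z (snd cn))%C).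
  pose (V := fun n => Csum (l n) (fun cn => fst cn * (if Z.eqb (snd cn) (-1) then 1 else 0))%C).
  assert (HG : forall n, is_contour r (G n) (V n)).
  { intros n; apply is_contour_Csum.
    intros cn _; now apply is_contour_scal, is_contour_Cpowz. }
  destruct (@filterlim_RInt nat C_R_CompleteNormedModule
    (fun n th => (G n (circ r th) * (Ci * circ r th))%C) 0 (2 * PI) Hierarchy.eventually _
    (fun th => (g (circ r th) * (Ci * circ r th))%C)
    (fun n => (RtoC (2 * PI) * Ci * V n)%C)) as (If & _ & HI).
  - exact HG.
  - apply filterlim_locally; intros eps.
    destruct (nfloor_ex (r / eps)) as [n0 [_ Hn0]].
    { apply Rlt_le, Rdiv_lt_0_compat; [easy | apply cond_pos]. }
    exists n0; intros n Hn th.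
    apply (@norm_compat1 R_AbsRing C_R_NormedModule).
    apply Rle_lt_trans with (Cmod (G n (circ r th) * (Ci * circ r th) -
        g (circ r th) * (Ci * circ r th))%C); [right; exact (eq_sym (Cmod_norm _))|].
    replace (G n (circ r th) * (Ci * circ r th) - g (circ r th) * (Ci * circ r th))%C
      with (- ((g (circ r th) - G n (circ r th)) * (Ci * circ r th)))%C by ring.
    rewrite Cmod_opp, Cmod_mult, Cmod_Ci_circ by easy.
    specialize (Hl n th); change (Csum _ _) with (G n (circ r th)) in Hl.
    assert (Hn' : r / eps < INR (S n)).
    { rewrite S_INR; apply le_INR in Hn; lra. }
    assert (0 < INR (S n)) by (apply lt_0_INR; lia).
    apply Rle_lt_trans with (/ INR (S n) * r); [now apply Rmult_le_compat_r; [lra|]|].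
    apply Rmult_lt_reg_l with (INR (S n)); [easy|].
    rewrite <- Rmult_assoc, Rinv_r, Rmult_1_l by lra.
    apply (Rmult_lt_compat_r eps) in Hn'; [|apply cond_pos].
    unfold Rdiv in Hn'; rewrite Rmult_assoc, Rinv_l in Hn'; [lra | apply Rgt_not_eq, cond_pos].
  - exists (/ (RtoC (2 * PI) * Ci) * If)%C; unfold is_contour.
    rewrite Cmult_assoc, Cinv_r, Cmult_1_l by apply two_pi_i_nz. exact HI.
Qed.

(** * Multiple contour integrals through Laurent polynomials on the torus *)

Definition torus (r : R) (N : nat) (xi : nat -> C) : Prop :=
  forall i, (1 <= i <= N)%nat -> Cmod (xi i) = r.

Definition mono (N : nat) (e : nat -> Z) (xi : nat -> C) : C :=
  Cprod (seq 1 N) (fun i => Cpowz (xi i) (e i)).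

Definition lpoly (N : nat) (l : list (C * (nat -> Z))) (xi : nat -> C) : C :=
  Csum l (fun ce => fst ce * mono N (snd ce) xi)%C.

(* Uniform limits on the torus of Laurent polynomials whose exponent vectors satisfy [E]. *)
Definition nice (r : R) (N : nat) (E : (nat -> Z) -> Prop) (F : (nat -> C) -> C) : Prop :=
  forall eps, 0 < eps -> exists l, Forall (fun ce => E (snd ce)) l /\
    forall xi, torus r N xi -> Cmod (F xi - lpoly N l xi)%C <= eps.

Definition anyE : (nat -> Z) -> Prop := fun _ => True.

(** The iterated residue of [lpoly]: the total coefficient of the monomial with every exponent -1.
    This functional is purely algebraic, so symmetry and linearity of multiple integrals can be read
    off it. *)
Definition coef (N : nat) (l : list (C * (nat -> Z))) : C :=
  Csum l (fun ce => fst ce *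
    (if forallb (fun i => Z.eqb (snd ce i) (-1)) (seq 1 N) then 1 else 0))%C.

Lemma torus_nz r N xi i : 0 < r -> torus r N xi -> (1 <= i <= N)%nat -> xi i <> 0%C.
Proof. intros Hr Ht Hi; apply (Cmod_nz _ r Hr), Ht, Hi. Qed.

Lemma torus_nz_seq r N xi i : 0 < r -> torus r N xi -> In i (seq 1 N) -> xi i <> 0%C.
Proof. intros Hr Ht Hi; apply in_seq in Hi; apply (torus_nz r N); auto; lia. Qed.

Lemma upd_same env k z : upd env k z k = z.
Proof. unfold upd; now rewrite Nat.eqb_refl. Qed.

Lemma upd_other env k z j : j <> k -> upd env k z j = env j.
Proof. intros H; unfold upd; now apply Nat.eqb_neq in H as ->. Qed.

Lemma torus_upd r N xi z : torus r N xi -> Cmod z = r -> torus r (S N) (upd xi (S N) z).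
Proof.
  intros Ht Hz i Hi; destruct (Nat.eq_dec i (S N)) as [->|H].
  - now rewrite upd_same.
  - rewrite upd_other by easy; apply Ht; lia.
Qed.

Lemma mono_upd N e xi z :
  mono (S N) e (upd xi (S N) z) = (mono N e xi * Cpowz z (e (S N)))%C.
Proof.
  unfold mono; rewrite seq_S, Cprod_app; f_equal.
  - apply Cprod_ext; intros i Hi; apply in_seq in Hi; rewrite upd_other by lia; easy.
  - simpl plus; rewrite Cprod_cons, upd_same; unfold Cprod; simpl; ring.
Qed.

Lemma mono_ext N e e' xi : (forall i, (1 <= i <= N)%nat -> e i = e' i) ->
  mono N e xi = mono N e' xi.
Proof.
  intros H; apply Cprod_ext; intros i Hi; apply in_seq in Hi; rewrite H by lia; easy.
Qed.

Lemma Cmod_circ r th : 0 < r -> Cmod (circ r th) = r.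
Proof. intros Hr; apply (Cmod_polar r th); lra. Qed.

(** Integration over the variable [S N] only annihilates coefficients; the spent exponent stays in
    the list, where [mono N] no longer looks at it. *)
Definition integrate_last (N : nat) (l : list (C * (nat -> Z))) : list (C * (nat -> Z)) :=
  map (fun ce => (fst ce * (if Z.eqb (snd ce (S N)) (-1) then 1 else 0), snd ce)%C) l.

Lemma is_contour_lpoly r N l env : 0 < r ->
  is_contour r (fun z => lpoly (S N) l (upd env (S N) z)) (lpoly N (integrate_last N l) env).
Proof.
  intros Hr; unfold lpoly, integrate_last; rewrite Csum_map; simpl.
  apply is_contour_ext with (fun z => Csum l (fun ce =>
     fst ce * mono N (snd ce) env * Cpowz z (snd ce (S N))))%C.
  { intros th; apply Csum_ext; intros ce _; rewrite mono_upd; ring. }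
  replace (Csum l _) with (Csum l (fun ce => fst ce * mono N (snd ce) env *
      (if Z.eqb (snd ce (S N)) (-1) then 1 else 0)))%C
    by (apply Csum_ext; intros; ring).
  apply is_contour_Csum.
  intros ce _; now apply is_contour_scal, is_contour_Cpowz.
Qed.

Lemma nice_ex_contour r N E F env : 0 < r -> nice r (S N) E F -> torus r N env ->
  exists v, is_contour r (fun z => F (upd env (S N) z)) v.
Proof.
  intros Hr HF Ht; apply ex_contour_lim; [easy|].
  intros eps Heps; destruct (HF eps Heps) as (l & _ & Hl).
  exists (map (fun ce => (fst ce * mono N (snd ce) env, snd ce (S N))%C) l).
  intros th.
  replace (Csum _ _) with (lpoly (S N) l (upd env (S N) (circ r th))).
  - apply Hl, torus_upd; [easy | now apply Cmod_circ].
  - unfold lpoly; rewrite Csum_map; apply Csum_ext; intros ce _; simpl.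
    rewrite mono_upd; ring.
Qed.

Lemma contour_lpoly_approx r N E F l eps env : 0 < r -> nice r (S N) E F ->
  (forall xi, torus r (S N) xi -> Cmod (F xi - lpoly (S N) l xi)%C <= eps) ->
  torus r N env ->
  Cmod (contour r (fun z => F (upd env (S N) z)) -
    lpoly N (integrate_last N l) env)%C <= r * eps.
Proof.
  intros Hr HF Hl Ht.
  destruct (nice_ex_contour r N E F env Hr HF Ht) as [v Hv].
  rewrite (contour_unique _ _ _ Hv).
  apply (contour_bound r (fun z => F (upd env (S N) z) +
    RtoC (-1) * lpoly (S N) l (upd env (S N) z))%C); [easy| |].
  - intros th.
    replace (F _ + _)%C with (F (upd env (S N) (circ r th)) -
       lpoly (S N) l (upd env (S N) (circ r th)))%C by ring.
    apply Hl, torus_upd; [easy | now apply Cmod_circ].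
  - replace (v - lpoly N (integrate_last N l) env)%C
      with (v + RtoC (-1) * lpoly N (integrate_last N l) env)%C by ring.
    apply is_contour_plus; [easy|].
    apply is_contour_scal, is_contour_lpoly; easy.
Qed.

(** [contour_n] integrates the last variable innermost, so each integration passes from N + 1 to N
    variables and multiplies the uniform error by r. *)
Lemma contour_n_approx r N E F l eps : 0 < r -> nice r N E F ->
  (forall xi, torus r N xi -> Cmod (F xi - lpoly N l xi)%C <= eps) ->
  Cmod (contour_n r N F - coef N l)%C <= r ^ N * eps.
Proof.
  intros Hr; revert E F l eps; induction N as [|N IH]; intros E F l eps HF Hl.
  - simpl; rewrite Rmult_1_l.
    replace (coef 0 l) with (lpoly 0 l (fun _ => RtoC 0)) by reflexivity.
    (* With no variables the torus condition is empty, so the dummy environment 0 of [contour_n]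
       lies on it. *)
    apply Hl; intros i Hi; lia.
  - simpl contour_n.
    replace (coef (S N) l) with (coef N (integrate_last N l)).
    + replace (r ^ S N * eps) with (r ^ N * (r * eps)) by (simpl; ring).
      apply (IH anyE).
      * intros e He; destruct (HF (e / r)) as (l' & _ & Hl').
        { now apply Rdiv_lt_0_compat. }
        exists (integrate_last N l'); split.
        { apply Forall_forall; intros; exact I. }
        intros xi Ht; replace e with (r * (e / r)) by (field; lra).
        now apply (contour_lpoly_approx r N E).
      * intros xi Ht; now apply (contour_lpoly_approx r N E).
    + unfold coef, integrate_last; rewrite Csum_map; apply Csum_ext; intros ce _.
      rewrite seq_S, forallb_app; simpl.
      destruct (Z.eqb _ _), (forallb _ _); simpl; ring.
Qed.

Lemma Cmod_le_all (z : C) : (forall eps, 0 < eps -> Cmod z <= eps) -> z = 0%C.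
Proof.
  intros H; apply Cmod_eq_0; destruct (Cmod_ge_0 z) as [Hz|Hz]; [|easy].
  specialize (H (Cmod z / 2)); lra.
Qed.

Lemma Ceq_minus (a b : C) : (a - b)%C = 0%C -> a = b.
Proof.
  intros H; replace a with (a - b + b)%C by ring; rewrite H; ring.
Qed.

(** Common engine for linearity, extensionality and symmetry of [contour_n]: approximants whose
    [coef] is close to [v] suffice. The constant [K] lets each application lose a fixed factor in
    the error. *)
Lemma contour_n_eq r N E F v K : 0 < r -> 0 <= K -> nice r N E F ->
  (forall eps, 0 < eps -> exists l,
     (forall xi, torus r N xi -> Cmod (F xi - lpoly N l xi)%C <= K * eps) /\
     Cmod (coef N l - v)%C <= K * eps) ->
  contour_n r N F = v.
Proof.
  intros Hr HK HF H; apply Ceq_minus, Cmod_le_all; intros eps Heps.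
  assert (Hp : 0 < r ^ N) by now apply pow_lt.
  set (K' := r ^ N * K + K + 1).
  assert (HK' : 0 < K') by (unfold K'; nra).
  destruct (H (eps / K')) as (l & A & B); [now apply Rdiv_lt_0_compat|].
  assert (D := contour_n_approx r N E F l _ Hr HF A).
  replace (contour_n r N F - v)%C with ((contour_n r N F - coef N l) + (coef N l - v))%C by ring.
  eapply Rle_trans; [apply Cmod_triangle|].
  assert (0 < eps / K') by now apply Rdiv_lt_0_compat.
  replace eps with (K' * (eps / K')) by (field; lra); unfold K' at 1; lra.
Qed.

Lemma contour_n_zero r N (E : (nat -> Z) -> Prop) F : 0 < r -> nice r N E F ->
  (forall e, E e -> exists i, (1 <= i <= N)%nat /\ e i <> (-1)%Z) ->
  contour_n r N F = 0%C.
Proof.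
  intros Hr HF HE; apply (contour_n_eq r N E F _ 1); [easy | lra | easy |].
  intros eps Heps; destruct (HF eps Heps) as (l & Hl & Ha).
  exists l; rewrite Rmult_1_l; split; [easy|].
  replace (coef N l) with (RtoC 0).
  - replace (0 - 0)%C with (RtoC 0) by ring; rewrite Cmod_0; lra.
  - symmetry; apply Csum_zero; intros ce Hce.
    destruct (HE (snd ce)) as (i & Hi & Hn).
    { rewrite Forall_forall in Hl; now apply Hl. }
    destruct (forallb _ _) eqn:Hf; [|ring].
    rewrite forallb_forall in Hf; specialize (Hf i).
    rewrite Z.eqb_eq in Hf; elim Hn; apply Hf, in_seq; lia.
Qed.

Lemma lpoly_app N l1 l2 xi : lpoly N (l1 ++ l2) xi = (lpoly N l1 xi + lpoly N l2 xi)%C.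
Proof. apply Csum_app. Qed.

Definition lscal (c : C) (l : list (C * (nat -> Z))) := map (fun ce => (c * fst ce, snd ce)%C) l.

Lemma lpoly_scal N c l xi : lpoly N (lscal c l) xi = (c * lpoly N l xi)%C.
Proof.
  unfold lpoly, lscal; rewrite Csum_map, <- Csum_scal; apply Csum_ext; intros; simpl; ring.
Qed.

Lemma coef_scal N c l : coef N (lscal c l) = (c * coef N l)%C.
Proof.
  unfold coef, lscal; rewrite Csum_map, <- Csum_scal; apply Csum_ext; intros; simpl; ring.
Qed.

Lemma Forall_lscal (E : (nat -> Z) -> Prop) c l :
  Forall (fun ce => E (snd ce)) l -> Forall (fun ce => E (snd ce)) (lscal c l).
Proof. intros H; apply Forall_map; exact H. Qed.

Lemma nice_lim r N E F :
  (forall eps, 0 < eps -> exists G, nice r N E G /\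
     forall xi, torus r N xi -> Cmod (F xi - G xi)%C <= eps) -> nice r N E F.
Proof.
  intros H eps Heps; destruct (H (eps / 2)) as (G & HG & Ha); [lra|].
  destruct (HG (eps / 2)) as (l & Hl & Hb); [lra|].
  exists l; split; [easy|]; intros xi Ht.
  replace (F xi - lpoly N l xi)%C with ((F xi - G xi) + (G xi - lpoly N l xi))%C by ring.
  eapply Rle_trans; [apply Cmod_triangle|].
  specialize (Ha xi Ht); specialize (Hb xi Ht); lra.
Qed.

Lemma nice_ext r N E F G :
  (forall xi, torus r N xi -> F xi = G xi) -> nice r N E F -> nice r N E G.
Proof.
  intros H HF eps Heps; destruct (HF eps Heps) as (l & Hl & Ha).
  exists l; split; [easy|]; intros xi Ht; rewrite <- H by easy; now apply Ha.
Qed.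

Lemma nice_weaken r N (E E' : (nat -> Z) -> Prop) F :
  (forall e, E e -> E' e) -> nice r N E F -> nice r N E' F.
Proof.
  intros H HF eps Heps; destruct (HF eps Heps) as (l & Hl & Ha).
  exists l; split; [|easy]; eapply Forall_impl; [|exact Hl]; intros; now apply H.
Qed.

Lemma nice_plus r N E F G :
  nice r N E F -> nice r N E G -> nice r N E (fun xi => F xi + G xi)%C.
Proof.
  intros HF HG eps Heps.
  destruct (HF (eps / 2)) as (l1 & H1 & A1); [lra|].
  destruct (HG (eps / 2)) as (l2 & H2 & A2); [lra|].
  exists (l1 ++ l2); split; [now apply Forall_app|]; intros xi Ht.
  rewrite lpoly_app.
  replace (F xi + G xi - (lpoly N l1 xi + lpoly N l2 xi))%C
    with ((F xi - lpoly N l1 xi) + (G xi - lpoly N l2 xi))%C by ring.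
  eapply Rle_trans; [apply Cmod_triangle|].
  specialize (A1 xi Ht); specialize (A2 xi Ht); lra.
Qed.

Lemma nice_scal r N E (c : C) F :
  nice r N E F -> nice r N E (fun xi => c * F xi)%C.
Proof.
  intros HF eps Heps.
  assert (Hc := Cmod_ge_0 c).
  destruct (HF (eps / (Cmod c + 1))) as (l & H1 & A1); [apply Rdiv_lt_0_compat; lra|].
  exists (lscal c l); split; [now apply Forall_lscal|]; intros xi Ht.
  rewrite lpoly_scal.
  replace (c * F xi - c * lpoly N l xi)%C with (c * (F xi - lpoly N l xi))%C by ring.
  rewrite Cmod_mult; specialize (A1 xi Ht).
  apply Rle_trans with (Cmod c * (eps / (Cmod c + 1))); [now apply Rmult_le_compat_l|].
  apply (Rmult_le_reg_r (Cmod c + 1)); [lra|].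
  replace (Cmod c * (eps / (Cmod c + 1)) * (Cmod c + 1)) with (Cmod c * eps) by (field; lra).
  nra.
Qed.

Lemma contour_n_bound r N E F M : 0 < r -> nice r N E F ->
  (forall xi, torus r N xi -> Cmod (F xi) <= M) -> Cmod (contour_n r N F) <= r ^ N * M.
Proof.
  intros Hr HF HM.
  replace (contour_n r N F) with (contour_n r N F - coef N [])%C
    by (unfold coef, Csum; simpl; ring).
  apply (contour_n_approx r N E); try easy.
  intros xi Ht; replace (F xi - lpoly N [] xi)%C with (F xi)
    by (unfold lpoly, Csum; simpl; ring).
  now apply HM.
Qed.

Lemma nice_coef_approx r N E F eps : 0 < r -> nice r N E F -> 0 < eps ->
  exists l, (forall xi, torus r N xi -> Cmod (F xi - lpoly N l xi)%C <= eps) /\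
    Cmod (coef N l - contour_n r N F)%C <= r ^ N * eps.
Proof.
  intros Hr HF Heps; destruct (HF eps Heps) as (l & _ & A); exists l; split; [easy|].
  replace (coef N l - contour_n r N F)%C with (- (contour_n r N F - coef N l))%C by ring.
  rewrite Cmod_opp; now apply (contour_n_approx r N E).
Qed.

Lemma contour_n_ext r N E F G : 0 < r -> nice r N E F ->
  (forall xi, torus r N xi -> F xi = G xi) -> contour_n r N F = contour_n r N G.
Proof.
  intros Hr HF H; symmetry; assert (Hp : 0 < r ^ N) by now apply pow_lt.
  apply (contour_n_eq r N E G _ (1 + r ^ N)); [easy | lra | now apply (nice_ext r N E F) |].
  intros eps Heps; destruct (nice_coef_approx r N E F eps Hr HF Heps) as (l & A & B).
  exists l; split; [|nra]; intros xi Ht; rewrite <- H by easy; specialize (A xi Ht); nra.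
Qed.

Lemma contour_n_plus r N E F G : 0 < r -> nice r N E F -> nice r N E G ->
  contour_n r N (fun xi => F xi + G xi)%C = (contour_n r N F + contour_n r N G)%C.
Proof.
  intros Hr HF HG; assert (Hp : 0 < r ^ N) by now apply pow_lt.
  apply (contour_n_eq r N E _ _ (2 + 2 * r ^ N)); [easy | lra | now apply nice_plus |].
  intros eps Heps; destruct (nice_coef_approx r N E F eps Hr HF Heps) as (l1 & A1 & B1).
  destruct (nice_coef_approx r N E G eps Hr HG Heps) as (l2 & A2 & B2).
  exists (l1 ++ l2); split.
  - intros xi Ht; rewrite lpoly_app.
    replace (F xi + G xi - (lpoly N l1 xi + lpoly N l2 xi))%C
      with ((F xi - lpoly N l1 xi) + (G xi - lpoly N l2 xi))%C by ring.
    eapply Rle_trans; [apply Cmod_triangle|]; specialize (A1 xi Ht); specialize (A2 xi Ht); nra.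
  - replace (coef N (l1 ++ l2) - (contour_n r N F + contour_n r N G))%C
      with ((coef N l1 - contour_n r N F) + (coef N l2 - contour_n r N G))%C
      by (unfold coef; rewrite Csum_app; ring).
    eapply Rle_trans; [apply Cmod_triangle|]; nra.
Qed.

Lemma contour_n_scal r N E (c : C) F : 0 < r -> nice r N E F ->
  contour_n r N (fun xi => c * F xi)%C = (c * contour_n r N F)%C.
Proof.
  intros Hr HF; assert (Hp : 0 < r ^ N) by now apply pow_lt.
  assert (Hc := Cmod_ge_0 c).
  apply (contour_n_eq r N E _ _ (Cmod c * (1 + r ^ N))); [easy | nra | now apply nice_scal |].
  intros eps Heps; destruct (nice_coef_approx r N E F eps Hr HF Heps) as (l & A & B).
  exists (lscal c l); split.
  - intros xi Ht; rewrite lpoly_scal.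
    replace (c * F xi - c * lpoly N l xi)%C with (c * (F xi - lpoly N l xi))%C by ring.
    rewrite Cmod_mult, Rmult_assoc; apply Rmult_le_compat_l; [easy|]; specialize (A xi Ht); nra.
  - rewrite coef_scal.
    replace (c * coef N l - c * contour_n r N F)%C with (c * (coef N l - contour_n r N F))%C by ring.
    rewrite Cmod_mult, Rmult_assoc; apply Rmult_le_compat_l; [easy | nra].
Qed.

Lemma nice_zero r N E : nice r N E (fun _ => 0%C).
Proof.
  intros eps Heps; exists []; split; [constructor|]; intros xi _.
  unfold lpoly, Csum; simpl; replace (RtoC 0 - RtoC 0)%C with (RtoC 0) by ring.
  rewrite Cmod_0; lra.
Qed.

Lemma nice_Csum {A} r N E (l : list A) (F : A -> (nat -> C) -> C) :
  (forall a, In a l -> nice r N E (F a)) -> nice r N E (fun xi => Csum l (fun a => F a xi)).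
Proof.
  induction l as [|a l IH]; intros H.
  - apply nice_zero.
  - apply nice_plus.
    + apply H; now left.
    + apply IH; intros; apply H; now right.
Qed.

Lemma contour_n_0 r N : 0 < r -> contour_n r N (fun _ => 0%C) = 0%C.
Proof.
  intros Hr; apply (contour_n_zero r N (fun _ => False)); [easy | apply nice_zero | easy].
Qed.

Lemma contour_n_Csum {A} r N E (l : list A) (F : A -> (nat -> C) -> C) : 0 < r ->
  (forall a, In a l -> nice r N E (F a)) ->
  contour_n r N (fun xi => Csum l (fun a => F a xi)) =
  Csum l (fun a => contour_n r N (F a)).
Proof.
  intros Hr; induction l as [|a l IH]; intros H.
  - now apply contour_n_0.
  - rewrite Csum_cons, <- IH by (intros; apply H; now right).
    apply (contour_n_plus r N E (F a) (fun xi => Csum l (fun a => F a xi))); [easy| |].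
    + apply H; now left.
    + apply nice_Csum; intros; apply H; now right.
Qed.

Lemma mono_Cmod r N e xi : 0 < r -> torus r N xi ->
  Cmod (mono N e xi) = Cmod (mono N e (fun _ => RtoC r)).
Proof.
  intros Hr Ht; unfold mono.
  assert (H : forall l, incl l (seq 1 N) ->
    Cmod (Cprod l (fun i => Cpowz (xi i) (e i))) =
    Cmod (Cprod l (fun i => Cpowz (RtoC r) (e i)))).
  { induction l as [|i l IH]; intros Hl; [reflexivity|].
    rewrite !Cprod_cons, !Cmod_mult, IH by (intros j Hj; apply Hl; now right); f_equal.
    assert (Hi : In i (seq 1 N)) by (apply Hl; now left).
    apply Cmod_Cpowz; [|now apply (torus_nz_seq r N)].
    rewrite Cmod_R, Rabs_right by lra; apply Ht; apply in_seq in Hi; lia. }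
  apply H, incl_refl.
Qed.

Lemma lpoly_bounded r N l : 0 < r ->
  exists M, 0 <= M /\ forall xi, torus r N xi -> Cmod (lpoly N l xi) <= M.
Proof.
  intros Hr; induction l as [|ce l (M & HM & H)].
  - exists 0; split; [lra|]; intros xi _; unfold lpoly, Csum; simpl; rewrite Cmod_0; lra.
  - exists (Cmod (fst ce) * Cmod (mono N (snd ce) (fun _ => RtoC r)) + M); split.
    + assert (0 <= Cmod (fst ce) * Cmod (mono N (snd ce) (fun _ => RtoC r)))
        by (apply Rmult_le_pos; apply Cmod_ge_0); lra.
    + intros xi Ht; unfold lpoly; rewrite Csum_cons.
      eapply Rle_trans; [apply Cmod_triangle|].
      rewrite Cmod_mult, (mono_Cmod r) by easy.
      apply Rplus_le_compat_l, H, Ht.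
Qed.

Lemma nice_bounded r N E F : 0 < r -> nice r N E F ->
  exists M, 0 < M /\ forall xi, torus r N xi -> Cmod (F xi) <= M.
Proof.
  intros Hr HF; destruct (HF 1) as (l & _ & Hl); [lra|].
  destruct (lpoly_bounded r N l Hr) as (M & HM & H).
  exists (1 + M); split; [lra|]; intros xi Ht.
  replace (F xi) with ((F xi - lpoly N l xi) + lpoly N l xi)%C by ring.
  eapply Rle_trans; [apply Cmod_triangle|].
  apply Rplus_le_compat; [now apply Hl | now apply H].
Qed.

Lemma mono_add r N e1 e2 xi : 0 < r -> torus r N xi ->
  mono N (fun i => (e1 i + e2 i)%Z) xi = (mono N e1 xi * mono N e2 xi)%C.
Proof.
  intros Hr Ht; apply Cprod_Cpowz_add; intros; now apply (torus_nz_seq r N).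
Qed.

Lemma nice_mult r N (E1 E2 E : (nat -> Z) -> Prop) F G : 0 < r ->
  (forall e1 e2, E1 e1 -> E2 e2 -> E (fun i => e1 i + e2 i)%Z) ->
  nice r N E1 F -> nice r N E2 G -> nice r N E (fun xi => F xi * G xi)%C.
Proof.
  intros Hr HE HF HG eps Heps.
  destruct (nice_bounded r N E1 F Hr HF) as (MF & HMF & BF).
  (* [l2] is chosen first, because the precision asked of [l1] depends on a bound for [l2]. *)
  destruct (HG (eps / 2 / MF)) as (l2 & H2 & A2).
  { apply Rdiv_lt_0_compat; lra. }
  destruct (lpoly_bounded r N l2 Hr) as (M2 & HM2 & B2).
  destruct (HF (eps / 2 / (M2 + 1))) as (l1 & H1 & A1).
  { apply Rdiv_lt_0_compat; lra. }
  exists (flat_map (fun c1 => map (fun c2 =>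
     (fst c1 * fst c2, fun i => (snd c1 i + snd c2 i)%Z)%C) l2) l1); split.
  - apply Forall_forall; intros ce Hce; apply in_flat_map in Hce.
    destruct Hce as (c1 & Hc1 & Hce); apply in_map_iff in Hce.
    destruct Hce as (c2 & <- & Hc2); simpl.
    rewrite Forall_forall in H1, H2; apply HE; [now apply H1 | now apply H2].
  - intros xi Ht.
    replace (lpoly N _ xi) with (lpoly N l1 xi * lpoly N l2 xi)%C.
    + replace (F xi * G xi - lpoly N l1 xi * lpoly N l2 xi)%C
        with (F xi * (G xi - lpoly N l2 xi) + (F xi - lpoly N l1 xi) * lpoly N l2 xi)%C by ring.
      eapply Rle_trans; [apply Cmod_triangle|]; rewrite !Cmod_mult.
      replace eps with (MF * (eps / 2 / MF) + (eps / 2 / (M2 + 1)) * (M2 + 1)) by (field; lra).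
      apply Rplus_le_compat; apply Rmult_le_compat; try apply Cmod_ge_0.
      * now apply BF.
      * now apply A2.
      * now apply A1.
      * specialize (B2 xi Ht); lra.
    + unfold lpoly; rewrite Csum_flat_map.
      rewrite Cmult_comm, <- Csum_scal; apply Csum_ext; intros c1 _.
      rewrite Csum_map, Cmult_comm, <- Csum_scal; apply Csum_ext; intros c2 _; simpl.
      rewrite (mono_add r) by easy; ring.
Qed.

Lemma nice_const r N (E : (nat -> Z) -> Prop) (c : C) :
  E (fun _ => 0%Z) -> nice r N E (fun _ => c).
Proof.
  intros HE eps Heps; exists [(c, fun _ => 0%Z)]; split; [now repeat constructor|].
  intros xi _; unfold lpoly; rewrite Csum_cons; simpl.
  replace (mono N (fun _ => 0%Z) xi) with (RtoC 1).
  - replace (c - _)%C with (RtoC 0) by (unfold Csum; simpl; ring). rewrite Cmod_0; lra.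
  - unfold mono; induction (seq 1 N) as [|i l IH]; [reflexivity|].
    rewrite Cprod_cons, <- IH; simpl; ring.
Qed.

Definition single (i : nat) (n : Z) : nat -> Z := fun j => if Nat.eqb j i then n else 0%Z.

Lemma mono_single N i n xi : (1 <= i <= N)%nat -> mono N (single i n) xi = Cpowz (xi i) n.
Proof.
  intros Hi.
  assert (H : forall l, NoDup l -> In i l ->
    Cprod l (fun j => Cpowz (xi j) (single i n j)) = Cpowz (xi i) n).
  { assert (H0 : forall l, ~ In i l ->
      Cprod l (fun j => Cpowz (xi j) (single i n j)) = 1%C).
    { induction l as [|j l IH]; intros Hl; [reflexivity|].
      rewrite Cprod_cons, IH by (intros H; apply Hl; now right).
      unfold single; destruct (Nat.eqb_spec j i); [elim Hl; now left | simpl; ring]. }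
    induction l as [|j l IH]; intros Hd Hin; [easy|].
    inversion Hd; subst; rewrite Cprod_cons; destruct Hin as [->|Hin].
    - rewrite H0 by easy; unfold single; rewrite Nat.eqb_refl; ring.
    - rewrite IH by easy; unfold single.
      destruct (Nat.eqb_spec j i); [now subst | simpl; ring]. }
  apply H; [apply seq_NoDup | apply in_seq; lia].
Qed.

Lemma nice_Cpowz r N (E : (nat -> Z) -> Prop) i n : (1 <= i <= N)%nat ->
  E (single i n) -> nice r N E (fun xi => Cpowz (xi i) n).
Proof.
  intros Hi HE eps Heps; exists [(RtoC 1, single i n)]; split; [now repeat constructor|].
  intros xi _; unfold lpoly; rewrite Csum_cons; simpl fst; simpl snd.
  rewrite mono_single by easy.
  replace (_ - _)%C with (RtoC 0) by (unfold Csum; simpl; ring). rewrite Cmod_0; lra.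
Qed.

Lemma nice_var r N (E : (nat -> Z) -> Prop) i : (1 <= i <= N)%nat ->
  E (single i 1) -> nice r N E (fun xi => xi i).
Proof.
  intros Hi HE; apply nice_ext with (fun xi => Cpowz (xi i) 1).
  - intros; apply Cpowz_1.
  - now apply nice_Cpowz.
Qed.

(** A submonoid of exponent vectors: for such an [E] the functions that are [nice r N E] form an
    algebra, stable also under convergent geometric series and under the exponential. *)
Definition addclosed (E : (nat -> Z) -> Prop) : Prop :=
  E (fun _ => 0%Z) /\ forall e1 e2, E e1 -> E e2 -> E (fun i => e1 i + e2 i)%Z.

Lemma nice_mult_closed r N E F G : 0 < r -> addclosed E ->
  nice r N E F -> nice r N E G -> nice r N E (fun xi => F xi * G xi)%C.
Proof. intros Hr [_ HE]; now apply nice_mult. Qed.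

Lemma nice_Cprod {A} r N E (l : list A) (F : A -> (nat -> C) -> C) : 0 < r -> addclosed E ->
  (forall a, In a l -> nice r N E (F a)) -> nice r N E (fun xi => Cprod l (fun a => F a xi)).
Proof.
  intros Hr HE; induction l as [|a l IH]; intros H.
  - exact (nice_const r N E 1 (proj1 HE)).
  - apply nice_mult_closed; try easy.
    + apply H; now left.
    + apply IH; intros; apply H; now right.
Qed.

Lemma nice_pow r N E F n : 0 < r -> addclosed E ->
  nice r N E F -> nice r N E (fun xi => F xi ^ n)%C.
Proof.
  intros Hr HE HF; induction n as [|n IH].
  - exact (nice_const r N E 1 (proj1 HE)).
  - now apply nice_mult_closed.
Qed.

(** Partial sums of the geometric series approximate uniformly: the remainder is w^n / (1 - w), and
    |1 - w| is at least 1 - rho, whence the target eps (1 - rho) for rho^n. *)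
Lemma nice_geom r N E F rho : 0 < r -> addclosed E -> 0 <= rho < 1 ->
  nice r N E F -> (forall xi, torus r N xi -> Cmod (F xi) <= rho) ->
  nice r N E (fun xi => / (1 - F xi))%C.
Proof.
  intros Hr HE Hrho HF HM; apply nice_lim; intros eps Heps.
  destruct (pow_lt_1_zero rho) with (y := eps * (1 - rho)) as [n Hn].
  { rewrite Rabs_right; lra. }
  { apply Rmult_lt_0_compat; lra. }
  specialize (Hn n (le_n n)); rewrite Rabs_right in Hn by (apply Rle_ge, pow_le; lra).
  exists (fun xi => Csum (seq 0 n) (fun k => F xi ^ k)%C); split.
  - apply nice_Csum; intros; now apply nice_pow.
  - intros xi Ht; specialize (HM xi Ht); set (w := F xi) in *.
    assert (B : 1 - rho <= Cmod (1 - w)%C).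
    { assert (T := Cmod_triangle (1 - w)%C w).
      replace (1 - w + w)%C with (RtoC 1) in T by ring; rewrite Cmod_1 in T; lra. }
    assert (Hw : (1 - w)%C <> 0%C).
    { intros H; rewrite H, Cmod_0 in B; lra. }
    assert (G : forall k, ((1 - w) * Csum (seq 0 k) (fun j => w ^ j) = 1 - w ^ k)%C).
    { induction k as [|k IH]; [change ((1 - w) * 0 = 1 - 1)%C; ring|].
      rewrite seq_S, Csum_app, Cmult_plus_distr_l, IH, Cpow_S.
      change (Csum [(0 + k)%nat] (fun j => w ^ j))%C with (w ^ k + 0)%C; ring. }
    replace (/ (1 - w) - _)%C with (w ^ n * / (1 - w))%C.
    + rewrite Cmod_mult, Cmod_inv, Cmod_pow by easy.
      apply (Rmult_le_reg_r (Cmod (1 - w)%C)); [lra|].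
      rewrite Rmult_assoc, Rinv_l, Rmult_1_r by lra.
      assert (Cmod w ^ n <= rho ^ n) by (apply pow_incr; split; [apply Cmod_ge_0 | easy]).
      nra.
    + replace (Csum (seq 0 n) (fun k => w ^ k))%C with ((1 - w ^ n) / (1 - w))%C;
        [now field|].
      rewrite <- G; now field.
Qed.

Lemma nice_inv_sub r N E (c rho : R) F : 0 < r -> addclosed E -> 0 <= rho < c ->
  nice r N E F -> (forall xi, torus r N xi -> Cmod (F xi) <= rho) ->
  nice r N E (fun xi => / (RtoC c - F xi))%C.
Proof.
  intros Hr HE Hrho HF HM.
  assert (Hc : RtoC c <> 0%C) by (intros H; apply RtoC_inj in H; lra).
  assert (Hlt : rho / c < 1).
  { apply (Rmult_lt_reg_r c); [lra|]; unfold Rdiv; rewrite Rmult_assoc, Rinv_l; lra. }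
  assert (HM' : forall xi, torus r N xi -> Cmod (/ RtoC c * F xi)%C <= rho / c).
  { intros xi Ht; rewrite Cmod_mult, Cmod_inv, Cmod_R, Rabs_right by (easy || lra).
    unfold Rdiv; rewrite Rmult_comm; apply Rmult_le_compat_r;
      [left; apply Rinv_0_lt_compat; lra | now apply HM]. }
  apply nice_ext with (fun xi => / RtoC c * / (1 - / RtoC c * F xi))%C.
  - intros xi Ht; field; split; [|easy].
    assert (H : forall w : C, Cmod w <= rho -> (RtoC c - w)%C <> 0%C).
    { intros w Hw H; assert (Hcw : w = RtoC c) by (symmetry; now apply Ceq_minus).
      rewrite Hcw, Cmod_R, Rabs_right in Hw; lra. }
    now apply H, HM.
  - apply nice_scal, nice_geom with (rho / c); try easy.
    + split; [|easy]; apply Rmult_le_pos; [easy | left; apply Rinv_0_lt_compat; lra].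
    + now apply nice_scal.
Qed.

(** * Exchange of two adjacent variables *)

Definition swap_idx (i j : nat) : nat :=
  if Nat.eqb j i then S i else if Nat.eqb j (S i) then i else j.

Lemma swap_idx_invol i j : swap_idx i (swap_idx i j) = j.
Proof.
  unfold swap_idx.
  destruct (Nat.eqb_spec j i); [|destruct (Nat.eqb_spec j (S i))];
    repeat match goal with |- context [Nat.eqb ?a ?b] => destruct (Nat.eqb_spec a b) end; lia.
Qed.

Lemma swap_idx_range N i j : (1 <= i < N)%nat -> (1 <= j <= N)%nat ->
  (1 <= swap_idx i j <= N)%nat.
Proof.
  intros; unfold swap_idx; destruct (Nat.eqb_spec j i); [lia|].
  destruct (Nat.eqb_spec j (S i)); lia.
Qed.

Lemma seq_swap_split N i : (1 <= i < N)%nat ->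
  seq 1 N = seq 1 (i - 1) ++ i :: S i :: seq (S (S i)) (N - i - 1).
Proof.
  intros Hi; replace N with ((i - 1) + S (S (N - i - 1)))%nat at 1 by lia.
  rewrite seq_app; f_equal; replace (1 + (i - 1))%nat with i by lia; reflexivity.
Qed.

Lemma map_swap_seq N i : (1 <= i < N)%nat ->
  map (swap_idx i) (seq 1 N) = seq 1 (i - 1) ++ S i :: i :: seq (S (S i)) (N - i - 1).
Proof.
  intros Hi; rewrite seq_swap_split with (i := i) by easy.
  rewrite map_app; simpl.
  assert (H : forall a n, (forall j, In j (seq a n) -> j <> i /\ j <> S i) ->
    map (swap_idx i) (seq a n) = seq a n).
  { intros a n Hj; rewrite <- map_id at 1; rewrite map_id; rewrite <- (map_id (seq a n)) at 2.
    apply map_ext_in; intros j Hin; destruct (Hj j Hin) as [H1 H2].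
    unfold swap_idx; apply Nat.eqb_neq in H1 as ->; now apply Nat.eqb_neq in H2 as ->. }
  rewrite !H by (intros j Hj; apply in_seq in Hj; lia).
  unfold swap_idx; rewrite Nat.eqb_refl.
  replace (Nat.eqb (S i) i) with false by (symmetry; apply Nat.eqb_neq; lia).
  now rewrite Nat.eqb_refl.
Qed.

Lemma map_swap_perm N i : (1 <= i < N)%nat -> Permutation (map (swap_idx i) (seq 1 N)) (seq 1 N).
Proof.
  intros Hi; rewrite map_swap_seq, (seq_swap_split N i) by easy.
  apply Permutation_app_head, perm_swap.
Qed.

Lemma torus_swap r N i xi : (1 <= i < N)%nat -> torus r N xi ->
  torus r N (fun j => xi (swap_idx i j)).
Proof. intros Hi Ht j Hj; apply Ht; now apply swap_idx_range. Qed.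

Lemma lpoly_swap N i l xi : (1 <= i < N)%nat ->
  lpoly N l (fun j => xi (swap_idx i j)) =
  lpoly N (map (fun ce => (fst ce, fun j => snd ce (swap_idx i j))) l) xi.
Proof.
  intros Hi; unfold lpoly; rewrite Csum_map; apply Csum_ext; intros ce _; simpl; f_equal.
  unfold mono.
  rewrite <- (Cprod_perm _ _ (fun j => Cpowz (xi j) (snd ce (swap_idx i j)))
    (map_swap_perm N i Hi)), Cprod_map.
  apply Cprod_ext; intros j _; now rewrite swap_idx_invol.
Qed.

Lemma coef_swap N i l : (1 <= i < N)%nat ->
  coef N (map (fun ce => (fst ce, fun j => snd ce (swap_idx i j))) l) = coef N l.
Proof.
  intros Hi; unfold coef; rewrite Csum_map; apply Csum_ext; intros ce _; simpl; f_equal.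
  replace (forallb (fun j => Z.eqb (snd ce (swap_idx i j)) (-1)) (seq 1 N))
    with (forallb (fun j => Z.eqb (snd ce j) (-1)) (seq 1 N)); [easy|].
  apply eq_true_iff_eq; rewrite !forallb_forall; split; intros H j Hj.
  - apply H, in_seq; apply in_seq in Hj.
    destruct (swap_idx_range N i j); lia.
  - rewrite <- (swap_idx_invol i j); apply H, in_seq; apply in_seq in Hj.
    destruct (swap_idx_range N i j); lia.
Qed.

Lemma nice_swap r N E i F : (1 <= i < N)%nat -> nice r N E F ->
  nice r N anyE (fun xi => F (fun j => xi (swap_idx i j))).
Proof.
  intros Hi HF eps Heps; destruct (HF eps Heps) as (l & _ & Hl).
  exists (map (fun ce => (fst ce, fun j => snd ce (swap_idx i j))) l); split.
  - apply Forall_forall; intros; exact I.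
  - intros xi Ht; rewrite <- lpoly_swap by easy; now apply Hl, torus_swap.
Qed.

(** This plays the role of Fubini: being -1 in every coordinate is a condition invariant under the
    exchange, so [coef] does not see it. *)
Lemma contour_n_swap r N E i F : 0 < r -> (1 <= i < N)%nat -> nice r N E F ->
  contour_n r N (fun xi => F (fun j => xi (swap_idx i j))) = contour_n r N F.
Proof.
  intros Hr Hi HF; assert (Hp : 0 < r ^ N) by now apply pow_lt.
  apply (contour_n_eq r N anyE _ _ (1 + r ^ N)); [easy | lra | now apply nice_swap with E |].
  intros eps Heps; destruct (nice_coef_approx r N E F eps Hr HF Heps) as (l & A & B).
  exists (map (fun ce => (fst ce, fun j => snd ce (swap_idx i j))) l); split.
  - intros xi Ht; rewrite <- lpoly_swap by easy; specialize (A _ (torus_swap r N i xi Hi Ht)); nra.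
  - rewrite coef_swap by easy; nra.
Qed.

Lemma contour_n_antisym r N E i F : 0 < r -> (1 <= i < N)%nat -> nice r N E F ->
  (forall xi, torus r N xi -> F (fun j => xi (swap_idx i j)) = (- F xi)%C) ->
  contour_n r N F = 0%C.
Proof.
  intros Hr Hi HF H.
  assert (E1 := contour_n_swap r N E i F Hr Hi HF).
  rewrite (contour_n_ext r N anyE _ (fun xi => RtoC (-1) * F xi)%C) in E1; [|easy| |].
  - rewrite (contour_n_scal r N E) in E1 by easy.
    assert (T : ((1 + 1) * contour_n r N F = 0)%C) 
      by (replace ((1 + 1) * contour_n r N F)%C with (contour_n r N F + contour_n r N F)%C by ring;
          rewrite <- E1 at 1; ring).
    replace (contour_n r N F) with (/ (1 + 1) * ((1 + 1) * contour_n r N F))%C.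
    + rewrite T; ring.
    + rewrite Cmult_assoc, Cinv_l; [ring|].
      intros A; apply (f_equal fst) in A; simpl in A; lra.
  - now apply nice_swap with E.
  - intros xi Ht; rewrite H by easy; ring.
Qed.

Lemma contour_ext r (g h : C -> C) : (forall z, g z = h z) -> contour r g = contour r h.
Proof.
  intros H; unfold contour; f_equal; apply (@RInt_ext C_R_CompleteNormedModule).
  intros; now rewrite H.
Qed.

Lemma contour_n_ext_all r N F G : (forall xi, F xi = G xi) -> contour_n r N F = contour_n r N G.
Proof.
  revert F G; induction N as [|N IH]; intros F G H; [apply H|].
  simpl; apply IH; intros; now apply contour_ext.
Qed.

(** The innermost integrand is a constant times a power of the last variable and is therefore
    evaluated exactly in every environment. *)
Lemma contour_n_last r N H n : 0 < r ->
  (forall env z, H (upd env (S N) z) = H env) ->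
  contour_n r (S N) (fun xi => Cpowz (xi (S N)) n * H xi)%C =
  if Z.eqb n (-1) then contour_n r N H else 0%C.
Proof.
  intros Hr HH; simpl.
  rewrite (contour_n_ext_all r N _ (fun env => (if Z.eqb n (-1) then 1 else 0) * H env)%C).
  - destruct (Z.eqb n (-1)).
    + apply contour_n_ext_all; intros; ring.
    + rewrite (contour_n_ext_all r N _ (fun _ => 0%C)); [now apply contour_n_0 | intros; ring].
  - intros env; apply contour_unique.
    apply is_contour_ext with (fun z => H env * Cpowz z n)%C.
    + intros th; rewrite upd_same, HH; ring.
    + rewrite Cmult_comm; now apply is_contour_scal, is_contour_Cpowz.
Qed.

(** * Polynomials and antisymmetry *)

(** Polynomials as functions, [T] listing the indices of the variables that may occur. Closure under
    pointwise equality ([Pol_ext]) admits any algebraic rewriting. *)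
Inductive Pol (T : list nat) : ((nat -> C) -> C) -> Prop :=
| Pol_const c : Pol T (fun _ => c)
| Pol_var i : In i T -> Pol T (fun xi => xi i)
| Pol_plus F G : Pol T F -> Pol T G -> Pol T (fun xi => F xi + G xi)%C
| Pol_mult F G : Pol T F -> Pol T G -> Pol T (fun xi => F xi * G xi)%C
| Pol_ext F G : (forall xi, F xi = G xi) -> Pol T F -> Pol T G.

Lemma Pol_minus T F G : Pol T F -> Pol T G -> Pol T (fun xi => F xi - G xi)%C.
Proof.
  intros HF HG; apply Pol_ext with (fun xi => F xi + RtoC (-1) * G xi)%C; [intros; ring|].
  apply Pol_plus; [easy|]; apply Pol_mult; [apply Pol_const | easy].
Qed.

Lemma Pol_Csum {A} T (l : list A) (F : A -> (nat -> C) -> C) :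
  (forall a, In a l -> Pol T (F a)) -> Pol T (fun xi => Csum l (fun a => F a xi)).
Proof.
  induction l as [|a l IH]; intros H; [apply (Pol_const T 0)|].
  apply Pol_plus.
  - apply H; now left.
  - apply IH; intros; apply H; now right.
Qed.

Lemma Pol_Cprod {A} T (l : list A) (F : A -> (nat -> C) -> C) :
  (forall a, In a l -> Pol T (F a)) -> Pol T (fun xi => Cprod l (fun a => F a xi)).
Proof.
  induction l as [|a l IH]; intros H; [apply (Pol_const T 1)|].
  apply Pol_mult.
  - apply H; now left.
  - apply IH; intros; apply H; now right.
Qed.

Lemma Pol_pow T F n : Pol T F -> Pol T (fun xi => F xi ^ n)%C.
Proof.
  intros HF; induction n as [|n IH]; [apply (Pol_const T 1)|].
  exact (Pol_mult T F (fun xi => F xi ^ n)%C HF IH).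
Qed.

Ltac pol := repeat first
  [ eassumption | apply Pol_const | apply Pol_var; solve [auto] | apply Pol_pow | apply Pol_minus
  | apply Pol_plus | apply Pol_mult | apply Pol_Cprod; intros | apply Pol_Csum; intros ].

Lemma Pol_pointwise T F : Pol T F -> forall xi xi', (forall k, In k T -> xi k = xi' k) -> F xi = F xi'.
Proof.
  intros HF; induction HF as [c|i Hi|F G _ IF _ IG|F G _ IF _ IG|F G E _ IF]; intros xi xi' H.
  - easy.
  - now apply H.
  - now rewrite (IF xi xi'), (IG xi xi').
  - now rewrite (IF xi xi'), (IG xi xi').
  - rewrite <- !E; now apply IF.
Qed.

Lemma Pol_incl T T' F : incl T T' -> Pol T F -> Pol T' F.
Proof.
  intros H HF; induction HF as [c|i Hi|F G _ IF _ IG|F G _ IF _ IG|F G E _ IF].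
  - apply Pol_const.
  - now apply Pol_var, H.
  - now apply Pol_plus.
  - now apply Pol_mult.
  - now apply Pol_ext with F.
Qed.

Lemma Pol_subst T i j F : In j T -> Pol T F -> Pol T (fun xi => F (upd xi i (xi j))).
Proof.
  intros Hj HF; induction HF as [c|k Hk|F G _ IF _ IG|F G _ IF _ IG|F G E _ IF].
  - apply Pol_const.
  - destruct (Nat.eq_dec k i) as [->|Hn].
    + apply Pol_ext with (fun xi => xi j); [intros; now rewrite upd_same | now apply Pol_var].
    + apply Pol_ext with (fun xi => xi k); [intros; now rewrite upd_other | now apply Pol_var].
  - now apply Pol_plus.
  - now apply Pol_mult.
  - apply Pol_ext with (fun xi => F (upd xi i (xi j))); [intros; apply E | easy].
Qed.

(** Division with remainder by xi_i - xi_j. For a product, FG - F'G' = (F - F')G + F'(G - G'), where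
    the prime denotes the substitution xi_i := xi_j. *)
Lemma Pol_div T i j F : In j T -> Pol T F ->
  exists Q, Pol T Q /\ forall xi, F xi = ((xi i - xi j) * Q xi + F (upd xi i (xi j)))%C.
Proof.
  intros Hj HF; induction HF as
    [c|k Hk|F G HF (Q1 & H1 & E1) HG (Q2 & H2 & E2)
    |F G HF (Q1 & H1 & E1) HG (Q2 & H2 & E2)|F G E _ (Q1 & H1 & E1)].
  - exists (fun _ => 0%C); split; [apply Pol_const | intros; ring].
  - destruct (Nat.eq_dec k i) as [->|Hn].
    + exists (fun _ => 1%C); split; [apply Pol_const | intros; rewrite upd_same; ring].
    + exists (fun _ => 0%C); split; [apply Pol_const | intros; rewrite upd_other by easy; ring].
  - exists (fun xi => Q1 xi + Q2 xi)%C; split; [now apply Pol_plus|].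
    intros xi; rewrite (E1 xi), (E2 xi) at 1; ring.
  - exists (fun xi => Q1 xi * G xi + F (upd xi i (xi j)) * Q2 xi)%C; split.
    + apply Pol_plus; [now apply Pol_mult|].
      apply Pol_mult; [now apply Pol_subst | easy].
    + intros xi; rewrite (E1 xi) at 1.
      replace (((xi i - xi j) * Q1 xi + F (upd xi i (xi j))) * G xi)%C
        with ((xi i - xi j) * (Q1 xi * G xi) + F (upd xi i (xi j)) * G xi)%C by ring.
      rewrite (E2 xi) at 2; ring.
  - exists Q1; split; [easy|]; intros xi; rewrite <- !E; apply E1.
Qed.

(** Quantitative continuity in one coordinate; it serves to reach the diagonal xi_i = xi_j in
    [Pol_cancel]. *)
Lemma Pol_lipschitz T F i xi : Pol T F ->
  exists M, 0 <= M /\ forall t, Cmod (t - xi i)%C <= 1 ->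
    Cmod (F (upd xi i t) - F xi)%C <= M * Cmod (t - xi i)%C.
Proof.
  intros HF; induction HF as
    [c|k Hk|F G HF (M1 & H1 & B1) HG (M2 & H2 & B2)
    |F G HF (M1 & H1 & B1) HG (M2 & H2 & B2)|F G E _ (M1 & H1 & B1)].
  - exists 0; split; [lra|]; intros t _; replace (c - c)%C with (RtoC 0) by ring.
    rewrite Cmod_0; lra.
  - exists 1; split; [lra|]; intros t _; destruct (Nat.eq_dec k i) as [->|Hn].
    + rewrite upd_same; lra.
    + rewrite upd_other by easy; replace (xi k - xi k)%C with (RtoC 0) by ring.
      rewrite Cmod_0; generalize (Cmod_ge_0 (t - xi i)%C); lra.
  - exists (M1 + M2); split; [lra|]; intros t Ht; specialize (B1 t Ht); specialize (B2 t Ht).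
    replace (_ - _)%C with ((F (upd xi i t) - F xi) + (G (upd xi i t) - G xi))%C by ring.
    eapply Rle_trans; [apply Cmod_triangle|]; lra.
  - assert (P1 := Cmod_ge_0 (F xi)); assert (P2 := Cmod_ge_0 (G xi)).
    exists (M1 * (Cmod (G xi) + M2) + Cmod (F xi) * M2); split.
    { apply Rplus_le_le_0_compat; apply Rmult_le_pos; lra. }
    intros t Ht; specialize (B1 t Ht); specialize (B2 t Ht).
    assert (P3 := Cmod_ge_0 (t - xi i)%C).
    replace (_ - _)%C with ((F (upd xi i t) - F xi) * G (upd xi i t) +
      F xi * (G (upd xi i t) - G xi))%C by ring.
    assert (B3 : Cmod (G (upd xi i t)) <= Cmod (G xi) + M2).
    { replace (G (upd xi i t)) with (G xi + (G (upd xi i t) - G xi))%C by ring.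
      eapply Rle_trans; [apply Cmod_triangle|]; nra. }
    eapply Rle_trans; [apply Cmod_triangle|]; rewrite !Cmod_mult.
    rewrite Rmult_plus_distr_r; apply Rplus_le_compat.
    + replace (M1 * (Cmod (G xi) + M2) * Cmod (t - xi i)%C)
        with ((M1 * Cmod (t - xi i)%C) * (Cmod (G xi) + M2)) by ring.
      apply Rmult_le_compat; try apply Cmod_ge_0; easy.
    + rewrite Rmult_assoc; apply Rmult_le_compat_l; easy.
  - exists M1; split; [easy|]; intros t Ht; rewrite <- !E; now apply B1.
Qed.

(** Off the diagonal one divides; a point of the diagonal is a limit of points off it. *)
Lemma Pol_cancel T F i j : Pol T F -> i <> j ->
  (forall xi, ((xi i - xi j) * F xi)%C = 0%C) -> forall xi, F xi = 0%C.
Proof.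
  intros HF Hij H xi.
  assert (H' : forall xi', (xi' i - xi' j)%C <> 0%C -> F xi' = 0%C).
  { intros xi' Hn; specialize (H xi').
    rewrite <- (Cmult_1_l (F xi')), <- (Cinv_l _ Hn), <- Cmult_assoc, H; ring. }
  destruct (Ceq_dec (xi i) (xi j)) as [E|E].
  2:{ apply H'; intros A; now apply E, Ceq_minus. }
  destruct (Pol_lipschitz T F i xi HF) as (M & HM & B).
  apply Cmod_le_all; intros eps Heps.
  (* Moving xi_i by d leaves the diagonal; d <= 1 keeps the Lipschitz bound valid, and M d <=
     eps. *)
  set (d := Rmin 1 (eps / (M + 1))).
  assert (Hd : 0 < d) by (apply Rmin_pos; [lra | apply Rdiv_lt_0_compat; lra]).
  assert (Ed : (xi i + RtoC d - xi i)%C = RtoC d) by ring.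
  assert (Hd1 : Cmod (xi i + RtoC d - xi i)%C = d) by (rewrite Ed, Cmod_R; apply Rabs_right; lra).
  specialize (B (xi i + RtoC d)%C).
  rewrite Hd1, H' in B.
  - replace (0 - F xi)%C with (- F xi)%C in B by ring; rewrite Cmod_opp in B.
    eapply Rle_trans; [apply B, Rmin_l|].
    assert (d <= eps / (M + 1)) by apply Rmin_r.
    apply Rle_trans with (M * (eps / (M + 1))); [now apply Rmult_le_compat_l|].
    apply (Rmult_le_reg_r (M + 1)); [lra|].
    replace (M * (eps / (M + 1)) * (M + 1)) with (M * eps) by (field; lra); nra.
  - rewrite upd_same, upd_other, <- E, Ed by now apply not_eq_sym.
    intros A; apply RtoC_inj in A; lra.
Qed.

Lemma Pol_cancel_list T F l a : Pol T F -> In a T -> incl l T -> ~ In a l ->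
  (forall xi, (Cprod l (fun b => xi b - xi a) * F xi)%C = 0%C) -> forall xi, F xi = 0%C.
Proof.
  intros HF Ha; induction l as [|b l IH]; intros Hl Hn H.
  - intros xi; rewrite <- (H xi); unfold Cprod; simpl; ring.
  - assert (Hl' : incl l T) by (intros c Hc; apply Hl; now right).
    apply IH; [easy | intros A; apply Hn; now right |].
    apply (Pol_cancel T) with (i := b) (j := a).
    + apply Pol_mult; [|easy].
      apply Pol_Cprod; intros c Hc.
      apply Pol_minus; apply Pol_var; auto.
    + intros E; apply Hn; now left.
    + intros xi; rewrite <- (H xi), Cprod_cons; ring.
Qed.

(** * Divisibility by the Vandermonde product *)

Fixpoint vd (V : list C) : C :=
  match V with
  | [] => 1%C
  | a :: V' => (Cprod V' (fun b => b - a) * vd V')%C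
  end.

(** The factors are split off one at a time. After division by xi_b - xi_a the quotient still
    vanishes on xi_c = xi_a, because its product with xi_b - xi_a vanishes there and [Pol_cancel]
    applies after substitution. *)
Lemma Pol_div_list T P a l : Pol T P -> In a T -> incl l T -> ~ In a l -> NoDup l ->
  (forall b xi, In b l -> xi b = xi a -> P xi = 0%C) ->
  exists Q, Pol T Q /\ forall xi, P xi = (Cprod l (fun b => xi b - xi a) * Q xi)%C.
Proof.
  intros HP Ha; revert P HP; induction l as [|b l IH]; intros P HP Hl Hn Hd H.
  - exists P; split; [easy|]; intros; unfold Cprod; simpl; ring.
  - assert (Hl' : incl l T) by (intros c Hc; apply Hl; now right).
    assert (Hba : b <> a) by (intros ->; apply Hn; now left).
    inversion Hd as [|? ? Hbl Hd']; subst.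
    destruct (Pol_div T b a P Ha HP) as (Q1 & HQ1 & E1).
    assert (E1' : forall xi, P xi = ((xi b - xi a) * Q1 xi)%C).
    { intros xi; rewrite E1, (H b (upd xi b (xi a))).
      - ring.
      - now left.
      - rewrite upd_same, upd_other by now apply not_eq_sym. easy. }
    destruct (IH Q1) as (Q & HQ & E); try easy.
    + intros A; apply Hn; now right.
    + intros c xi Hc Hx.
      assert (Hca : c <> a) by (intros ->; apply Hn; now right).
      assert (Hcb : b <> c) by now intros ->.
      rewrite (Pol_pointwise T Q1 HQ1 xi (upd xi c (xi a))).
      * apply (Pol_cancel T (fun xi => Q1 (upd xi c (xi a))) b a); [now apply Pol_subst | easy |].
        intros xi'; rewrite <- (H c (upd xi' c (xi' a))).
        -- rewrite (E1' (upd xi' c (xi' a))).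
           rewrite (upd_other _ _ _ b) by easy.
           rewrite (upd_other _ _ _ a) by now apply not_eq_sym. easy.
        -- now right.
        -- rewrite upd_same, upd_other by now apply not_eq_sym. easy.
      * intros k _; destruct (Nat.eq_dec k c) as [->|Hk]; [now rewrite upd_same | now rewrite upd_other].
    + exists Q; split; [easy|]; intros xi; rewrite E1', E, Cprod_cons; ring.
Qed.

Lemma Pol_vd_div S T P : Pol S P -> incl T S -> NoDup T ->
  (forall i j xi, In i T -> In j T -> i <> j -> xi i = xi j -> P xi = 0%C) ->
  exists Q, Pol S Q /\ forall xi, P xi = (vd (map xi T) * Q xi)%C.
Proof.
  revert P; induction T as [|a T IH]; intros P HP HT Hd H.
  - exists P; split; [easy|]; intros; simpl; ring.
  - inversion Hd as [|? ? Ha Hd']; subst.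
    assert (HaS : In a S) by (apply HT; now left).
    assert (HT' : incl T S) by (intros c Hc; apply HT; now right).
    destruct (Pol_div_list S P a T) as (Q1 & HQ1 & E1); try easy.
    { intros b xi Hb Hx; apply (H b a); [now right | now left | now intros -> | easy]. }
    destruct (IH Q1) as (Q & HQ & E); try easy.
    + intros i j xi Hi Hj Hij Hx.
      rewrite (Pol_pointwise S Q1 HQ1 xi (upd xi i (xi j))).
      (* On xi_i = xi_j the product over [T] turns into one where [j] replaces [i] and so occurs
         twice; [Pol_cancel_list] allows repetitions. *)
      * apply (Pol_cancel_list S (fun xi => Q1 (upd xi i (xi j)))
          (map (fun b => if Nat.eqb b i then j else b) T) a); try easy.
        -- apply Pol_subst; [now apply HT' | easy].
        -- intros c Hc; apply in_map_iff in Hc; destruct Hc as (b & <- & Hb).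
           destruct (Nat.eqb_spec b i); now apply HT'.
        -- intros Hc; apply in_map_iff in Hc; destruct Hc as (b & Hb & Hb').
           destruct (Nat.eqb_spec b i); subst; easy.
        -- intros xi'; rewrite <- (H i j (upd xi' i (xi' j))).
           ++ rewrite E1, Cprod_map; f_equal; apply Cprod_ext; intros b Hb.
              rewrite (upd_other _ _ _ a) by now intros ->.
              destruct (Nat.eqb_spec b i); [subst; now rewrite upd_same | now rewrite upd_other].
           ++ now right.
           ++ now right.
           ++ easy.
           ++ rewrite upd_same, upd_other by now apply not_eq_sym. easy.
      * intros k _; destruct (Nat.eq_dec k i) as [->|Hk]; [now rewrite upd_same | now rewrite upd_other].
    + exists Q; split; [easy|]; intros xi; rewrite E1, E; simpl; rewrite Cprod_map; ring.
Qed.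

Lemma Pol_map_vd T l : incl l T -> Pol T (fun xi => vd (map xi l)).
Proof.
  induction l as [|a l IH]; intros Hl; [apply (Pol_const T 1)|].
  assert (Ha : In a T) by (apply Hl; now left).
  assert (Hl' : incl l T) by (intros b Hb; apply Hl; now right).
  apply Pol_ext with (fun xi => Cprod l (fun b => xi b - xi a) * vd (map xi l))%C.
  { intros; simpl; now rewrite Cprod_map. }
  pol; now apply IH.
Qed.

(** * Partial fractions with polynomial weights *)

Lemma Csum_geom_diff (a b : C) j :
  (b ^ j - a ^ j = (b - a) * Csum (seq 0 j) (fun i => b ^ i * a ^ (j - 1 - i)))%C.
Proof.
  induction j as [|j IH].
  - change (1 - 1 = (b - a) * 0)%C; ring.
  - rewrite seq_S, Csum_app.
    replace (Csum (seq 0 j) _) with (a * Csum (seq 0 j) (fun i => b ^ i * a ^ (j - 1 - i)))%C.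
    + rewrite Csum_cons; change (Csum [] _) with (RtoC 0).
      replace (S j - 1 - (0 + j))%nat with 0%nat by lia.
      rewrite Cmult_plus_distr_l.
      replace ((b - a) * (a * Csum (seq 0 j) (fun i => b ^ i * a ^ (j - 1 - i))))%C
        with (a * (b ^ j - a ^ j))%C by (rewrite IH; ring).
      rewrite !Cpow_S, Nat.add_0_l; change (a ^ 0)%C with (RtoC 1); ring.
    + rewrite <- Csum_scal; apply Csum_ext; intros i Hi; apply in_seq in Hi.
      replace (S j - 1 - i)%nat with (S (j - 1 - i)) by lia; rewrite Cpow_S; ring.
Qed.

(* Partial fractions in [w] of [vd / prod (p - x_b w)]; the numerators are the Lagrange weights
   cleared of denominators, so no distinctness of the [x_b] is required. *)
Lemma vd_partial_fractions T : T <> [] ->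
  exists L : list (nat * ((nat -> C) -> C)),
    (forall bR, In bR L -> In (fst bR) T /\ Pol T (snd bR)) /\
    (forall xi j, (j < length T - 1)%nat ->
       Csum L (fun bR => snd bR xi * xi (fst bR) ^ j)%C = 0%C) /\
    (forall (p : C) xi w, (forall b, In b T -> (p - xi b * w)%C <> 0%C) ->
       Csum L (fun bR => snd bR xi * xi (fst bR) ^ (length T - 1) / (p - xi (fst bR) * w))%C =
       (p ^ (length T - 1) * vd (map xi T) / Cprod T (fun b => p - xi b * w))%C).
Proof.
  induction T as [|c B IH]; [easy|]; intros _.
  destruct B as [|b0 B0].
  { exists [(c, fun _ => RtoC 1)]; split; [|split].
    - intros bR [<-|[]]; split; [now left | apply (Pol_const _ 1)].
    - simpl; intros; lia.
    - intros p xi w H; rewrite Csum_cons, Cprod_cons.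
      change (1 * 1 / (p - xi c * w) + 0 = 1 * (1 * 1) / ((p - xi c * w) * 1))%C.
      field; apply H; now left. }
  assert (HBn : b0 :: B0 <> []) by easy.
  set (B := b0 :: B0) in *; clearbody B.
  destruct IH as (L & HL & H0 & H1); [easy|].
  (* [L2] attaches to the weight R_b of each entry the polynomial U_b, the product over B of the
     differences with x_c in which one factor x_b - x_c is left out. *)
  assert (E2 : exists L2 : list (nat * ((nat -> C) -> C) * ((nat -> C) -> C)),
    map fst L2 = L /\ forall t, In t L2 -> Pol (c :: B) (snd t) /\
      forall xi, Cprod B (fun b => xi b - xi c)%C =
        ((xi (fst (fst t)) - xi c) * snd t xi)%C).
  { clear H0 H1; induction L as [|bR L IHL]; [now exists []|].
    destruct IHL as (L2 & E & HL2); [intros; apply HL; now right|].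
    destruct (HL bR) as [Hb _]; [now left|].
    destruct (in_split _ _ Hb) as (B1 & B2 & EB).
    exists ((bR, fun xi => Cprod (B1 ++ B2) (fun b => xi b - xi c)%C) :: L2); split.
    - simpl; now rewrite E.
    - intros t [<-|Ht]; [|now apply HL2]; simpl; split.
      + apply Pol_Cprod; intros b Hin.
        apply Pol_minus; apply Pol_var; [|now left]; right; rewrite EB.
        apply in_app_or in Hin; apply in_or_app; destruct Hin; [now left | right; now right].
      + intros xi; rewrite EB, !Cprod_app, Cprod_cons; ring. }
  destruct E2 as (L2 & EL & HL2).
  assert (HB : length (c :: B) = S (length B)) by reflexivity.
  set (k := length B) in *.
  assert (Hk : (1 <= k)%nat) by (unfold k; destruct B; [easy | simpl; lia]).
  (* The weights of B acquire the factor U_b and the weight of [c] is minus their sum, so every sum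
     over the new weights becomes a sum of differences between the values at b and at c. *)
  exists ((c, fun xi => RtoC (-1) * Csum L2 (fun t => snd (fst t) xi * snd t xi))%C ::
    map (fun t => (fst (fst t), fun xi => snd (fst t) xi * snd t xi)%C) L2).
  assert (HLt : forall t, In t L2 -> In (fst (fst t)) B /\ Pol B (snd (fst t))).
  { intros t Ht; apply HL; rewrite <- EL; now apply in_map. }
  assert (Hpol : forall t, In t L2 -> Pol (c :: B) (fun xi => snd (fst t) xi * snd t xi)%C).
  { intros t Ht; apply Pol_mult; [|now apply HL2].
    apply Pol_incl with B; [intros b Hb; now right | now apply HLt]. }
  assert (S0 : forall xi j (cf : nat -> C), (j <= k - 1)%nat ->
    Csum L2 (fun t => snd (fst t) xi * Csum (seq 0 j) (fun i => cf i * xi (fst (fst t)) ^ i))%C = 0%C).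
  { intros xi j cf Hj.
    rewrite (Csum_ext _ _ (fun t => Csum (seq 0 j) (fun i => cf i *
       (snd (fst t) xi * xi (fst (fst t)) ^ i)))%C).
    2:{ intros t _; rewrite <- Csum_scal; apply Csum_ext; intros; ring. }
    rewrite Csum_exchange; apply Csum_zero; intros i Hi; apply in_seq in Hi.
    rewrite Csum_scal, <- (Csum_map fst L2 (fun bR => snd bR xi * xi (fst bR) ^ i))%C, EL.
    rewrite H0 by lia; ring. }
  split; [|split].
  - intros bR [<-|Hb]; simpl.
    + split; [now left|].
      apply Pol_mult; [apply Pol_const|].
      now apply Pol_Csum.
    + apply in_map_iff in Hb; destruct Hb as (t & <- & Ht); simpl; split.
      * right; now apply HLt.
      * now apply Hpol.
  - intros xi j Hj; rewrite HB in Hj.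
    rewrite Csum_cons, Csum_map; simpl fst; simpl snd.
    replace (_ + _)%C with (Csum L2 (fun t => snd (fst t) xi * snd t xi * xi (fst (fst t)) ^ j) -
       Csum L2 (fun t => xi c ^ j * (snd (fst t) xi * snd t xi)))%C by (rewrite Csum_scal; ring).
    rewrite <- Csum_minus.
    rewrite (Csum_ext _ _ (fun t => Cprod B (fun b => xi b - xi c) * (snd (fst t) xi *
      Csum (seq 0 j) (fun i => xi c ^ (j - 1 - i) * xi (fst (fst t)) ^ i))))%C.
    + rewrite Csum_scal, S0 by lia; ring.
    + intros t Ht; destruct (HL2 t Ht) as [_ HU]; rewrite (HU xi).
      replace (_ - _)%C with (snd (fst t) xi * snd t xi * (xi (fst (fst t)) ^ j - xi c ^ j))%C by ring.
      rewrite Csum_geom_diff.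
      rewrite (Csum_ext _ (fun i => xi c ^ (j - 1 - i) * xi (fst (fst t)) ^ i)%C
        (fun i => xi (fst (fst t)) ^ i * xi c ^ (j - 1 - i))%C) by (intros; ring).
      ring.
  - intros p xi w Hw.
    assert (Hc : (p - xi c * w)%C <> 0%C) by (apply Hw; now left).
    assert (HwB : forall b, In b B -> (p - xi b * w)%C <> 0%C) by (intros; apply Hw; now right).
    rewrite HB; replace (S k - 1)%nat with k by lia.
    rewrite Csum_cons, Csum_map; simpl fst; simpl snd.
    replace (_ + _)%C with
      (Csum L2 (fun t => snd (fst t) xi * snd t xi * xi (fst (fst t)) ^ k / (p - xi (fst (fst t)) * w)) -
       Csum L2 (fun t => (xi c ^ k / (p - xi c * w)) * (snd (fst t) xi * snd t xi)))%C
      by (rewrite Csum_scal; field; easy).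
    rewrite <- Csum_minus.
    set (Pi := Cprod B (fun b => xi b - xi c)%C).
    (* Each difference splits into a multiple of the term in the induction hypothesis and a
       combination of powers of x_b below k - 1, which the old weights annihilate. *)
    rewrite (Csum_ext _ _ (fun t =>
       (Pi * p / (p - xi c * w)) * (snd (fst t) xi * xi (fst (fst t)) ^ (k - 1) / (p - xi (fst (fst t)) * w))
       + (Pi / (p - xi c * w)) * (snd (fst t) xi *
      Csum (seq 0 (k - 1)) (fun i => (xi c * xi c ^ (k - 1 - 1 - i)) * xi (fst (fst t)) ^ i))))%C.
    + rewrite Csum_plus, !Csum_scal, S0 by lia.
      rewrite <- (Csum_map fst L2 (fun bR => snd bR xi * xi (fst bR) ^ (k - 1) / (p - xi (fst bR) * w))%C), EL.
      rewrite H1 by easy; rewrite Cprod_cons; simpl vd; rewrite Cprod_map; fold Pi.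
      replace k with (S (k - 1)) at 2 by lia; rewrite Cpow_S.
      field; split; [now apply Cprod_nz | easy].
    + intros t Ht; destruct (HL2 t Ht) as [_ HU]; specialize (HU xi); fold Pi in HU.
      assert (Hb := HwB _ (proj1 (HLt t Ht))).
      set (b := fst (fst t)) in *; set (U := snd t xi) in *; set (Rb := snd (fst t) xi).
      replace (Csum _ _) with (xi c * Csum (seq 0 (k - 1)) (fun i => xi b ^ i * xi c ^ (k - 1 - 1 - i)))%C
        by (rewrite <- Csum_scal; apply Csum_ext; intros; ring).
      assert (G := Csum_geom_diff (xi c) (xi b) (k - 1)).
      set (sg := Csum _ _) in *.
      replace k with (S (k - 1)) at 1 2 by lia; rewrite !Cpow_S, HU.
      replace (xi c ^ (k - 1))%C with (xi b ^ (k - 1) - (xi b - xi c) * sg)%C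
        by (rewrite <- G; ring).
      field; easy.
Qed.

(** * The antisymmetric numerator *)

(** All ways to take one entry out of a list, with sign (-1)^position, as in the Laplace expansion
    of a determinant along a row. *)
Fixpoint picks {A} (l : list A) : list (C * A * list A) :=
  match l with
  | [] => []
  | a :: l' => (RtoC 1, a, l') :: map (fun t => (- fst (fst t), snd (fst t), a :: snd t)%C) (picks l')
  end.

(* The numerator of the formula, summed over [Lambda] one entry at a time,
   with [prod (1 - v)] cleared from the denominator; the exponents [ns] are the [x_i], shifted. *)
Fixpoint numerator (p : R) (ns : list nat) (V : list C) : C :=
  match ns with
  | [] => 1%C
  | n :: ns' =>
    match ns' with
    | [] => (RtoC p ^ (length V * (length V - 1) / 2) * Cprod V (fun v => v ^ n) *
             (1 - Cprod V (fun v => v)) * vd V)%C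
    | _ => Csum (picks V) (fun t => fst (fst t) * (snd (fst t) ^ n * (1 - snd (fst t)) *
             Cprod (snd t) (fpq p (snd (fst t))) * numerator p ns' (snd t)))%C
    end
  end.

Lemma numerator_cons p n n' ns V :
  numerator p (n :: n' :: ns) V =
  Csum (picks V) (fun t => fst (fst t) * (snd (fst t) ^ n * (1 - snd (fst t)) *
    Cprod (snd t) (fpq p (snd (fst t))) * numerator p (n' :: ns) (snd t)))%C.
Proof. reflexivity. Qed.

Lemma picks_map {A B} (g : A -> B) l :
  picks (map g l) = map (fun t => (fst (fst t), g (snd (fst t)), map g (snd t))) (picks l).
Proof.
  induction l as [|a l IH]; [reflexivity|].
  simpl; rewrite IH, !map_map; reflexivity.
Qed.

Definition signC (n : nat) : C := (RtoC (-1) ^ n)%C.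

Lemma picks_snoc {A} (l : list A) z :
  picks (l ++ [z]) = map (fun t => (fst t, snd t ++ [z])) (picks l) ++ [(signC (length l), z, l)].
Proof.
  induction l as [|a l IH]; [reflexivity|].
  simpl; rewrite IH, map_app, !map_map; simpl; do 4 f_equal.
  unfold signC; rewrite Cpow_S; f_equal; ring.
Qed.

Lemma picks_perm {A} (l : list A) t : In t (picks l) -> Permutation l (snd (fst t) :: snd t).
Proof.
  revert t; induction l as [|a l IH]; intros t Ht; [easy|].
  destruct Ht as [<-|Ht]; [easy|].
  apply in_map_iff in Ht; destruct Ht as (u & <- & Hu); simpl.
  rewrite (IH u Hu) at 1; apply perm_swap.
Qed.

Lemma picks_length {A} (l : list A) t : In t (picks l) -> length l = S (length (snd t)).
Proof. intros Ht; now rewrite (Permutation_length (picks_perm l t Ht)). Qed.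

(** The picks of [a] and of [b] trade places with opposite signs; every other pick inherits the
    change of sign from [Phi]. *)
Lemma Csum_picks_swap {A} (Phi : A -> list A -> C) V1 a b V2 :
  (forall c r1 r2, Phi c (r1 ++ b :: a :: r2) = (- Phi c (r1 ++ a :: b :: r2))%C) ->
  Csum (picks (V1 ++ b :: a :: V2)) (fun t => fst (fst t) * Phi (snd (fst t)) (snd t))%C =
  (- Csum (picks (V1 ++ a :: b :: V2)) (fun t => fst (fst t) * Phi (snd (fst t)) (snd t)))%C.
Proof.
  revert Phi; induction V1 as [|d V1 IH]; intros Phi H; simpl picks;
    rewrite !Csum_cons, !Csum_map; simpl fst; simpl snd.
  - rewrite ?Csum_cons, ?Csum_map; simpl fst; simpl snd.
    rewrite (Csum_ext (picks V2) (fun t => - - fst (fst t) * Phi (snd (fst t)) (b :: a :: snd t))%C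
      (fun t => RtoC (-1) * (- - fst (fst t) * Phi (snd (fst t)) (a :: b :: snd t)))%C).
    + rewrite Csum_scal; ring.
    + intros t _; rewrite (H _ [] (snd t)); simpl; ring.
  - rewrite H.
    rewrite (Csum_ext (picks (V1 ++ b :: a :: V2)) _
      (fun t => RtoC (-1) * (fst (fst t) * Phi (snd (fst t)) (d :: snd t)))%C) by (intros; ring).
    rewrite (Csum_ext (picks (V1 ++ a :: b :: V2)) _
      (fun t => RtoC (-1) * (fst (fst t) * Phi (snd (fst t)) (d :: snd t)))%C) by (intros; ring).
    rewrite !Csum_scal, (IH (fun c r => Phi c (d :: r))); [ring|].
    intros c r1 r2; apply (H c (d :: r1)).
Qed.

Lemma vd_swap V1 a b V2 : vd (V1 ++ b :: a :: V2) = (- vd (V1 ++ a :: b :: V2))%C.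
Proof.
  induction V1 as [|d V1 IH]; cbn [app vd].
  - rewrite !Cprod_cons; ring.
  - rewrite IH, (Cprod_perm (V1 ++ b :: a :: V2) (V1 ++ a :: b :: V2)); [ring|].
    apply Permutation_app_head, perm_swap.
Qed.

(** By induction on the exponents: every factor is symmetric in the remaining variables, except the
    Vandermonde product at the end and the signs of the picks. *)
Lemma numerator_swap p ns V1 a b V2 : ns <> [] ->
  numerator p ns (V1 ++ b :: a :: V2) = (- numerator p ns (V1 ++ a :: b :: V2))%C.
Proof.
  intros Hns; revert V1 a b V2; induction ns as [|n ns IH]; [easy|]; intros V1 a b V2.
  assert (P : forall r1 r2 : list C, Permutation (r1 ++ b :: a :: r2) (r1 ++ a :: b :: r2))
    by (intros; apply Permutation_app_head, perm_swap).
  destruct ns as [|n' ns].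
  - simpl; rewrite vd_swap, !(Cprod_perm _ _ _ (P V1 V2)), (Permutation_length (P V1 V2)); ring.
  - rewrite !numerator_cons.
    apply (Csum_picks_swap (fun v r => v ^ n * (1 - v) * Cprod r (fpq p v) * numerator p (n' :: ns) r)%C).
    intros c r1 r2; rewrite IH, (Cprod_perm _ _ _ (P r1 r2)) by easy; ring.
Qed.

(** Adjacent exchanges bring the two equal entries together, and there the value equals its own
    negative. *)
Lemma numerator_repeat p ns V1 u V2 V3 : ns <> [] ->
  numerator p ns (V1 ++ u :: V2 ++ u :: V3) = 0%C.
Proof.
  intros Hns; revert V1; induction V2 as [|w V2 IH]; intros V1.
  - assert (H := numerator_swap p ns V1 u u V3 Hns); simpl.
    set (X := numerator _ _ _) in *.
    assert (T : (X + X)%C = 0%C) by (rewrite H at 1; ring).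
    replace X with (RtoC (/ 2) * (X + X))%C; [rewrite T; ring|].
    replace (X + X)%C with (RtoC 2 * X)%C by ring.
    rewrite Cmult_assoc, <- RtoC_mult, Rinv_l by lra; ring.
  - simpl; rewrite numerator_swap by easy.
    replace (V1 ++ w :: u :: V2 ++ u :: V3) with ((V1 ++ [w]) ++ u :: V2 ++ u :: V3)
      by now rewrite <- app_assoc.
    rewrite IH; ring.
Qed.

(** In each term every variable carries exactly one of the exponents, the last one being shared by
    all variables that are never picked. *)
Lemma numerator_shift p ns c V : ns <> [] ->
  numerator p (map (fun n => n + c)%nat ns) V = (Cprod V (fun v => v ^ c) * numerator p ns V)%C.
Proof.
  intros Hns; revert V; induction ns as [|n ns IH]; [easy|]; intros V.
  destruct ns as [|n' ns].
  - simpl.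
    rewrite (Cprod_ext _ (fun v => v ^ (n + c))%C (fun v => v ^ n * v ^ c)%C)
      by (intros; apply Cpow_add_r).
    rewrite Cprod_mult; ring.
  - simpl map; rewrite !numerator_cons, <- Csum_scal; apply Csum_ext; intros t Ht.
    change (n' + c :: map (fun n => (n + c)%nat) ns)%nat with (map (fun n => (n + c)%nat) (n' :: ns)).
    rewrite IH, (Cprod_perm _ _ _ (picks_perm V t Ht)), Cprod_cons, Cpow_add_r by easy; ring.
Qed.

Lemma Pol_numerator p ns T l : incl l T -> Pol T (fun xi => numerator p ns (map xi l)).
Proof.
  revert l; induction ns as [|n ns IH]; intros l Hl; [apply (Pol_const T 1)|].
  destruct ns as [|n' ns].
  - apply Pol_ext with (fun xi => RtoC p ^ (length l * (length l - 1) / 2) *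
      Cprod l (fun i => xi i ^ n) * (1 - Cprod l (fun i => xi i)) * vd (map xi l))%C.
    { intros xi; simpl; now rewrite length_map, !Cprod_map. }
    pol; now apply Pol_map_vd.
  - apply Pol_ext with (fun xi => Csum (picks l) (fun t => fst (fst t) *
      (xi (snd (fst t)) ^ n * (1 - xi (snd (fst t))) *
       Cprod (snd t) (fun j => fpq p (xi (snd (fst t))) (xi j)) *
       numerator p (n' :: ns) (map xi (snd t)))))%C.
    { intros xi; rewrite numerator_cons, picks_map, Csum_map; apply Csum_ext; intros t _; simpl fst; simpl snd.
      now rewrite Cprod_map. }
    apply Pol_Csum; intros t Ht; assert (HP := picks_perm l t Ht).
    assert (Ha : In (snd (fst t)) T).
    { apply Hl, (Permutation_in _ (Permutation_sym HP)); now left. }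
    assert (Hr : incl (snd t) T).
    { intros j Hj; apply Hl, (Permutation_in _ (Permutation_sym HP)); now right. }
    pol; now apply IH.
Qed.

(** Antisymmetry forces zeros on all diagonals, hence the Vandermonde factor. The partial fractions
    below consume this factor. *)
Lemma numerator_vd_div p ns T : ns <> [] -> NoDup T ->
  exists Q, Pol T Q /\ forall xi, numerator p ns (map xi T) = (vd (map xi T) * Q xi)%C.
Proof.
  intros Hns Hd.
  apply (Pol_vd_div T T (fun xi => numerator p ns (map xi T))); try easy.
  - now apply Pol_numerator.
  - assert (H : forall i j xi l1 l2 l3, T = l1 ++ i :: l2 ++ j :: l3 -> xi i = xi j ->
      numerator p ns (map xi T) = 0%C).
    { intros i j xi l1 l2 l3 -> E; rewrite map_app; simpl; rewrite map_app; simpl.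
      rewrite E; now apply numerator_repeat. }
    intros i j xi Hi Hj Hij E.
    destruct (in_split _ _ Hi) as (l1 & l2 & ET).
    rewrite ET in Hj; apply in_app_or in Hj; destruct Hj as [Hj|[Hj|Hj]]; [|easy|].
    + destruct (in_split _ _ Hj) as (l3 & l4 & ->).
      apply (H j i xi l3 l4 l2); [rewrite ET, <- app_assoc; reflexivity | easy].
    + destruct (in_split _ _ Hj) as (l3 & l4 & ->).
      apply (H i j xi l1 l3 l4 ET E).
Qed.

(** * Integrating out the last variable *)

Definition admissible (p r : R) : Prop := 0 < p <= 1 /\ small_radius p r.

(* The denominator [fpq p a (-r)] vanishes at [a = p / (1 + (1 - p) r)]. *)
Lemma admissible_lt p r : admissible p r -> r + (1 - p) * (r * r) < p.
Proof.
  intros (Hp & Hr & Hr1 & H).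
  apply Rnot_le_lt; intros Hle.
  assert (Hd : 0 < 1 + (1 - p) * r) by nra.
  set (a := p / (1 + (1 - p) * r)).
  assert (Ha : a * (1 + (1 - p) * r) = p) by (unfold a; field; lra).
  assert (Ha0 : 0 < a) by (apply Rdiv_lt_0_compat; lra).
  apply (H (RtoC a) (RtoC (- r))).
  - rewrite Cmod_R, Rabs_right by lra.
    apply (Rmult_le_reg_r (1 + (1 - p) * r)); nra.
  - rewrite Cmod_R, Rabs_Ropp, Rabs_right; lra.
  - unfold fpq; rewrite <- !RtoC_mult, <- RtoC_plus, <- RtoC_minus; f_equal; nra.
Qed.

Lemma fpq_torus_nz p r N xi i j : admissible p r -> torus r N xi ->
  (1 <= i <= N)%nat -> (1 <= j <= N)%nat -> fpq p (xi i) (xi j) <> 0%C.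
Proof.
  intros (_ & _ & _ & H) Ht Hi Hj; apply H; right; now apply Ht.
Qed.

Lemma one_sub_torus_nz p r N xi i : admissible p r -> torus r N xi ->
  (1 <= i <= N)%nat -> (1 - xi i)%C <> 0%C.
Proof.
  intros (_ & Hr & Hr1 & _) Ht Hi H; apply Ceq_minus in H.
  specialize (Ht i Hi); rewrite <- H, Cmod_1 in Ht; lra.
Qed.

(** Write f(a, b) = p - (a - (1-p) a b); on the torus the bracket is at most r + (1-p) r^2 < p, so
    the inverse is a geometric series in xi_i and xi_i xi_j alone. Keeping these two as separate
    hypotheses is what yields the degree inequality between xi_j and xi_i. *)
Lemma nice_inv_fpq p r N E i j : admissible p r -> addclosed E ->
  (1 <= i <= N)%nat -> (1 <= j <= N)%nat ->
  nice r N E (fun xi => xi i) -> nice r N E (fun xi => xi i * xi j)%C ->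
  nice r N E (fun xi => / fpq p (xi i) (xi j))%C.
Proof.
  intros Ha HE Hi Hj H1 H2.
  assert (Hlt := admissible_lt p r Ha).
  destruct Ha as (Hp & Hr & Hr1 & _).
  apply nice_ext with (fun xi => / (RtoC p - (xi i + RtoC (- (1 - p)) * (xi i * xi j))))%C.
  { intros xi Ht; f_equal; unfold fpq; rewrite RtoC_opp; ring. }
  apply nice_inv_sub with (r + (1 - p) * (r * r)); try easy.
  - nra.
  - apply nice_plus; [easy | now apply nice_scal].
  - intros xi Ht; eapply Rle_trans; [apply Cmod_triangle|].
    rewrite !Cmod_mult, Cmod_R, Rabs_Ropp, Rabs_right, !Ht by (easy || lra); lra.
Qed.

Lemma nice_inv_one_sub p r N E i : admissible p r -> addclosed E ->
  (1 <= i <= N)%nat -> E (single i 1) -> nice r N E (fun xi => / (1 - xi i))%C.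
Proof.
  intros (_ & Hr & Hr1 & _) HE Hi H.
  apply nice_inv_sub with r; try easy.
  - lra.
  - now apply nice_var.
  - intros xi Ht; rewrite Ht; [lra | easy].
Qed.

Lemma nice_Pol r N E T F : 0 < r -> addclosed E ->
  (forall i, In i T -> (1 <= i <= N)%nat /\ E (single i 1)) ->
  Pol T F -> nice r N E F.
Proof.
  intros Hr HE HT HF; induction HF as [c|k Hk|F G _ IF _ IG|F G _ IF _ IG|F G E' _ IF].
  - apply nice_const, HE.
  - apply nice_var; now apply HT.
  - now apply nice_plus.
  - now apply nice_mult_closed.
  - now apply nice_ext with F.
Qed.

(** * Comparing the degrees in two variables *)

(** [c] is an additive budget: slacks add up under products, so a long product is handled by summing
    the contributions of its factors. A total of at most 0 leads to [Kill]. *)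
Definition Gap (z b : nat) (c : Z) (e : nat -> Z) : Prop :=
  (forall i, i <> z -> (0 <= e i)%Z) /\ (e z <= e b + c)%Z.

(** Exponents that will contribute nothing: once multiplied by the initial monomial prod
    xi_i^(-y_i-1), having -1 at both [z] and [b] would give y_z <= y_b, against the order of the
    particles. *)
Definition Kill (T : list nat) (z : nat) (e : nat -> Z) : Prop :=
  exists b, In b T /\ (e z <= e b)%Z.

Lemma Gap_closed z b : addclosed (Gap z b 0).
Proof.
  split; [split; intros; lia|].
  intros e1 e2 [H1 H2] [H3 H4]; split; [intros i Hi; specialize (H1 i Hi); specialize (H3 i Hi)|]; lia.
Qed.

Lemma Gap_single z b i : i <> z -> b <> z -> Gap z b 0 (single i 1).
Proof.
  intros Hi Hb; unfold single; split.
  - intros j _; destruct (Nat.eqb j i); lia.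
  - apply not_eq_sym, Nat.eqb_neq in Hi as ->; destruct (Nat.eqb b i); lia.
Qed.

Lemma nice_Gap_mult r N z b c1 c2 c F G : 0 < r -> c = (c1 + c2)%Z ->
  nice r N (Gap z b c1) F -> nice r N (Gap z b c2) G ->
  nice r N (Gap z b c) (fun xi => F xi * G xi)%C.
Proof.
  intros Hr -> ; apply nice_mult; [easy|].
  intros e1 e2 [H1 H2] [H3 H4]; split; [intros i Hi; specialize (H1 i Hi); specialize (H3 i Hi)|]; lia.
Qed.

Lemma nice_Gap_weaken r N z b c1 c2 F : (c1 <= c2)%Z ->
  nice r N (Gap z b c1) F -> nice r N (Gap z b c2) F.
Proof.
  intros Hc; apply nice_weaken; intros e [H1 H2]; split; [easy | lia].
Qed.

Lemma nice_Gap_Kill r N z b c T F : In b T -> (c <= 0)%Z ->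
  nice r N (Gap z b c) F -> nice r N (Kill T z) F.
Proof.
  intros Hb Hc; apply nice_weaken; intros e [H1 H2]; exists b; split; [easy | lia].
Qed.

Lemma nice_Gap_Pol r N z b T F : 0 < r -> b <> z -> ~ In z T ->
  (forall i, In i T -> (1 <= i <= N)%nat) -> Pol T F -> nice r N (Gap z b 0) F.
Proof.
  intros Hr Hb Hz HT; apply nice_Pol; [easy | apply Gap_closed |].
  intros i Hi; split; [now apply HT|]; apply Gap_single; [now intros -> | easy].
Qed.

Lemma nice_Gap_powz r N z b n : 0 < r -> b <> z -> (1 <= z <= N)%nat ->
  nice r N (Gap z b (Z.of_nat n)) (fun xi => xi z ^ n)%C.
Proof.
  intros Hr Hb Hz; apply nice_ext with (fun xi => Cpowz (xi z) (Z.of_nat n)).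
  { intros; apply Cpowz_of_nat. }
  apply nice_Cpowz; [easy|]; unfold single; split.
  - intros i Hi; apply Nat.eqb_neq in Hi as ->; lia.
  - rewrite Nat.eqb_refl; apply Nat.eqb_neq in Hb as ->; lia.
Qed.

Lemma nice_Gap_powb r N z b n : 0 < r -> b <> z -> (1 <= b <= N)%nat ->
  nice r N (Gap z b (- Z.of_nat n)) (fun xi => xi b ^ n)%C.
Proof.
  intros Hr Hb Hz; apply nice_ext with (fun xi => Cpowz (xi b) (Z.of_nat n)).
  { intros; apply Cpowz_of_nat. }
  apply nice_Cpowz; [easy|]; unfold single; split.
  - intros i Hi; destruct (Nat.eqb i b); lia.
  - rewrite Nat.eqb_refl; apply not_eq_sym, Nat.eqb_neq in Hb as ->; lia.
Qed.

Lemma nice_Gap_var r N z b i : 0 < r -> i <> z -> b <> z -> (1 <= i <= N)%nat ->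
  nice r N (Gap z b 0) (fun xi => xi i).
Proof. intros; apply nice_var; [easy | now apply Gap_single]. Qed.

Lemma nice_Gap_prod_pow r N z b n T : 0 < r -> ~ In z T -> In b T ->
  (forall i, In i T -> (1 <= i <= N)%nat) ->
  nice r N (Gap z b (- Z.of_nat n)) (fun xi => Cprod T (fun i => xi i ^ n))%C.
Proof.
  intros Hr Hz Hb HT.
  assert (Hbz : b <> z) by now intros ->.
  destruct (in_split _ _ Hb) as (T1 & T2 & E).
  assert (P : Permutation T (b :: T1 ++ T2)) by (rewrite E; symmetry; apply Permutation_middle).
  apply nice_ext with (fun xi => xi b ^ n * Cprod (T1 ++ T2) (fun i => xi i ^ n))%C.
  { intros xi _; now rewrite (Cprod_perm _ _ _ P), Cprod_cons. }
  apply nice_Gap_mult with (- Z.of_nat n)%Z 0%Z; [easy | lia | |].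
  - apply nice_Gap_powb; auto.
  - apply nice_Gap_Pol with (T1 ++ T2); try easy.
    + intros H; apply Hz; apply (Permutation_in _ (Permutation_sym P)); now right.
    + intros i Hi; apply HT; apply (Permutation_in _ (Permutation_sym P)); now right.
    + apply Pol_Cprod; intros; now apply Pol_pow, Pol_var.
Qed.

Lemma nice_Gap_Cprod {A} r N z b (c : Z) (l : list A) (F : A -> (nat -> C) -> C) : 0 < r ->
  (forall a, In a l -> nice r N (Gap z b c) (F a)) ->
  nice r N (Gap z b (Z.of_nat (length l) * c)) (fun xi => Cprod l (fun a => F a xi)).
Proof.
  intros Hr; induction l as [|a l IH]; intros H.
  - apply (nice_const r N _ 1); apply Gap_closed.
  - apply (nice_Gap_mult r N z b c (Z.of_nat (length l) * c) _ (F a)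
      (fun xi => Cprod l (fun a => F a xi))); [easy | simpl length; lia | |].
    + apply H; now left.
    + apply IH; intros; apply H; now right.
Qed.

(** Both monomials of the expansion, xi_b and xi_b xi_z, have at least as much degree in [b] as in
    [z]. *)
Lemma nice_Gap_inv_fpq p r N z b : admissible p r -> b <> z ->
  (1 <= z <= N)%nat -> (1 <= b <= N)%nat ->
  nice r N (Gap z b 0) (fun xi => / fpq p (xi b) (xi z))%C.
Proof.
  intros Ha Hb Hz Hbn; assert (Hr := proj1 (proj2 Ha)).
  apply nice_inv_fpq; try easy.
  - apply Gap_closed.
  - now apply nice_Gap_var.
  - apply nice_Gap_mult with (-1)%Z 1%Z; [easy | lia | |].
    + apply nice_ext with (fun xi => xi b ^ 1)%C; [intros; apply Cpow_1_r|].
      now apply (nice_Gap_powb r N z b 1).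
    + apply nice_ext with (fun xi => xi z ^ 1)%C; [intros; apply Cpow_1_r|].
      now apply (nice_Gap_powz r N z b 1).
Qed.

Lemma nice_Gap_z r N z b : 0 < r -> b <> z -> (1 <= z <= N)%nat ->
  nice r N (Gap z b 1) (fun xi => xi z).
Proof.
  intros Hr Hb Hz; apply nice_ext with (fun xi => xi z ^ 1)%C; [intros; apply Cpow_1_r|].
  now apply (nice_Gap_powz r N z b 1).
Qed.

Lemma nice_Gap_fpq_z p r N z b s : 0 < r -> b <> z -> s <> z -> (1 <= z <= N)%nat ->
  (1 <= s <= N)%nat -> nice r N (Gap z b 1) (fun xi => fpq p (xi z) (xi s)).
Proof.
  intros Hr Hb Hs Hz Hsn.
  apply nice_ext with (fun xi => RtoC p + xi z * (RtoC (1 - p) * xi s + RtoC (-1)))%C.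
  { intros; unfold fpq; ring. }
  apply nice_plus.
  - apply nice_Gap_weaken with 0%Z; [lia|]; apply nice_const, Gap_closed.
  - apply nice_Gap_mult with 1%Z 0%Z; [easy | lia | now apply nice_Gap_z |].
    apply nice_plus; [apply nice_scal; now apply nice_Gap_var | apply nice_const, Gap_closed].
Qed.

(* [difference_quotient V z = (prod (1 - v) - prod (z - v)) / (1 - z)]. *)
Fixpoint difference_quotient (V : list C) (z : C) : C :=
  match V with
  | [] => 0%C
  | c :: V' => ((z - c) * difference_quotient V' z + Cprod V' (fun v => 1 - v))%C
  end.

Lemma difference_quotientP V z :
  (Cprod V (fun v => z - v) = Cprod V (fun v => 1 - v) - (1 - z) * difference_quotient V z)%C.
Proof.
  induction V as [|c V IH]; simpl difference_quotient.
  - unfold Cprod; simpl; ring.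
  - rewrite !Cprod_cons, IH; ring.
Qed.

Lemma nice_Gap_difference_quotient r N z b T : 0 < r -> b <> z -> (1 <= z <= N)%nat ->
  ~ In z T -> (forall i, In i T -> (1 <= i <= N)%nat) ->
  nice r N (Gap z b (Z.of_nat (length T) - 1)) (fun xi => difference_quotient (map xi T) (xi z)).
Proof.
  intros Hr Hb Hz; induction T as [|c T IH]; intros HzT HT; [apply nice_zero|].
  apply nice_ext with (fun xi => (xi z - xi c) * difference_quotient (map xi T) (xi z) +
    Cprod T (fun i => 1 - xi i))%C.
  { intros; simpl; now rewrite Cprod_map. }
  assert (HT' : forall i, In i T -> (1 <= i <= N)%nat) by (intros; apply HT; now right).
  assert (HzT' : ~ In z T) by (intros H; apply HzT; now right).
  apply nice_plus.
  - apply nice_Gap_mult with 1%Z (Z.of_nat (length T) - 1)%Z; [easy | simpl length; lia | |].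
    + apply nice_ext with (fun xi => xi z + RtoC (-1) * xi c)%C; [intros; ring|].
      apply nice_plus; [now apply nice_Gap_z | apply nice_scal].
      apply nice_Gap_weaken with 0%Z; [lia|].
      apply nice_Gap_var; try easy; [intros ->; apply HzT; now left | apply HT; now left].
    + now apply IH.
  - apply nice_Gap_weaken with 0%Z; [simpl length; lia|].
    apply nice_Gap_Pol with T; try easy.
    apply Pol_Cprod; intros i Hi.
    apply Pol_minus; [apply Pol_const | now apply Pol_var].
Qed.

Lemma nice_Gap_prod_diff r N z b T : 0 < r -> b <> z -> (1 <= z <= N)%nat ->
  ~ In z T -> (forall i, In i T -> (1 <= i <= N)%nat) ->
  nice r N (Gap z b (Z.of_nat (length T))) (fun xi => Cprod T (fun i => xi z - xi i)%C).
Proof.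
  intros Hr Hb Hz HzT HT.
  apply nice_Gap_weaken with (Z.of_nat (length T) * 1)%Z; [lia|].
  apply (nice_Gap_Cprod r N z b 1 T (fun i xi => xi z - xi i)%C); [easy|]; intros i Hi.
  apply nice_ext with (fun xi => xi z + RtoC (-1) * xi i)%C; [intros; ring|].
  apply nice_plus; [now apply nice_Gap_z | apply nice_scal].
  apply nice_Gap_weaken with 0%Z; [lia|].
  apply nice_Gap_var; auto; now intros ->.
Qed.

Lemma nice_Gap_prod_fpq p r N z b T : 0 < r -> b <> z -> (1 <= z <= N)%nat ->
  ~ In z T -> (forall i, In i T -> (1 <= i <= N)%nat) ->
  nice r N (Gap z b (Z.of_nat (length T))) (fun xi => Cprod T (fun i => fpq p (xi z) (xi i))).
Proof.
  intros Hr Hb Hz HzT HT.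
  apply nice_Gap_weaken with (Z.of_nat (length T) * 1)%Z; [lia|].
  apply (nice_Gap_Cprod r N z b 1 T (fun i xi => fpq p (xi z) (xi i))); [easy|].
  intros i Hi; apply nice_Gap_fpq_z; auto; now intros ->.
Qed.

(* The gaps of the factors are inferred and added up; only the final comparison is left to [lia]. *)
Ltac gap := eapply nice_Gap_weaken; [|
  repeat first [ eassumption | apply nice_scal
    | apply nice_Gap_powz; assumption | apply nice_Gap_powb; solve [auto]
    | apply nice_Gap_prod_pow; assumption | apply nice_Gap_prod_fpq; assumption
    | apply nice_Gap_prod_diff; assumption | apply nice_Gap_difference_quotient; assumption
    | eapply nice_Gap_inv_fpq; solve [eauto] | apply nice_Gap_z; assumption
    | eapply nice_Gap_Pol; [eassumption | assumption | eassumption | eassumption | solve [eauto using Pol_mult]]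
    | eapply nice_Gap_mult; [eassumption | reflexivity | |] ] ]; try lia.

Lemma fpq_factor p a b : fpq p a b = (RtoC p - a * (1 - RtoC (1 - p) * b))%C.
Proof. unfold fpq; ring. Qed.

Lemma vd_snoc V z : vd (V ++ [z]) = (vd V * Cprod V (fun v => z - v))%C.
Proof.
  induction V as [|a V IH]; simpl app.
  - cbn [vd]; unfold Cprod; simpl; ring.
  - cbn [vd]; rewrite IH, Cprod_app, !Cprod_cons; change (Cprod [] _) with (RtoC 1); ring.
Qed.

Lemma half_succ k : ((S k * (S k - 1)) / 2 = k * (k - 1) / 2 + k)%nat.
Proof.
  replace (S k * (S k - 1))%nat with (k * (k - 1) + k * 2)%nat by (destruct k; simpl; nia).
  apply Nat.div_add; lia.
Qed.

(** One set of weights evaluated at three values of w: 0 and 1 with p replaced by 1, and 1 - (1-p)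
    z, since f(b, z) = p - b (1 - (1-p) z). *)
Lemma merging_partial_fractions T : T <> [] ->
  exists L : list (nat * ((nat -> C) -> C)),
    (forall bR, In bR L -> In (fst bR) T /\ Pol T (snd bR)) /\
    (forall xi, Csum L (fun bR => snd bR xi * xi (fst bR) ^ (length T - 1))%C = vd (map xi T)) /\
    (forall xi, (forall b, In b T -> (1 - xi b)%C <> 0%C) ->
       Csum L (fun bR => snd bR xi * xi (fst bR) ^ (length T - 1) / (1 - xi (fst bR)))%C =
       (vd (map xi T) / Cprod T (fun i => 1 - xi i))%C) /\
    (forall p xi z, (forall b, In b T -> fpq p (xi b) z <> 0%C) ->
       Csum L (fun bR => snd bR xi * xi (fst bR) ^ (length T - 1) / fpq p (xi (fst bR)) z)%C =
       (RtoC p ^ (length T - 1) * vd (map xi T) / Cprod T (fun b => fpq p (xi b) z))%C).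
Proof.
  intros HT; destruct (vd_partial_fractions T HT) as (L & HL & _ & EL).
  exists L; split; [easy|]; split; [|split].
  - intros xi; assert (E := EL (RtoC 1) xi (RtoC 0)); rewrite Cpow_1_l, Cmult_1_l in E.
    assert (H1 : forall b, (1 - xi b * 0)%C = 1%C) by (intros; ring).
    assert (HP : Cprod T (fun b => 1 - xi b * 0)%C = 1%C).
    { clear - H1; induction T as [|a T IH]; [reflexivity|]; rewrite Cprod_cons, IH, H1; ring. }
    rewrite HP in E; replace (vd (map xi T)) with (vd (map xi T) / 1)%C by field; rewrite <- E.
    + apply Csum_ext; intros; rewrite H1; field.
    + intros b _; rewrite H1; apply C1_nz.
  - intros xi H; assert (E := EL (RtoC 1) xi (RtoC 1)); rewrite Cpow_1_l, Cmult_1_l in E.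
    rewrite (Cprod_ext T (fun i => 1 - xi i)%C (fun i => 1 - xi i * 1)%C) by (intros; ring).
    rewrite <- E by (intros b Hb; rewrite Cmult_1_r; auto).
    apply Csum_ext; intros; now rewrite Cmult_1_r.
  - intros p xi z H.
    rewrite (Cprod_ext T _ (fun b => RtoC p - xi b * (1 - RtoC (1 - p) * z))%C) by (intros; apply fpq_factor).
    rewrite <- EL by (intros b Hb; rewrite <- fpq_factor; now apply H).
    apply Csum_ext; intros; now rewrite fpq_factor.
Qed.

(** The term in which [z] is picked first and so receives the least exponent [n]. Budget, with k =
    length T: z^n and the factors f(z, .) cost n + k; the variable [b] gains n + 1 from the larger
    exponents and k - 1 from the partial fractions of the Vandermonde factor over the f(b, z). The
    slack is 0. *)
Lemma nice_Kill_last_first p r N z T n ns : admissible p r -> (1 <= z <= N)%nat ->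
  NoDup T -> ~ In z T -> (forall i, In i T -> (1 <= i <= N)%nat) -> T <> [] -> ns <> [] ->
  nice r N (Kill T z) (fun xi => xi z ^ n * Cprod T (fun i => fpq p (xi z) (xi i)) *
    numerator p (map (fun k => k + S n)%nat ns) (map xi T) /
    Cprod T (fun i => fpq p (xi i) (xi z)))%C.
Proof.
  intros Ha Hz Hd HzT HT HTn Hns.
  assert (Hr := proj1 (proj2 Ha)).
  assert (Hp : RtoC p <> 0%C) by (intros A; apply RtoC_inj in A; destruct Ha; lra).
  destruct (numerator_vd_div p ns T Hns Hd) as (Q & HQ & EQ).
  destruct (merging_partial_fractions T HTn) as (L & HL & E0' & E1' & E').
  assert (Hk : (1 <= length T)%nat) by (destruct T; [easy | simpl; lia]).
  set (k := length T) in *.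
  apply nice_ext with (fun xi => Csum L (fun bR => / (RtoC p) ^ (k - 1) *
    (((xi z ^ n * Cprod T (fun i => fpq p (xi z) (xi i))) *
     ((Cprod T (fun i => xi i ^ S n) * xi (fst bR) ^ (k - 1)) * (Q xi * snd bR xi))) *
     / fpq p (xi (fst bR)) (xi z))))%C.
  - intros xi Ht.
    assert (HD : forall b, In b T -> fpq p (xi b) (xi z) <> 0%C).
    { intros b Hb; apply (fpq_torus_nz p r N); auto. }
    rewrite numerator_shift, EQ, Cprod_map by easy.
    rewrite (Csum_ext L _ (fun bR => (/ (RtoC p) ^ (k - 1) * (xi z ^ n * Cprod T (fun i => fpq p (xi z) (xi i)) *
       Cprod T (fun i => xi i ^ S n) * Q xi)) *
       (snd bR xi * xi (fst bR) ^ (k - 1) / fpq p (xi (fst bR)) (xi z))))%C by (intros; unfold Cdiv; ring).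
    rewrite Csum_scal, E' by easy; fold k.
    field; split; [now apply Cprod_nz | now apply Cpow_nz].
  - apply nice_Csum.
    intros bR HbR; destruct (HL bR HbR) as [Hb HR]; set (b := fst bR) in *.
    assert (Hbz : b <> z) by now intros ->.
    apply nice_Gap_Kill with b 0%Z; [easy | lia |].
    gap.
Qed.

(** Removal of [z] when no entry of [Lambda] remains to be picked. At z = 1 the product of the f(b,
    z) is p^k times that of the 1 - b, with k = length T; so p^k / prod f(b, z) - 1 / prod (1 - b)
    is divisible by 1 - z, and the quotient is again a sum of partial fractions. *)
Lemma nice_Kill_merge p r N z T n : admissible p r -> (1 <= z <= N)%nat ->
  NoDup T -> ~ In z T -> (forall i, In i T -> (1 <= i <= N)%nat) -> T <> [] ->
  nice r N (Kill T z) (fun xi =>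
    numerator p [n] (map xi (T ++ [z])) / ((1 - xi z) * Cprod T (fun i => fpq p (xi i) (xi z))) -
    xi z ^ n / (1 - xi z) * numerator p [n] (map xi T))%C.
Proof.
  intros Ha Hz Hd HzT HT HTn.
  assert (Hr := proj1 (proj2 Ha)).
  assert (Hp : RtoC p <> 0%C) by (intros A; apply RtoC_inj in A; destruct Ha; lra).
  destruct (merging_partial_fractions T HTn) as (L & HL & E0' & E1' & E').
  assert (Hk : (1 <= length T)%nat) by (destruct T; [easy | simpl; lia]).
  set (k := length T) in *.
  pose (c0 := (RtoC p ^ (k * (k - 1) / 2))%C).
  pose (zx := fun xi : nat -> C => (xi z ^ n * Cprod T (fun i => xi i ^ n))%C).
  pose (PI' := fun xi : nat -> C => (Cprod T (fun i => xi i ^ 1))%C).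
  pose (P := fun xi : nat -> C => Cprod T (fun i => xi z - xi i)%C).
  pose (P1 := fun xi : nat -> C => Cprod T (fun i => 1 - xi i)%C).
  pose (U := fun xi : nat -> C => difference_quotient (map xi T) (xi z)).
  (* The first sum comes from the quotient by 1 - z: there x_b^k pays for the k factors z - x_i. The
     second is the remainder: x_b^(k-1) pays for the difference quotient [U], of degree at most k -
     1 in z. *)
  apply nice_ext with (fun xi => Csum L (fun bR => c0 * (zx xi *
      ((P xi * (1 + RtoC (-1) * (xi z * PI' xi))) * ((RtoC (1 - p) * snd bR xi * xi (fst bR) ^ k) *
        (/ (1 - xi (fst bR)) * / fpq p (xi (fst bR)) (xi z)))))) +
     Csum L (fun bR => c0 * (zx xi * ((snd bR xi * xi (fst bR) ^ (k - 1) * Cprod T (fun i => / (1 - xi i))) *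
        (PI' xi * P1 xi + U xi * (RtoC (-1) + xi z * PI' xi))))))%C.
  - intros xi Ht.
    assert (HD : forall b, In b T -> fpq p (xi b) (xi z) <> 0%C).
    { intros b Hb; apply (fpq_torus_nz p r N); auto. }
    assert (H1 : forall b, In b T -> (1 - xi b)%C <> 0%C).
    { intros b Hb; apply (one_sub_torus_nz p r N); auto. }
    assert (H1z : (1 - xi z)%C <> 0%C) by (apply (one_sub_torus_nz p r N); auto).
    assert (HP1 : P1 xi <> 0%C) by now apply Cprod_nz.
    assert (HDp : Cprod T (fun i => fpq p (xi i) (xi z)) <> 0%C) by now apply Cprod_nz.
    assert (Hpk : forall j, (RtoC p ^ j)%C <> 0%C) by (intros; now apply Cpow_nz).
    assert (E := E' p xi (xi z) HD); assert (E1 := E1' xi H1); assert (E0 := E0' xi); fold k (P1 xi) in E, E1, E0.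
    (* Term by term from p (1 - b) - f(b, z) = (1 - p) b (1 - z), the difference of the values of
       f(b, .) at 1 and at z. *)
    assert (E3 : (RtoC (1 - p) * Csum L (fun bR => snd bR xi * xi (fst bR) ^ k /
        ((1 - xi (fst bR)) * fpq p (xi (fst bR)) (xi z))))%C =
      ((RtoC p ^ k * vd (map xi T) / Cprod T (fun i => fpq p (xi i) (xi z)) -
       vd (map xi T) / P1 xi) / (1 - xi z))%C).
    { replace (RtoC p ^ k)%C with (RtoC p * RtoC p ^ (k - 1))%C
        by (rewrite <- Cpow_S; f_equal; lia).
      replace (RtoC p * RtoC p ^ (k - 1) * vd (map xi T) / Cprod T (fun i => fpq p (xi i) (xi z)))%C
        with (RtoC p * Csum L (fun bR => snd bR xi * xi (fst bR) ^ (k - 1) / fpq p (xi (fst bR)) (xi z)))%C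
        by (rewrite E; field; easy).
      rewrite <- E1, <- (Csum_scal L (RtoC p)), <- Csum_minus, <- (Csum_scal L (RtoC (1 - p))).
      unfold Cdiv at 2; rewrite Cmult_comm, <- Csum_scal; apply Csum_ext; intros bR HbR.
      assert (Hb := proj1 (HL bR HbR)); assert (Hb1 := H1 _ Hb); assert (HbD := HD _ Hb).
      replace k with (S (k - 1)) at 1 by lia; rewrite Cpow_S.
      set (b := xi (fst bR)) in *.
      replace (RtoC p * _ - _)%C with
        (snd bR xi * b ^ (k - 1) * ((RtoC p * (1 - b) - fpq p b (xi z)) / ((1 - b) * fpq p b (xi z))))%C
        by (field; easy).
      replace (RtoC p * (1 - b) - fpq p b (xi z))%C with (RtoC (1 - p) * b * (1 - xi z))%C
        by (unfold fpq; rewrite RtoC_minus; ring).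
      field; easy. }
    rewrite (Csum_ext L (fun bR => c0 * _)%C (fun bR => (c0 * zx xi * (P xi * (1 - xi z * PI' xi)) * RtoC (1 - p)) *
       (snd bR xi * xi (fst bR) ^ k / ((1 - xi (fst bR)) * fpq p (xi (fst bR)) (xi z))))%C).
    2:{ intros bR HbR; assert (Hb := proj1 (HL bR HbR)); assert (Hb1 := H1 _ Hb); assert (HbD := HD _ Hb).
        field; easy. }
    rewrite (Csum_ext L (fun bR => c0 * (zx xi * (_ * _)))%C (fun bR => (c0 * zx xi * / P1 xi *
        (PI' xi * P1 xi - U xi * (1 - xi z * PI' xi))) * (snd bR xi * xi (fst bR) ^ (k - 1)))%C).
    2:{ intros bR _; rewrite Cprod_inv by easy; fold (P1 xi); ring. }
    rewrite !Csum_scal, E0.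
    match goal with |- (?A * ?X + _)%C = _ =>
      replace (A * X)%C with (c0 * zx xi * (P xi * (1 - xi z * PI' xi)) * (RtoC (1 - p) * X))%C by ring end.
    rewrite E3.
    cbn [numerator]; rewrite map_app; simpl map; rewrite vd_snoc, !Cprod_app, length_app, length_map.
    simpl length; fold k; rewrite Nat.add_1_r, half_succ, Cpow_add_r; fold c0.
    rewrite !Cprod_cons, !Cprod_map; change (Cprod [] _) with (RtoC 1).
    fold (P xi).
    assert (EP : Cprod T (fun i => xi i) = PI' xi).
    { apply Cprod_ext; intros; now rewrite Cpow_1_r. }
    rewrite EP.
    assert (EU := difference_quotientP (map xi T) (xi z)).
    rewrite !Cprod_map in EU; fold (P xi) (P1 xi) (U xi) in EU.
    rewrite EU; unfold zx; field; easy.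
  - assert (Hinv : forall b i, b <> z -> In i T -> nice r N (Gap z b 0) (fun xi => / (1 - xi i))%C).
    { intros b i Hb Hi; apply nice_inv_one_sub with p; auto; [apply Gap_closed|].
      apply Gap_single; [now intros -> | easy]. }
    assert (Hc : forall b (c : C), nice r N (Gap z b 0) (fun _ => c)) by (intros; apply nice_const, Gap_closed).
    assert (HP1 : Pol T P1).
    { apply Pol_Cprod; intros i Hi; apply (Pol_minus T (fun _ => RtoC 1)); [apply Pol_const | now apply Pol_var]. }
    apply nice_plus; apply nice_Csum; intros bR HbR; destruct (HL bR HbR) as [Hb HR];
      set (b := fst bR) in *; assert (Hbz : b <> z) by (now intros ->);
      assert (Hb1 := Hinv b b Hbz Hb); assert (HU : nice r N (Gap z b 0) (fun xi => RtoC (-1) + xi z * PI' xi)%C)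
        by (apply nice_plus; [apply Hc | unfold PI'; gap]);
      apply nice_Gap_Kill with b 0%Z; try easy; unfold zx, P.
    + assert (Hm : nice r N (Gap z b 0) (fun xi => 1 + RtoC (-1) * (xi z * PI' xi))%C).
      { apply nice_plus; [apply Hc | unfold PI'; gap]. }
      gap.
    + assert (HQ : nice r N (Gap z b (Z.of_nat (k - 1))) (fun xi => PI' xi * P1 xi + U xi * (RtoC (-1) + xi z * PI' xi))%C).
      { apply nice_plus; unfold U; [unfold PI'|]; gap. }
      assert (Hi : nice r N (Gap z b 0) (fun xi => Cprod T (fun i => / (1 - xi i)))%C).
      { apply nice_Cprod; auto; apply Gap_closed. }
      gap.
Qed.

(** Exponents of factors free of [z] and regular at 0 in the other variables; multiplication by such
    factors preserves [Kill]. *)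
Definition Pos (z : nat) (e : nat -> Z) : Prop :=
  (forall i, i <> z -> (0 <= e i)%Z) /\ e z = 0%Z.

Lemma Pos_closed z : addclosed (Pos z).
Proof.
  split; [split; intros; lia|].
  intros e1 e2 [H1 H2] [H3 H4]; split; [intros i Hi; specialize (H1 i Hi); specialize (H3 i Hi)|]; lia.
Qed.

Lemma Pos_single z i : i <> z -> Pos z (single i 1).
Proof.
  intros H; unfold single; split.
  - intros j _; destruct (Nat.eqb j i); lia.
  - now apply not_eq_sym, Nat.eqb_neq in H as ->.
Qed.

Lemma nice_Kill_mult r N z T T' F G : 0 < r -> incl T T' -> ~ In z T ->
  nice r N (Pos z) F -> nice r N (Kill T z) G -> nice r N (Kill T' z) (fun xi => F xi * G xi)%C.
Proof.
  intros Hr HT Hz; apply nice_mult; [easy|].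
  intros e1 e2 [H1 H2] (b & Hb & H3); exists b; split; [now apply HT|].
  specialize (H1 b); assert (b <> z) by now intros ->. specialize (H1 H); lia.
Qed.

(** * Reduction of the amplitude in its last variable *)

(** The part of the amplitude on [T ++ [z]] that involves [z]; the rest is the inverse denominator
    of [T] alone. *)
Definition last_factor (p : R) (z : nat) (ns : list nat) (T : list nat) (xi : nat -> C) : C :=
  (numerator p ns (map xi (T ++ [z])) / ((1 - xi z) * Cprod T (fun i => fpq p (xi i) (xi z))))%C.

Definition in_range (N : nat) (T : list nat) : Prop := forall i, In i T -> (1 <= i <= N)%nat.

(** Either [z] is picked first, which falls into [Kill] because [n] is the least exponent; or some
    [a] of [T] is, and then f(a, z) cancels between numerator and denominator and leaves the same
    problem without [a]. [M] stands for the reduced form of the smaller [last_factor], known modulo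
    [Kill]. *)
Lemma last_factor_step p r N z T n n' ns (M : list nat -> (nat -> C) -> C) :
  admissible p r -> (1 <= z <= N)%nat -> NoDup T -> ~ In z T -> in_range N T -> T <> [] ->
  Forall (lt n) (n' :: ns) ->
  (forall t, In t (picks T) ->
     nice r N (Kill (snd t) z) (fun xi => last_factor p z (n' :: ns) (snd t) xi - M (snd t) xi)%C) ->
  nice r N (Kill T z) (fun xi => last_factor p z (n :: n' :: ns) T xi -
    Csum (picks T) (fun t => fst (fst t) * (xi (snd (fst t)) ^ n * (1 - xi (snd (fst t))) *
      Cprod (snd t) (fun j => fpq p (xi (snd (fst t))) (xi j)) * M (snd t) xi)))%C.
Proof.
  intros Ha Hz Hd HzT HT HTn Hn HM.
  assert (Hr := proj1 (proj2 Ha)).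
  pose (c := fun t : C * nat * list nat => fun xi : nat -> C => (fst (fst t) * (xi (snd (fst t)) ^ n *
    (1 - xi (snd (fst t))) * Cprod (snd t) (fun j => fpq p (xi (snd (fst t))) (xi j))))%C).
  (* All later exponents exceed [n], so the subtraction of n + 1 is not truncated. *)
  pose (ns0 := map (fun k => k - S n)%nat (n' :: ns)).
  assert (E0 : map (fun k => k + S n)%nat ns0 = n' :: ns).
  { unfold ns0; rewrite map_map, <- map_id; apply map_ext_in; intros k Hk.
    rewrite Forall_forall in Hn; specialize (Hn k Hk); lia. }
  apply nice_ext with (fun xi =>
    Csum (picks T) (fun t => c t xi * (last_factor p z (n' :: ns) (snd t) xi - M (snd t) xi)) +
    signC (length T) * (xi z ^ n * Cprod T (fun i => fpq p (xi z) (xi i)) *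
      numerator p (map (fun k => k + S n)%nat ns0) (map xi T) /
      Cprod T (fun i => fpq p (xi i) (xi z))))%C.
  - intros xi Ht.
    assert (HD : forall b, In b T -> fpq p (xi b) (xi z) <> 0%C).
    { intros b Hb; apply (fpq_torus_nz p r N); auto. }
    assert (H1z : (1 - xi z)%C <> 0%C) by (apply (one_sub_torus_nz p r N); auto).
    assert (HDp : Cprod T (fun i => fpq p (xi i) (xi z)) <> 0%C) by now apply Cprod_nz.
    rewrite E0; unfold last_factor at 2.
    rewrite numerator_cons, picks_map, Csum_map, picks_snoc, Csum_app, Csum_map, Csum_cons.
    change (Csum [] _) with (RtoC 0); simpl fst; simpl snd.
    rewrite Cprod_map.
    set (last_term := numerator p (n' :: ns) (map xi T)).
    rewrite (Csum_ext (picks T) (fun t => c t xi * _)%C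
      (fun t => c t xi * last_factor p z (n' :: ns) (snd t) xi - c t xi * M (snd t) xi)%C) by (intros; ring).
    rewrite Csum_minus.
    rewrite (Csum_ext (picks T) (fun t => fst (fst t) * (_ * M (snd t) xi))%C
      (fun t => c t xi * M (snd t) xi)%C) by (intros; unfold c; ring).
    rewrite (Csum_ext (picks T) (fun a => _ * (_ * numerator _ _ _))%C
      (fun t => ((1 - xi z) * Cprod T (fun i => fpq p (xi i) (xi z))) *
          (c t xi * last_factor p z (n' :: ns) (snd t) xi)))%C.
    + rewrite Csum_scal; field; easy.
    + intros t Hin; assert (P := picks_perm T t Hin); unfold c, last_factor.
      assert (HDa : fpq p (xi (snd (fst t))) (xi z) <> 0%C).
      { apply HD, (Permutation_in _ (Permutation_sym P)); now left. }
      assert (HDr : Cprod (snd t) (fun i => fpq p (xi i) (xi z)) <> 0%C).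
      { apply Cprod_nz; intros b Hb; apply HD, (Permutation_in _ (Permutation_sym P)); now right. }
      rewrite (Cprod_perm _ _ _ P), Cprod_cons, Cprod_map, Cprod_app, Cprod_cons.
      change (Cprod [] _) with (RtoC 1); field; easy.
  - apply nice_plus.
    + apply nice_Csum.
      intros t Hin; assert (P := picks_perm T t Hin).
      assert (Hinc : incl (snd t) T).
      { intros b Hb; apply (Permutation_in _ (Permutation_sym P)); now right. }
      assert (Hin1 : In (snd (fst t)) T).
      { apply (Permutation_in _ (Permutation_sym P)); now left. }
      apply (nice_Kill_mult r N z (snd t) T (c t)); auto.
      apply nice_Pol with T; [easy | apply Pos_closed | |].
      * intros i Hi; split; [now apply HT | apply Pos_single; now intros ->].
      * unfold c; pol.
    + apply nice_scal; apply nice_Kill_last_first; easy.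
Qed.

Lemma picks_rest {A} (T : list A) t : In t (picks T) -> NoDup T ->
  NoDup (snd t) /\ incl (snd t) T /\ length T = S (length (snd t)).
Proof.
  intros Hin Hd; assert (P := picks_perm T t Hin); repeat split.
  - apply (Permutation_NoDup P) in Hd; now inversion Hd.
  - intros b Hb; apply (Permutation_in _ (Permutation_sym P)); now right.
  - now apply picks_length.
Qed.

Lemma numerator_cons_map p n n' ns (T : list nat) xi :
  numerator p (n :: n' :: ns) (map xi T) = Csum (picks T) (fun t => fst (fst t) *
    (xi (snd (fst t)) ^ n * (1 - xi (snd (fst t))) *
      Cprod (snd t) (fun j => fpq p (xi (snd (fst t))) (xi j)) * numerator p (n' :: ns) (map xi (snd t))))%C.
Proof.
  rewrite numerator_cons, picks_map, Csum_map; apply Csum_ext; intros t _; simpl fst; simpl snd.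
  now rewrite Cprod_map.
Qed.

(** Some particle is left unprescribed, and the recursion ends in [nice_Kill_merge]. With l the last
    exponent, the surviving factor z^l / (1 - z) integrates against z^(-y-1) to the indicator of l
    <= y. *)
Lemma last_factor_free p r N z ns T : admissible p r -> (1 <= z <= N)%nat ->
  NoDup T -> ~ In z T -> in_range N T -> ns <> [] -> StronglySorted lt ns ->
  (length ns <= length T)%nat ->
  nice r N (Kill T z) (fun xi => last_factor p z ns T xi -
     xi z ^ last ns 0%nat / (1 - xi z) * numerator p ns (map xi T))%C.
Proof.
  intros Ha Hz; revert T; induction ns as [|n ns IH]; [easy|]; intros T Hd HzT HT _ Hs Hl.
  assert (HTn : T <> []) by (intros ->; simpl in Hl; lia).
  destruct ns as [|n' ns].
  - apply nice_Kill_merge; easy.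
  - apply StronglySorted_inv in Hs; destruct Hs as [Hs Hn].
    eapply nice_ext; [|apply (last_factor_step p r N z T n n' ns
      (fun T xi => xi z ^ last (n' :: ns) 0%nat / (1 - xi z) * numerator p (n' :: ns) (map xi T))%C); try easy].
    + intros xi _; rewrite numerator_cons_map; f_equal; f_equal.
      change (last (n :: n' :: ns) 0%nat) with (last (n' :: ns) 0%nat).
      rewrite <- Csum_scal; apply Csum_ext; intros; ring.
    + intros t Hin; destruct (picks_rest T t Hin Hd) as (Hd' & Hi & Hlen).
      apply IH; try easy.
      * intros H; now apply HzT, Hi.
      * intros i H; now apply HT, Hi.
      * simpl in Hl; simpl; lia.
Qed.

(** Every particle is prescribed, so modulo [Kill] the variable [z] takes the last exponent; the
    recursion ends at [z] alone, where the two factors 1 - z cancel. *)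
Lemma last_factor_full p r N z ns T : admissible p r -> (1 <= z <= N)%nat ->
  NoDup T -> ~ In z T -> in_range N T -> StronglySorted lt ns ->
  length ns = S (length T) ->
  nice r N (Kill T z) (fun xi => last_factor p z ns T xi -
     xi z ^ last ns 0%nat * numerator p (removelast ns) (map xi T))%C.
Proof.
  intros Ha Hz; revert T; induction ns as [|n ns IH]; [easy|]; intros T Hd HzT HT Hs Hl.
  destruct ns as [|n' ns].
  - assert (T = []) as -> by (destruct T; [easy | simpl in Hl; lia]).
    apply nice_ext with (fun _ => 0%C); [|apply nice_zero].
    intros xi Ht; assert (H1z : (1 - xi z)%C <> 0%C) by (apply (one_sub_torus_nz p r N); auto).
    unfold last_factor, Cprod; simpl; field; easy.
  - assert (HTn : T <> []) by (intros ->; simpl in Hl; lia).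
    apply StronglySorted_inv in Hs; destruct Hs as [Hs Hn].
    eapply nice_ext; [|apply (last_factor_step p r N z T n n' ns
      (fun T xi => xi z ^ last (n' :: ns) 0%nat * numerator p (removelast (n' :: ns)) (map xi T))%C); try easy].
    + intros xi _; change (last (n :: n' :: ns) 0%nat) with (last (n' :: ns) 0%nat).
      change (removelast (n :: n' :: ns)) with (n :: removelast (n' :: ns)).
      cbn beta; f_equal.
      rewrite (Csum_ext _ _ (fun t => xi z ^ last (n' :: ns) 0%nat * (fst (fst t) *
        (xi (snd (fst t)) ^ n * (1 - xi (snd (fst t))) *
         Cprod (snd t) (fun j => fpq p (xi (snd (fst t))) (xi j)) *
         numerator p (removelast (n' :: ns)) (map xi (snd t))))))%C by (intros; ring).
      rewrite Csum_scal; f_equal.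
      (* When [removelast] leaves the single exponent [n], [numerator] uses its closing clause
         instead of an expansion; the two agree because [T] then has one element. *)
      destruct ns as [|n'' ns].
      * destruct T as [|a [|b T]]; simpl in Hl; try lia.
        unfold Csum, Cprod; simpl; ring.
      * symmetry; apply numerator_cons_map.
    + intros t Hin; destruct (picks_rest T t Hin Hd) as (Hd' & Hi & Hlen).
      apply IH; try easy.
      * intros H; now apply HzT, Hi.
      * intros i H; now apply HT, Hi.
      * simpl in Hl; simpl; lia.
Qed.

(** * The initial condition *)

Lemma pairs_lt_in l i j : In (i, j) (pairs_lt l) -> In i l /\ In j l.
Proof.
  induction l as [|a l IH]; [easy|]; simpl; intros H.
  apply in_app_or in H; destruct H as [H|H].
  - apply in_map_iff in H; destruct H as (b & E & Hb); injection E as -> ->; auto.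
  - destruct (IH H); auto.
Qed.

Lemma Cprod_pairs_snoc l z (F : nat * nat -> C) :
  Cprod (pairs_lt (l ++ [z])) F = (Cprod (pairs_lt l) F * Cprod l (fun i => F (i, z)))%C.
Proof.
  induction l as [|a l IH]; cbn [pairs_lt app].
  - unfold Cprod; simpl; ring.
  - rewrite !Cprod_app, IH, map_app, Cprod_app, !Cprod_cons, !Cprod_map.
    cbn [map]; rewrite Cprod_cons; change (Cprod [] _) with (RtoC 1); ring.
Qed.

Definition denominator (p : R) (T : list nat) (xi : nat -> C) : C :=
  (Cprod (pairs_lt T) (fun ij => fpq p (xi (fst ij)) (xi (snd ij))) * Cprod T (fun i => 1 - xi i))%C.

(** The integrand without initial monomial and time factor, up to the shift of the exponents; the
    sum over [Lambda] is already carried out inside [numerator]. *)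
Definition amplitude (p : R) (ns T : list nat) (xi : nat -> C) : C :=
  (numerator p ns (map xi T) * / denominator p T xi)%C.

Lemma nice_inv_denominator p r N E T : admissible p r -> addclosed E ->
  (forall i, In i T -> (1 <= i <= N)%nat /\ E (single i 1)) ->
  nice r N E (fun xi => / denominator p T xi)%C.
Proof.
  intros Ha HE HT; assert (Hr := proj1 (proj2 Ha)).
  apply nice_ext with (fun xi => Cprod (pairs_lt T) (fun ij => / fpq p (xi (fst ij)) (xi (snd ij))) *
    Cprod T (fun i => / (1 - xi i)))%C.
  - intros xi Ht; unfold denominator; rewrite !Cprod_inv.
    + field; split; [|apply Cprod_nz].
      * apply Cprod_nz; intros i Hi; apply (one_sub_torus_nz p r N); auto; now apply HT.
      * intros [i j] Hij; apply pairs_lt_in in Hij; destruct Hij.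
        apply (fpq_torus_nz p r N); auto; now apply HT.
    + intros i Hi; apply (one_sub_torus_nz p r N); auto; now apply HT.
    + intros [i j] Hij; apply pairs_lt_in in Hij; destruct Hij.
      apply (fpq_torus_nz p r N); auto; now apply HT.
  - apply nice_mult_closed; try easy.
    + apply nice_Cprod; try easy.
      intros [i j] Hij; apply pairs_lt_in in Hij; destruct Hij as [Hi Hj]; simpl.
      destruct (HT i Hi), (HT j Hj).
      apply nice_inv_fpq; try easy; [now apply nice_var|].
      apply nice_mult_closed; try easy; now apply nice_var.
    + apply nice_Cprod; try easy.
      intros i Hi; destruct (HT i Hi); now apply nice_inv_one_sub with p.
Qed.

Lemma nice_amplitude p r N E ns T : admissible p r -> addclosed E ->
  (forall i, In i T -> (1 <= i <= N)%nat /\ E (single i 1)) ->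
  nice r N E (amplitude p ns T).
Proof.
  intros Ha HE HT; assert (Hr := proj1 (proj2 Ha)).
  apply nice_mult_closed; try easy.
  - apply nice_Pol with T; try easy; apply Pol_numerator, incl_refl.
  - now apply nice_inv_denominator.
Qed.

Lemma amplitude_snoc p r N ns T z xi : admissible p r -> torus r N xi -> in_range N T ->
  (1 <= z <= N)%nat ->
  amplitude p ns (T ++ [z]) xi = (last_factor p z ns T xi * / denominator p T xi)%C.
Proof.
  intros Ha Ht HT Hz; unfold amplitude, last_factor, denominator.
  rewrite Cprod_pairs_snoc, Cprod_app, Cprod_cons; change (Cprod [] _) with (RtoC 1); simpl fst; simpl snd.
  assert (H1 : (1 - xi z)%C <> 0%C) by (apply (one_sub_torus_nz p r N); auto).
  assert (H2 : Cprod T (fun i => fpq p (xi i) (xi z)) <> 0%C).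
  { apply Cprod_nz; intros i Hi; apply (fpq_torus_nz p r N); auto. }
  assert (H3 : Cprod T (fun i => 1 - xi i)%C <> 0%C).
  { apply Cprod_nz; intros i Hi; apply (one_sub_torus_nz p r N); auto. }
  assert (H4 : Cprod (pairs_lt T) (fun ij => fpq p (xi (fst ij)) (xi (snd ij))) <> 0%C).
  { apply Cprod_nz; intros [i j] Hij; apply pairs_lt_in in Hij; destruct Hij.
    apply (fpq_torus_nz p r N); auto. }
  field; easy.
Qed.

Lemma nice_mono r N (E : (nat -> Z) -> Prop) e : E e -> nice r N E (mono N e).
Proof.
  intros HE eps Heps; exists [(RtoC 1, e)]; split; [now repeat constructor|].
  intros xi _; unfold lpoly; rewrite Csum_cons; simpl fst; simpl snd.
  replace (_ - _)%C with (RtoC 0) by (change (Csum [] _) with (RtoC 0); ring).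
  rewrite Cmod_0; lra.
Qed.

Lemma any_closed : addclosed anyE.
Proof. now split. Qed.

Lemma nice_any_inv_denominator p r N T : admissible p r -> in_range N T ->
  nice r N anyE (fun xi => / denominator p T xi)%C.
Proof. intros Ha HT; apply nice_inv_denominator; try easy; intros i Hi; split; [now apply HT | easy]. Qed.

Lemma nice_any_amplitude p r N ns T : admissible p r -> in_range N T ->
  nice r N anyE (amplitude p ns T).
Proof. intros Ha HT; apply nice_amplitude; try easy; intros i Hi; split; [now apply HT | easy]. Qed.

Lemma nice_any_Pol r N T F : 0 < r -> in_range N T -> Pol T F -> nice r N anyE F.
Proof. intros Hr HT; apply nice_Pol; try easy; intros i Hi; split; [now apply HT | easy]. Qed.

Lemma in_range_seq n N : (n <= N)%nat -> in_range N (seq 1 n).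
Proof. intros H i Hi; apply in_seq in Hi; lia. Qed.

Lemma nice_any_inv_var r N i : 0 < r -> (1 <= i <= N)%nat -> nice r N anyE (fun xi => / xi i)%C.
Proof.
  intros Hr Hi; apply nice_ext with (fun xi => Cpowz (xi i) (-1)).
  - intros xi Ht; apply Cpowz_neg1; now apply (torus_nz r N).
  - now apply nice_Cpowz.
Qed.

Ltac nice_any := repeat first
  [ assumption | exact any_closed
  | apply nice_any_amplitude | apply nice_any_inv_denominator | apply in_range_seq; lia
  | apply nice_mono; exact I
  | match goal with
    | |- nice _ _ _ (fun xi => Cplus (@?F xi) (@?G xi)) => apply nice_plus
    | |- nice _ _ _ (fun xi => Cmult ?c (@?G xi)) => apply nice_scal
    | |- nice _ _ _ (fun xi => Cmult (@?F xi) (@?G xi)) => apply nice_mult_closed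
    | |- nice _ _ _ (fun xi => Cpow (@?F xi) _) => apply nice_pow
    | |- nice _ _ _ (fun xi => Cinv (Cminus _ (xi _))) => eapply nice_inv_one_sub; [eassumption | | lia | exact I]
    | |- nice _ _ _ (fun xi => Cinv (xi _)) => apply nice_any_inv_var; [assumption | lia]
    | |- nice _ _ _ (fun xi => Cpowz (xi _) _) => apply nice_Cpowz; [lia | exact I]
    | |- nice _ _ _ (fun xi => xi _) => apply nice_var; [lia | exact I]
    end ].

Definition free_of (z : nat) (e : nat -> Z) : Prop := e z = 0%Z.

Lemma free_of_closed z : addclosed (free_of z).
Proof. split; unfold free_of; lia. Qed.

Lemma free_of_single z i n : i <> z -> free_of z (single i n).
Proof. intros H; unfold free_of, single; now apply not_eq_sym, Nat.eqb_neq in H as ->. Qed.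

(** By z^n / (1 - z) = z^n + z^(n+1) / (1 - z) the value changes only at n = -1, and for n >= 0
    there is no pole inside the circle. *)
Lemma contour_n_last_geom p r N H n : admissible p r ->
  nice r (S N) (free_of (S N)) H -> (forall env z, H (upd env (S N) z) = H env) ->
  contour_n r (S N) (fun xi => Cpowz (xi (S N)) n * / (1 - xi (S N)) * H xi)%C =
  if Z.ltb n 0 then contour_n r N H else 0%C.
Proof.
  intros Ha HH HHe; assert (Hr := proj1 (proj2 Ha)).
  assert (HHa : nice r (S N) anyE H) by now apply nice_weaken with (free_of (S N)).
  pose (J := fun n => contour_n r (S N) (fun xi => Cpowz (xi (S N)) n * / (1 - xi (S N)) * H xi)%C).
  assert (H0 : forall n, (0 <= n)%Z -> J n = 0%C).
  { intros k Hk; apply (contour_n_zero r (S N) (fun e => (0 <= e (S N))%Z)); [easy | |].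
    - apply nice_mult with (fun e => (0 <= e (S N))%Z) (free_of (S N)); try easy.
      + unfold free_of; intros; lia.
      + apply nice_mult_closed; try easy; [split; intros; lia | |].
        * apply nice_Cpowz; [lia|]; unfold single; now rewrite Nat.eqb_refl.
        * apply nice_inv_one_sub with p; try easy; [split; intros; lia | lia|].
          unfold single; now rewrite Nat.eqb_refl.
    - intros e He; exists (S N); split; lia. }
  assert (HS : forall n, J n = ((if Z.eqb n (-1) then contour_n r N H else 0) + J (n + 1)%Z)%C).
  { intros k; rewrite <- (contour_n_last r N H k) by easy; unfold J.
    rewrite <- (contour_n_plus r (S N) anyE); [|easy| |]; try (now nice_any).
    apply (contour_n_ext r (S N) anyE); [easy | now nice_any|].
    intros xi Ht.
    assert (Hz : xi (S N) <> 0%C) by (apply (torus_nz r (S N)); auto; lia).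
    assert (H1 : (1 - xi (S N))%C <> 0%C) by (apply (one_sub_torus_nz p r (S N)); auto; lia).
    rewrite Cpowz_succ by easy; field; easy. }
  fold (J n); destruct (Z.ltb_spec n 0) as [Hn|Hn]; [|now apply H0].
  replace n with (- Z.of_nat (S (Z.to_nat (- n - 1))))%Z by lia.
  induction (Z.to_nat (- n - 1)) as [|k IH]; rewrite HS.
  - rewrite (H0 (- Z.of_nat 1 + 1)%Z) by lia; simpl; ring.
  - replace (- Z.of_nat (S (S k)) + 1)%Z with (- Z.of_nat (S k))%Z by lia; rewrite IH.
    replace (- Z.of_nat (S (S k)) =? -1)%Z with false by (symmetry; apply Z.eqb_neq; lia); ring.
Qed.

Definition start_exponent (Y : list Z) (i : nat) : Z := (- nth (i - 1) Y 0 - 1)%Z.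

Lemma start_exponent_last N Y y : length Y = N -> start_exponent (Y ++ [y]) (S N) = (- y - 1)%Z.
Proof.
  intros HY; unfold start_exponent; simpl; rewrite Nat.sub_0_r, app_nth2, HY, Nat.sub_diag by lia.
  reflexivity.
Qed.

Lemma mono_snoc_start N Y y xi : length Y = N ->
  mono (S N) (start_exponent (Y ++ [y])) xi =
  (mono N (start_exponent Y) xi * Cpowz (xi (S N)) (- y - 1))%C.
Proof.
  intros HY; unfold mono; rewrite seq_S, Cprod_app, Cprod_cons; change (Cprod [] _) with (RtoC 1).
  rewrite Cmult_1_r; f_equal.
  - apply Cprod_ext; intros i Hi; apply in_seq in Hi; unfold start_exponent.
    rewrite app_nth1 by lia; easy.
  - now rewrite <- (start_exponent_last N Y y).
Qed.

Lemma nice_free_mono r N Y : 0 < r -> nice r (S N) (free_of (S N)) (mono N (start_exponent Y)).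
Proof.
  intros Hr.
  apply nice_Cprod;
    [easy | apply free_of_closed|].
  intros i Hi; apply in_seq in Hi; apply nice_Cpowz; [lia | apply free_of_single; lia].
Qed.

Lemma mono_upd_last N e env z : mono N e (upd env (S N) z) = mono N e env.
Proof.
  apply Cprod_ext; intros i Hi; apply in_seq in Hi; now rewrite upd_other by lia.
Qed.

Lemma amplitude_upd_last p ns N env z :
  amplitude p ns (seq 1 N) (upd env (S N) z) = amplitude p ns (seq 1 N) env.
Proof.
  assert (H : forall i, In i (seq 1 N) -> upd env (S N) z i = env i).
  { intros i Hi; apply in_seq in Hi; now rewrite upd_other by lia. }
  unfold amplitude, denominator; f_equal; [|f_equal; f_equal].
  - f_equal; now apply map_ext_in.
  - apply Cprod_ext; intros [i j] Hij; apply pairs_lt_in in Hij; simpl; now rewrite !H.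
  - apply Cprod_ext; intros i Hi; now rewrite H.
Qed.

Lemma contour_n_Kill p r N Y y F : admissible p r -> length Y = N ->
  Forall (fun y' => (y' < y)%Z) Y ->
  nice r (S N) (Kill (seq 1 N) (S N)) F ->
  contour_n r (S N) (fun xi => F xi * (/ denominator p (seq 1 N) xi *
    mono (S N) (start_exponent (Y ++ [y])) xi))%C = 0%C.
Proof.
  intros Ha HY Hy HF; assert (Hr := proj1 (proj2 Ha)).
  (* The [Kill] inequality after the shift of exponents by -y_i - 1; the inverse denominator only
     raises the exponents of variables other than [S N]. *)
  pose (E := fun e : nat -> Z => exists b, In b (seq 1 N) /\ (e (S N) + y <= e b + nth (b - 1) Y 0)%Z).
  apply (contour_n_zero r (S N) E); [easy | |].
  - apply nice_mult with (Kill (seq 1 N) (S N))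
      (fun e => exists e', Pos (S N) e' /\ forall i, e i = (e' i + start_exponent (Y ++ [y]) i)%Z); try easy.
    + intros e1 e2 (b & Hb & H1) (e' & (H2 & H3) & H4); exists b; split; [easy|].
      apply in_seq in Hb; rewrite !H4, H3.
      specialize (H2 b ltac:(lia)).
      rewrite start_exponent_last by easy.
      replace (start_exponent (Y ++ [y]) b) with (start_exponent Y b); [unfold start_exponent; lia|].
      unfold start_exponent; rewrite app_nth1 by lia; easy.
    + apply nice_mult with (Pos (S N)) (fun e => e = start_exponent (Y ++ [y])); [easy | | |].
      * intros e1 e2 H1 ->; now exists e1.
      * apply nice_inv_denominator; [easy | apply Pos_closed |].
        intros i Hi; split; [apply in_seq in Hi; lia|]; apply in_seq in Hi; apply Pos_single; lia.
      * now apply nice_mono.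
  - intros e (b & Hb & Hle).
    destruct (Z.eq_dec (e b) (-1)) as [Eb|Eb].
    + exists (S N); split; [lia|]; intros Ez.
      assert (Hlt : (nth (b - 1) Y 0 < y)%Z).
      { rewrite Forall_forall in Hy; apply Hy, nth_In; apply in_seq in Hb; lia. }
      lia.
    + exists b; split; [apply in_seq in Hb; lia | easy].
Qed.

Lemma StronglySorted_snoc_inv {A} (R : A -> A -> Prop) l a : StronglySorted R (l ++ [a]) ->
  StronglySorted R l /\ Forall (fun b => R b a) l.
Proof.
  induction l as [|b l IH]; intros H; [split; constructor|].
  simpl in H; apply StronglySorted_inv in H; destruct H as [H1 H2].
  destruct (IH H1) as [H3 H4]; apply Forall_app in H2; destruct H2 as [H2 H5].
  split; constructor; try easy; now inversion H5.
Qed.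

Lemma contour_n_amplitude_snoc p r N ns Y y M : admissible p r -> length Y = N ->
  Forall (fun y' => (y' < y)%Z) Y ->
  nice r (S N) (Kill (seq 1 N) (S N)) (fun xi => last_factor p (S N) ns (seq 1 N) xi - M xi)%C ->
  contour_n r (S N) (fun xi => amplitude p ns (seq 1 (S N)) xi *
    mono (S N) (start_exponent (Y ++ [y])) xi)%C =
  contour_n r (S N) (fun xi => M xi * (/ denominator p (seq 1 N) xi *
    mono (S N) (start_exponent (Y ++ [y])) xi))%C.
Proof.
  intros Ha HY Hy HK; assert (Hr := proj1 (proj2 Ha)).
  pose (rest := fun xi => (/ denominator p (seq 1 N) xi * mono (S N) (start_exponent (Y ++ [y])) xi)%C).
  assert (HR : nice r (S N) anyE rest) by (unfold rest; now nice_any).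
  assert (HD : nice r (S N) anyE (fun xi => (last_factor p (S N) ns (seq 1 N) xi - M xi) * rest xi)%C)
    by (apply nice_mult with (Kill (seq 1 N) (S N)) anyE; easy).
  assert (HA : nice r (S N) anyE (fun xi => amplitude p ns (seq 1 (S N)) xi *
    mono (S N) (start_exponent (Y ++ [y])) xi)%C) by now nice_any.
  symmetry; rewrite <- (contour_n_ext r (S N) anyE (fun xi => amplitude p ns (seq 1 (S N)) xi *
    mono (S N) (start_exponent (Y ++ [y])) xi +
    RtoC (-1) * ((last_factor p (S N) ns (seq 1 N) xi - M xi) * rest xi)))%C; [|easy| |].
  - rewrite (contour_n_plus r (S N) anyE), (contour_n_scal r (S N) anyE) by (easy || now nice_any).
    unfold rest; rewrite contour_n_Kill by easy; ring.
  - now nice_any.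
  - intros xi Ht; rewrite seq_S; change (1 + N)%nat with (S N).
    rewrite (amplitude_snoc p r (S N)) by (easy || (apply in_range_seq; lia) || lia).
    unfold rest; ring.
Qed.

Lemma initial_condition p r N ns Y : admissible p r -> length Y = N ->
  StronglySorted Z.lt Y -> StronglySorted lt ns -> (length ns <= N)%nat -> (ns = [] -> N = 0%nat) ->
  contour_n r N (fun xi => amplitude p ns (seq 1 N) xi * mono N (start_exponent Y) xi)%C =
  if list_eq_dec Z.eq_dec (firstn (length ns) Y) (map Z.of_nat ns) then 1%C else 0%C.
Proof.
  intros Ha; assert (Hr := proj1 (proj2 Ha)); revert ns Y.
  induction N as [|N IH]; intros ns Y HY Hs Hns Hl H0.
  - destruct ns; [|simpl in Hl; lia]; destruct Y; [|easy]; simpl.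
    unfold amplitude, denominator, mono, Cprod; simpl; field.
  - assert (Hnn : ns <> []) by (intros H; specialize (H0 H); lia).
    destruct (exists_last (l := Y)) as (Y' & y & ->); [now intros ->|].
    rewrite length_app in HY; simpl in HY; assert (HY' : length Y' = N) by lia.
    destruct (StronglySorted_snoc_inv _ _ _ Hs) as [Hs' Hy].
    assert (Hd : NoDup (seq 1 N)) by apply seq_NoDup.
    assert (Hz : ~ In (S N) (seq 1 N)) by (rewrite in_seq; lia).
    assert (Hrg : in_range (S N) (seq 1 N)) by (apply in_range_seq; lia).
    assert (HH : forall ns', nice r (S N) (free_of (S N))
      (fun xi => amplitude p ns' (seq 1 N) xi * mono N (start_exponent Y') xi)%C).
    { intros ns'; apply nice_mult_closed; try easy; [apply free_of_closed | | now apply nice_free_mono].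
      apply nice_amplitude; try easy; [apply free_of_closed|]; intros i Hi; split; [now apply Hrg|].
      apply in_seq in Hi; apply free_of_single; lia. }
    assert (HHa : forall ns', nice r (S N) anyE
      (fun xi => amplitude p ns' (seq 1 N) xi * mono N (start_exponent Y') xi)%C)
      by (intros; now apply nice_weaken with (free_of (S N))).
    assert (Hupd : forall ns' env z, (amplitude p ns' (seq 1 N) (upd env (S N) z) *
      mono N (start_exponent Y') (upd env (S N) z) =
      amplitude p ns' (seq 1 N) env * mono N (start_exponent Y') env)%C)
      by (intros; now rewrite amplitude_upd_last, mono_upd_last).
    destruct (le_lt_dec (length ns) N) as [Hle|Hlt].
    + rewrite (contour_n_amplitude_snoc p r N ns Y' y (fun xi => xi (S N) ^ last ns 0%nat / (1 - xi (S N)) *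
         numerator p ns (map xi (seq 1 N)))%C); try easy.
      2:{ apply last_factor_free; try easy; [lia | rewrite length_seq; lia]. }
      rewrite <- (contour_n_ext r (S N) anyE (fun xi => Cpowz (xi (S N)) (Z.of_nat (last ns 0%nat) + (- y - 1)) *
         / (1 - xi (S N)) * (amplitude p ns (seq 1 N) xi * mono N (start_exponent Y') xi))%C); [|easy| |].
      * rewrite (contour_n_last_geom p) by easy.
        rewrite firstn_app, HY'; replace (length ns - N)%nat with 0%nat by lia; simpl firstn; rewrite app_nil_r.
        rewrite IH; try easy.
        (* A zero integral means that [y] lies strictly left of the last prescribed site; [Y'] lies
           left of it too and cannot contain it, so the indicator is 0 as well. *)
        destruct (Z.ltb_spec (Z.of_nat (last ns 0%nat) + (- y - 1)) 0) as [Hy1|Hy1]; [easy|].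
        destruct (list_eq_dec _ _ _) as [E|]; [|easy].
        assert (Hin : In (Z.of_nat (last ns 0%nat)) Y').
        { rewrite <- (firstn_skipn (length ns) Y'), E; apply in_or_app; left; apply in_map.
          rewrite (app_removelast_last 0%nat Hnn) at 2; apply in_or_app; right; now left. }
        rewrite Forall_forall in Hy; specialize (Hy _ Hin); lia.
      * apply nice_mult_closed; try easy; now nice_any.
      * intros xi Ht; rewrite mono_snoc_start by easy; unfold amplitude.
        assert (Hz0 : xi (S N) <> 0%C) by (apply (torus_nz r (S N)); auto; lia).
        rewrite Cpowz_add, Cpowz_of_nat by easy; unfold Cdiv; ring.
    + assert (Hlen : length ns = S N) by lia.
      rewrite (contour_n_amplitude_snoc p r N ns Y' y (fun xi => xi (S N) ^ last ns 0%nat *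
         numerator p (removelast ns) (map xi (seq 1 N)))%C); try easy.
      2:{ apply last_factor_full; try easy; [lia | rewrite length_seq; lia]. }
      rewrite <- (contour_n_ext r (S N) anyE (fun xi => Cpowz (xi (S N)) (Z.of_nat (last ns 0%nat) + (- y - 1)) *
         (amplitude p (removelast ns) (seq 1 N) xi * mono N (start_exponent Y') xi))%C); [|easy| |].
      * rewrite contour_n_last by easy.
        set (ns' := removelast ns) in *; set (l := last ns 0%nat) in *.
        assert (Ens : ns = ns' ++ [l]) by now apply app_removelast_last.
        assert (Hlen' : length ns' = N) by (rewrite Ens, length_app in Hlen; simpl in Hlen; lia).
        rewrite Ens, map_app, length_app; simpl length; simpl map.
        rewrite firstn_all2 by (rewrite length_app; simpl; lia).
        rewrite IH; try easy.
        -- rewrite firstn_all2 by lia.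
           destruct (Z.eqb_spec (Z.of_nat l + (- y - 1)) (-1)) as [Ey|Ey];
             destruct (list_eq_dec Z.eq_dec Y' (map Z.of_nat ns')) as [E1|E1];
             destruct (list_eq_dec Z.eq_dec (Y' ++ [y]) (map Z.of_nat ns' ++ [Z.of_nat l])) as [E2|E2]; try easy.
           ++ elim E2; rewrite E1; do 2 f_equal; lia.
           ++ apply app_inj_tail in E2; now elim E1.
           ++ apply app_inj_tail in E2; lia.
           ++ apply app_inj_tail in E2; lia.
        -- rewrite Ens in Hns; now apply StronglySorted_snoc_inv in Hns.
        -- lia.
        -- intros E; rewrite E in Hlen'; easy.
      * apply nice_mult_closed; try easy; now nice_any.
      * intros xi Ht; rewrite mono_snoc_start by easy; unfold amplitude.
        assert (Hz0 : xi (S N) <> 0%C) by (apply (torus_nz r (S N)); auto; lia).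
        rewrite Cpowz_add, Cpowz_of_nat by easy; ring.
Qed.

(** * The backward equation *)

(** The symbol of one free jump attempt by a uniformly chosen particle: raising y_i by 1 multiplies
    the initial monomial by 1 / xi_i. *)
Definition one_step (p : R) (N : nat) (xi : nat -> C) : C :=
  Csum (seq 1 N) (fun i => / RtoC (INR N) * (RtoC p * / xi i + RtoC (1 - p) * xi i))%C.

(** The exponents [e] are arbitrary and not tied to a configuration, because the free recursion also
    visits coinciding positions. *)
Definition bethe_integrand (p : R) (N : nat) (ns : list nat) (n : nat) (e : nat -> Z) (xi : nat -> C) : C :=
  (amplitude p ns (seq 1 N) xi * mono N e xi * one_step p N xi ^ n)%C.

Definition bethe (p r : R) (N : nat) (ns : list nat) (n : nat) (e : nat -> Z) : C :=
  contour_n r N (bethe_integrand p N ns n e).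

Lemma nice_one_step p r N : 0 < r -> nice r N anyE (one_step p N).
Proof.
  intros Hr; apply nice_Csum.
  intros i Hi; apply in_seq in Hi; nice_any.
Qed.

Lemma nice_bethe p r N ns n e : admissible p r -> nice r N anyE (bethe_integrand p N ns n e).
Proof.
  intros Ha; assert (Hr := proj1 (proj2 Ha)); assert (Hg := nice_one_step p r N Hr).
  unfold bethe_integrand; nice_any.
Qed.

Definition bump (e : nat -> Z) (i : nat) (d : Z) (j : nat) : Z := (e j + single i d j)%Z.

Lemma bethe_integrand_bump p r N ns n e i d xi : 0 < r -> torus r N xi -> (1 <= i <= N)%nat ->
  bethe_integrand p N ns n (bump e i d) xi = (bethe_integrand p N ns n e xi * Cpowz (xi i) d)%C.
Proof.
  intros Hr Ht Hi; unfold bethe_integrand, bump; rewrite (mono_add r), mono_single by easy; ring.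
Qed.

Lemma bethe_plus p r N ns n e1 e2 (a b : C) : admissible p r ->
  contour_n r N (fun xi => a * bethe_integrand p N ns n e1 xi + b * bethe_integrand p N ns n e2 xi)%C =
  (a * bethe p r N ns n e1 + b * bethe p r N ns n e2)%C.
Proof.
  intros Ha; assert (Hr := proj1 (proj2 Ha)); assert (H := fun e => nice_bethe p r N ns n e Ha).
  rewrite (contour_n_plus r N anyE), !(contour_n_scal r N anyE); try easy; now apply nice_scal.
Qed.

Lemma bethe_succ p r N ns n e : admissible p r ->
  bethe p r N ns (S n) e = Csum (seq 1 N) (fun i => / RtoC (INR N) *
    (RtoC p * bethe p r N ns n (bump e i (-1)) + RtoC (1 - p) * bethe p r N ns n (bump e i 1)))%C.
Proof.
  intros Ha; assert (Hr := proj1 (proj2 Ha)); assert (H := fun e => nice_bethe p r N ns n e Ha).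
  rewrite (Csum_ext _ _ (fun i => contour_n r N (fun xi => / RtoC (INR N) *
      (RtoC p * bethe_integrand p N ns n (bump e i (-1)) xi +
       RtoC (1 - p) * bethe_integrand p N ns n (bump e i 1) xi)))%C).
  - rewrite <- (contour_n_Csum r N anyE); [|easy|].
    + apply contour_n_ext with anyE; [easy | now apply nice_bethe |].
      intros xi Ht.
      replace (bethe_integrand p N ns (S n) e xi) with (bethe_integrand p N ns n e xi * one_step p N xi)%C
        by (unfold bethe_integrand; rewrite Cpow_S; ring).
      unfold one_step; rewrite <- Csum_scal; apply Csum_ext; intros i Hi.
      assert (Hx := torus_nz_seq r N xi i Hr Ht Hi); apply in_seq in Hi.
      rewrite !(bethe_integrand_bump p r), Cpowz_neg1, Cpowz_1 by (easy || lia); ring.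
    + intros i _; apply nice_scal, nice_plus; now apply nice_scal.
  - intros i _; rewrite (contour_n_scal r N anyE), bethe_plus by
      (easy || (apply nice_plus; now apply nice_scal)); easy.
Qed.

(** Only the pair of the exchanged neighbours changes its order; cross-multiplication keeps the
    identity free of division. *)
Lemma pairs_prod_swap (F : nat * nat -> C) l1 a b l2 :
  (Cprod (pairs_lt (l1 ++ b :: a :: l2)) F * F (a, b) =
   Cprod (pairs_lt (l1 ++ a :: b :: l2)) F * F (b, a))%C.
Proof.
  induction l1 as [|c l1 IH]; cbn [app pairs_lt].
  - cbn [map]; rewrite !Cprod_app, ?Cprod_cons, ?Cprod_app; ring.
  - rewrite !Cprod_app, !Cprod_map, <- !Cmult_assoc, IH.
    rewrite (Cprod_perm (l1 ++ b :: a :: l2) (l1 ++ a :: b :: l2)); [ring|].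
    apply Permutation_app_head, perm_swap.
Qed.

(** The numerator changes sign, and the denominator is symmetric except for the factor of the pair
    (i, i+1). Multiplied by that factor the amplitude is antisymmetric. *)
Lemma amplitude_swap p r N ns i xi : admissible p r -> torus r N xi -> (1 <= i < N)%nat ->
  ns <> [] ->
  (amplitude p ns (seq 1 N) (fun j => xi (swap_idx i j)) * fpq p (xi (S i)) (xi i) =
   - (amplitude p ns (seq 1 N) xi * fpq p (xi i) (xi (S i))))%C.
Proof.
  intros Ha Ht Hi Hns; unfold amplitude, denominator.
  rewrite <- (map_map (swap_idx i) xi), <- (Cprod_map (swap_idx i) (seq 1 N) (fun j => 1 - xi j)%C).
  assert (E : Cprod (pairs_lt (seq 1 N)) (fun ij => fpq p (xi (swap_idx i (fst ij))) (xi (swap_idx i (snd ij)))) =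
    Cprod (pairs_lt (map (swap_idx i) (seq 1 N))) (fun ij => fpq p (xi (fst ij)) (xi (snd ij)))).
  { generalize (seq 1 N); intros l; induction l as [|a l IHl]; [reflexivity|].
    cbn [map pairs_lt]; rewrite !Cprod_app, IHl, !Cprod_map; reflexivity. }
  rewrite E; clear E.
  rewrite (Cprod_perm _ _ (fun j => 1 - xi j)%C (map_swap_perm N i Hi)).
  rewrite map_swap_seq, (seq_swap_split N i) by easy.
  rewrite !map_app; cbn [map]; rewrite numerator_swap by easy.
  set (l1 := seq 1 (i - 1)); set (l2 := seq (S (S i)) (N - i - 1)).
  assert (EP := pairs_prod_swap (fun ij => fpq p (xi (fst ij)) (xi (snd ij))) l1 i (S i) l2).
  cbn beta in EP; cbn [fst snd] in EP.
  assert (Hl : in_range N (l1 ++ i :: S i :: l2)).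
  { unfold l1, l2; rewrite <- seq_swap_split by easy; intros j Hj; apply in_seq in Hj; lia. }
  assert (Hl' : in_range N (l1 ++ S i :: i :: l2)).
  { unfold l1, l2; rewrite <- map_swap_seq by easy; intros j Hj.
    apply (Permutation_in _ (map_swap_perm N i Hi)), in_seq in Hj; lia. }
  assert (HP : forall l, in_range N l ->
    Cprod (pairs_lt l) (fun ij => fpq p (xi (fst ij)) (xi (snd ij))) <> 0%C).
  { intros l Hr; apply Cprod_nz; intros [a b] Hab; apply pairs_lt_in in Hab; destruct Hab.
    apply (fpq_torus_nz p r N); auto. }
  assert (H1 : Cprod (l1 ++ i :: S i :: l2) (fun j => 1 - xi j)%C <> 0%C).
  { apply Cprod_nz; intros j Hj; apply (one_sub_torus_nz p r N); auto. }
  assert (HPa := HP _ Hl); assert (HPb := HP _ Hl').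
  assert (Hf1 : fpq p (xi i) (xi (S i)) <> 0%C) by (apply (fpq_torus_nz p r N); auto; lia).
  assert (Hf2 : fpq p (xi (S i)) (xi i) <> 0%C) by (apply (fpq_torus_nz p r N); auto; lia).
  set (A := Cprod (pairs_lt (l1 ++ i :: S i :: l2)) _) in *.
  set (B := Cprod (pairs_lt (l1 ++ S i :: i :: l2)) _) in *.
  replace (fpq p (xi (S i)) (xi i)) with (B * fpq p (xi i) (xi (S i)) / A)%C
    by (rewrite EP; field; easy).
  field; easy.
Qed.

Lemma one_step_swap p N i xi : (1 <= i < N)%nat ->
  one_step p N (fun j => xi (swap_idx i j)) = one_step p N xi.
Proof.
  intros Hi; unfold one_step.
  rewrite <- (Csum_map (swap_idx i) (seq 1 N)
    (fun j => / RtoC (INR N) * (RtoC p * / xi j + RtoC (1 - p) * xi j)))%C.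
  now apply Csum_perm, map_swap_perm.
Qed.

Lemma mono_swap N i e xi : (1 <= i < N)%nat -> e i = e (S i) ->
  mono N e (fun j => xi (swap_idx i j)) = mono N e xi.
Proof.
  intros Hi He; unfold mono.
  rewrite <- (Cprod_perm _ _ (fun j => Cpowz (xi j) (e j)) (map_swap_perm N i Hi)), Cprod_map.
  apply Cprod_ext; intros j _; f_equal; unfold swap_idx.
  destruct (Nat.eqb_spec j i); [now subst|]; destruct (Nat.eqb_spec j (S i)); now subst.
Qed.

Lemma swap_idx_l i : swap_idx i i = S i.
Proof. unfold swap_idx; now rewrite Nat.eqb_refl. Qed.

Lemma swap_idx_r i : swap_idx i (S i) = i.
Proof. rewrite <- (swap_idx_l i); apply swap_idx_invol. Qed.

Lemma bethe_boundary p r N ns n e i : admissible p r -> ns <> [] -> (1 <= i < N)%nat ->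
  e (S i) = (e i - 1)%Z ->
  (RtoC p * bethe p r N ns n (bump e i (-1)) +
   RtoC (1 - p) * bethe p r N ns n (bump e (S i) 1))%C = bethe p r N ns n e.
Proof.
  intros Ha Hns Hi He; assert (Hr := proj1 (proj2 Ha)); assert (H := fun e => nice_bethe p r N ns n e Ha).
  rewrite <- bethe_plus by easy; apply Ceq_minus.
  assert (H2 : nice r N anyE (fun xi => RtoC p * bethe_integrand p N ns n (bump e i (-1)) xi +
    RtoC (1 - p) * bethe_integrand p N ns n (bump e (S i) 1) xi)%C)
    by (apply nice_plus; now apply nice_scal).
  assert (H3 : nice r N anyE (fun xi => RtoC (-1) * bethe_integrand p N ns n e xi)%C) by now apply nice_scal.
  replace (_ - _)%C with (contour_n r N (fun xi => (RtoC p * bethe_integrand p N ns n (bump e i (-1)) xi +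
    RtoC (1 - p) * bethe_integrand p N ns n (bump e (S i) 1) xi) +
    RtoC (-1) * bethe_integrand p N ns n e xi))%C.
  - apply (contour_n_antisym r N anyE i); try easy; [now apply nice_plus|].
    (* For x = xi_i and x' = xi_(i+1) one has p / x + (1 - p) x' - 1 = f(x, x') / x. Lowering e_i by
       1 makes the exponents at i and i + 1 equal, so the factors beside amplitude times f are
       symmetric. *)
    assert (E : forall xi, torus r N xi -> (RtoC p * bethe_integrand p N ns n (bump e i (-1)) xi +
      RtoC (1 - p) * bethe_integrand p N ns n (bump e (S i) 1) xi + RtoC (-1) * bethe_integrand p N ns n e xi)%C =
      ((amplitude p ns (seq 1 N) xi * fpq p (xi i) (xi (S i))) *
       (mono N (bump e i (-1)) xi * one_step p N xi ^ n))%C).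
    { intros xi Ht; assert (Hx : xi i <> 0%C) by (apply (torus_nz r N); auto; lia).
      rewrite !(bethe_integrand_bump p r) by (easy || lia); unfold bethe_integrand, bump.
      rewrite (mono_add r), mono_single, Cpowz_neg1, Cpowz_1 by (easy || lia).
      unfold fpq; field; easy. }
    intros xi Ht; rewrite !E by (try apply torus_swap; easy).
    rewrite one_step_swap, mono_swap by (try easy; unfold bump, single; rewrite Nat.eqb_refl;
      replace (Nat.eqb (S i) i) with false by (symmetry; apply Nat.eqb_neq; lia); lia).
    rewrite swap_idx_l, swap_idx_r, (amplitude_swap p r N ns i xi) by easy; ring.
  - rewrite (contour_n_plus r N anyE), (contour_n_scal r N anyE) by easy; unfold bethe; ring.
Qed.

Lemma bethe_ext p r N ns n e e' : (forall i, (1 <= i <= N)%nat -> e i = e' i) ->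
  bethe p r N ns n e = bethe p r N ns n e'.
Proof.
  intros H; apply contour_n_ext_all; intros xi; unfold bethe_integrand; now rewrite (mono_ext N e e').
Qed.

(** * The jump chain *)

Definition increasing (Y : list Z) : Prop :=
  forall i j, (i < j < length Y)%nat -> (nth i Y 0 < nth j Y 0)%Z.

Lemma increasing_of_sorted Y : StronglySorted Z.lt Y -> increasing Y.
Proof.
  induction 1 as [|a Y HY IH Ha]; intros i j Hij; [simpl in Hij; lia|].
  destruct j; [lia|]; destruct i; simpl in *.
  - rewrite Forall_forall in Ha; apply Ha, nth_In; lia.
  - apply IH; lia.
Qed.

Lemma sorted_of_increasing Y : increasing Y -> StronglySorted Z.lt Y.
Proof.
  induction Y as [|a Y IH]; intros H; constructor.
  - apply IH; intros i j Hij; apply (H (S i) (S j)); simpl; lia.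
  - apply Forall_forall; intros b Hb; destruct (In_nth _ _ 0%Z Hb) as (j & Hj & <-).
    apply (H 0%nat (S j)); simpl; lia.
Qed.

(** The move with exclusion switched off; the result need not be increasing. *)
Definition displace (Y : list Z) (k : nat) (d : Z) : list Z :=
  firstn k Y ++ (nth k Y 0 + d)%Z :: skipn (S k) Y.

Lemma length_displace Y k d : (k < length Y)%nat -> length (displace Y k d) = length Y.
Proof.
  intros Hk; unfold displace; rewrite length_app, length_firstn; cbn [length]; rewrite length_skipn; lia.
Qed.

Lemma nth_displace Y k d j : (k < length Y)%nat ->
  nth j (displace Y k d) 0%Z = (if Nat.eqb j k then nth k Y 0 + d else nth j Y 0)%Z.
Proof.
  intros Hk; unfold displace; destruct (Nat.eqb_spec j k) as [->|Hj].
  - rewrite app_nth2; rewrite length_firstn; [|lia].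
    replace (k - Nat.min k (length Y))%nat with 0%nat by lia; reflexivity.
  - destruct (lt_dec j k).
    + rewrite app_nth1 by (rewrite length_firstn; lia); rewrite nth_firstn.
      now replace (j <? k)%nat with true by (symmetry; apply Nat.ltb_lt; lia).
    + rewrite app_nth2; rewrite length_firstn; [|lia].
      replace (j - Nat.min k (length Y))%nat with (S (j - k - 1)) by lia; cbn [nth].
      rewrite nth_skipn; f_equal; lia.
Qed.

(** In an increasing configuration only the next particle can occupy the target site. *)
Lemma move_right Y k : increasing Y -> (k < length Y)%nat ->
  asep_move Y k 1 = if (S k <? length Y)%nat && (nth (S k) Y 0 =? nth k Y 0 + 1)%Z
    then Y else displace Y k 1.
Proof.
  intros HY Hk; unfold asep_move; fold (displace Y k 1).
  replace (existsb (Z.eqb (nth k Y 0 + 1)%Z) Y) with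
    ((S k <? length Y)%nat && (nth (S k) Y 0 =? nth k Y 0 + 1)%Z); [easy|].
  apply eq_true_iff_eq; rewrite existsb_exists, andb_true_iff, Nat.ltb_lt, Z.eqb_eq; split.
  - intros [H1 H2]; exists (nth (S k) Y 0%Z); split; [now apply nth_In | apply Z.eqb_eq; lia].
  - intros (x & Hx & Ex); apply Z.eqb_eq in Ex; destruct (In_nth _ _ 0%Z Hx) as (j & Hj & Ej).
    assert (Hkj : (k < j)%nat).
    { destruct (lt_eq_lt_dec k j) as [[|Ekj]|Hlt]; [easy | subst; lia |].
      assert (H := HY j k ltac:(lia)); lia. }
    destruct (Nat.eq_dec j (S k)) as [->|Hn]; [split; [easy | lia]|].
    assert (A1 := HY k (S k) ltac:(lia)); assert (A2 := HY (S k) j ltac:(lia)); lia.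
Qed.

Lemma move_left Y k : increasing Y -> (k < length Y)%nat ->
  asep_move Y k (-1) = if (1 <=? k)%nat && (nth k Y 0 =? nth (k - 1) Y 0 + 1)%Z
    then Y else displace Y k (-1).
Proof.
  intros HY Hk; unfold asep_move; fold (displace Y k (-1)).
  replace (existsb (Z.eqb (nth k Y 0 + -1)%Z) Y) with
    ((1 <=? k)%nat && (nth k Y 0 =? nth (k - 1) Y 0 + 1)%Z); [easy|].
  apply eq_true_iff_eq; rewrite existsb_exists, andb_true_iff, Nat.leb_le, Z.eqb_eq; split.
  - intros [H1 H2]; exists (nth (k - 1) Y 0%Z); split; [apply nth_In; lia | apply Z.eqb_eq; lia].
  - intros (x & Hx & Ex); apply Z.eqb_eq in Ex; destruct (In_nth _ _ 0%Z Hx) as (j & Hj & Ej).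
    assert (Hkj : (j < k)%nat).
    { destruct (lt_eq_lt_dec k j) as [[Hlt|Ekj]|Hlt]; [|subst; lia|easy].
      assert (H := HY k j ltac:(lia)); lia. }
    destruct (Nat.eq_dec j (k - 1)) as [->|Hn]; [split; lia|].
    assert (A1 := HY j (k - 1)%nat ltac:(lia)); assert (A2 := HY (k - 1)%nat k ltac:(lia)); lia.
Qed.

Lemma increasing_displace Y k d : increasing Y -> (k < length Y)%nat ->
  (forall j, (j < k)%nat -> (nth j Y 0 < nth k Y 0 + d)%Z) ->
  (forall j, (k < j < length Y)%nat -> (nth k Y 0 + d < nth j Y 0)%Z) ->
  increasing (displace Y k d).
Proof.
  intros HY Hk H1 H2 i j; rewrite length_displace by easy; intros Hij.
  rewrite !nth_displace by easy.
  destruct (Nat.eqb_spec i k); destruct (Nat.eqb_spec j k); subst; try lia.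
  - now apply H2.
  - apply H1; lia.
  - now apply HY.
Qed.

Lemma increasing_move Y k d : increasing Y -> (k < length Y)%nat -> d = 1%Z \/ d = (-1)%Z ->
  increasing (asep_move Y k d) /\ length (asep_move Y k d) = length Y.
Proof.
  intros HY Hk [-> | ->].
  - rewrite move_right by easy.
    destruct (_ && _) eqn:E; [easy|]; split; [|now apply length_displace].
    apply increasing_displace; try easy.
    + intros j Hj; assert (H := HY j k ltac:(lia)); lia.
    + intros j Hj; apply andb_false_iff in E; rewrite Nat.ltb_ge, Z.eqb_neq in E.
      assert (H := HY k (S k) ltac:(lia)).
      destruct (Nat.eq_dec j (S k)) as [->|Hn]; [lia|].
      assert (H' := HY (S k) j ltac:(lia)); lia.
  - rewrite move_left by easy.
    destruct (_ && _) eqn:E; [easy|]; split; [|now apply length_displace].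
    apply increasing_displace; try easy.
    + intros j Hj; apply andb_false_iff in E; rewrite Nat.leb_gt, Z.eqb_neq in E.
      assert (H := HY (k - 1)%nat k ltac:(lia)).
      destruct (Nat.eq_dec j (k - 1)) as [->|Hn]; [lia|].
      assert (H' := HY j (k - 1)%nat ltac:(lia)); lia.
    + intros j Hj; assert (H := HY k j ltac:(lia)); lia.
Qed.

(* Exclusion is encoded by the boundary condition: a blocked right jump of particle [k]
   is matched with the blocked left jump of particle [k + 1]. *)
Lemma exclusion_boundary p (v : list Z -> C) Y : increasing Y ->
  (forall k, (S k < length Y)%nat -> nth (S k) Y 0%Z = (nth k Y 0 + 1)%Z ->
     (RtoC p * v (displace Y k 1) + RtoC (1 - p) * v (displace Y (S k) (-1)))%C = v Y) ->
  Csum (seq 0 (length Y)) (fun k => RtoC p * v (asep_move Y k 1) + RtoC (1 - p) * v (asep_move Y k (-1)))%C =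
  Csum (seq 0 (length Y)) (fun k => RtoC p * v (displace Y k 1) + RtoC (1 - p) * v (displace Y k (-1)))%C.
Proof.
  intros HY HB.
  pose (bR := fun k => (S k <? length Y)%nat && (nth (S k) Y 0 =? nth k Y 0 + 1)%Z).
  pose (bL := fun k => (1 <=? k)%nat && (nth k Y 0 =? nth (k - 1) Y 0 + 1)%Z).
  symmetry; apply Ceq_minus; rewrite <- Csum_minus.
  rewrite (Csum_ext _ _ (fun k =>
    (if bR k then RtoC p * (v (displace Y k 1) - v Y) else 0) +
    (if bL k then RtoC (1 - p) * (v (displace Y k (-1)) - v Y) else 0)))%C.
  2:{ intros k Hk; apply in_seq in Hk; rewrite move_right, move_left by (easy || lia).
      fold (bR k) (bL k); destruct (bR k), (bL k); ring. }
  rewrite Csum_plus.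
  destruct (length Y) as [|n] eqn:Hn; [unfold Csum; simpl; ring|].
  (* The last particle is never blocked on the right nor the first on the left; without these two
     terms the right jump of k is aligned with the left jump of k + 1. *)
  rewrite seq_S at 1; rewrite <- cons_seq, <- seq_shift, Csum_app, !Csum_cons, Csum_map.
  replace (bR (0 + n)%nat) with false.
  2:{ symmetry; unfold bR; apply andb_false_iff; left; apply Nat.ltb_ge; lia. }
  replace (bL 0%nat) with false by reflexivity; change (Csum [] _) with (RtoC 0).
  replace (_ + _)%C with (Csum (seq 0 n) (fun k =>
    (if bR k then RtoC p * (v (displace Y k 1) - v Y) else 0) +
    (if bL (S k) then RtoC (1 - p) * (v (displace Y (S k) (-1)) - v Y) else 0)))%C
    by (rewrite Csum_plus; ring).
  apply Csum_zero; intros k Hk; apply in_seq in Hk.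
  replace (bL (S k)) with (bR k).
  - destruct (bR k) eqn:E; [|ring].
    unfold bR in E; apply andb_true_iff in E; rewrite Nat.ltb_lt, Z.eqb_eq in E.
    replace (_ + _)%C with ((RtoC p * v (displace Y k 1) + RtoC (1 - p) * v (displace Y (S k) (-1))) -
      (RtoC p + RtoC (1 - p)) * v Y)%C by ring.
    rewrite (HB k) by lia; rewrite RtoC_minus; ring.
  - unfold bR, bL; replace (S k <? S n)%nat with true by (symmetry; apply Nat.ltb_lt; lia).
    replace (S k - 1)%nat with k by lia; reflexivity.
Qed.

(** Exponents of the process seen from [x0]: the power xi_i^x0 moves from the target monomials to
    the initial one, which leaves natural numbers as target exponents. *)
Definition shifted_exponent (x0 : Z) (Y : list Z) (i : nat) : Z := (x0 - nth (i - 1) Y 0 - 1)%Z.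

Lemma RtoC_Rsum {A} (l : list A) (F : A -> R) : RtoC (Rsum l F) = Csum l (fun a => RtoC (F a)).
Proof.
  induction l as [|a l IH]; [reflexivity|].
  change (Rsum (a :: l) F) with (F a + Rsum l F); now rewrite RtoC_plus, IH.
Qed.

(** For n = 0 this is the initial condition translated by [x0]. In the step, exclusion is traded for
    free motion through the boundary identity; actual moves keep the configuration increasing, so
    the induction hypothesis applies to them. *)
Lemma asep_steps_bethe p r N ns x0 E n Y : admissible p r -> ns <> [] -> StronglySorted lt ns ->
  (length ns <= N)%nat ->
  (forall X, E X = if list_eq_dec Z.eq_dec (firstn (length ns) X) (map (fun k => x0 + Z.of_nat k)%Z ns)
     then true else false) ->
  increasing Y -> length Y = N ->
  RtoC (asep_steps p N n Y E) = bethe p r N ns n (shifted_exponent x0 Y).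
Proof.
  intros Ha Hns Hs Hl HE; assert (Hr := proj1 (proj2 Ha)).
  revert Y; induction n as [|n IH]; intros Y HY HN.
  - unfold bethe.
    rewrite (contour_n_ext_all r N _ (fun xi => amplitude p ns (seq 1 N) xi *
      mono N (start_exponent (map (fun y => y - x0)%Z Y)) xi)%C).
    + rewrite initial_condition; try easy.
      * simpl asep_steps; rewrite HE, firstn_map.
        destruct (list_eq_dec Z.eq_dec (firstn (length ns) Y) _) as [E1|E1];
          destruct (list_eq_dec Z.eq_dec (map _ (firstn (length ns) Y)) _) as [E2|E2]; try easy.
        -- elim E2; rewrite E1, map_map; apply map_ext; intros; lia.
        -- elim E1; rewrite <- (map_id (firstn (length ns) Y)), <- (map_map Z.of_nat (fun z => x0 + z)%Z), <- E2, map_map.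
           apply map_ext; intros; lia.
      * now rewrite length_map.
      * apply sorted_of_increasing; intros i j; rewrite length_map; intros Hij.
        assert (H : forall k, (k < length Y)%nat ->
          nth k (map (fun y => y - x0)%Z Y) 0%Z = (nth k Y 0 - x0)%Z).
        { intros k Hk; rewrite (nth_indep _ 0%Z (0 - x0)%Z) by now rewrite length_map.
          apply (map_nth (fun y => y - x0)%Z). }
        rewrite !H by lia; specialize (HY i j Hij); lia.
    + intros xi; unfold bethe_integrand; change (one_step p N xi ^ 0)%C with (RtoC 1); rewrite Cmult_1_r; f_equal.
      apply mono_ext; intros i Hi; unfold shifted_exponent, start_exponent.
      rewrite (nth_indep (map (fun y => y - x0)%Z Y) 0%Z (0 - x0)%Z) by (rewrite length_map; lia).
      rewrite (map_nth (fun y => y - x0)%Z); lia.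
  - simpl asep_steps; rewrite RtoC_Rsum, bethe_succ by easy.
    rewrite Csum_scal, <- seq_shift, Csum_map.
    pose (v := fun X => bethe p r N ns n (shifted_exponent x0 X)).
    assert (Hv : forall k d, (k < N)%nat -> v (displace Y k d) =
      bethe p r N ns n (bump (shifted_exponent x0 Y) (S k) (- d))).
    { intros k d Hk; apply bethe_ext; intros i Hi; unfold bump, shifted_exponent, single.
      rewrite nth_displace by lia.
      destruct (Nat.eqb_spec (i - 1) k); destruct (Nat.eqb_spec i (S k)); subst; lia. }
    rewrite (Csum_ext (seq 0 N) (fun a => _ + _)%C (fun k => RtoC p * v (displace Y k 1) + RtoC (1 - p) * v (displace Y k (-1)))%C).
    2:{ intros k Hk; apply in_seq in Hk; rewrite !Hv by lia; reflexivity. }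
    replace (seq 0 N) with (seq 0 (length Y)) by now rewrite HN.
    rewrite <- (exclusion_boundary p v Y HY), <- Csum_scal.
    + apply Csum_ext; intros k Hk; apply in_seq in Hk.
      destruct (increasing_move Y k 1 HY) as [M1 M2]; [lia | now left|].
      destruct (increasing_move Y k (-1) HY) as [M3 M4]; [lia | now right|].
      unfold v; rewrite <- !IH by (easy || lia).
      rewrite RtoC_mult, RtoC_plus, !RtoC_mult, RtoC_inv; [reflexivity | apply not_0_INR; lia].
    + intros k Hk Hgap; rewrite !Hv by lia.
      (* Positions are counted from 0 and variables from 1, hence [S k]. *)
      apply (bethe_boundary p r N ns n (shifted_exponent x0 Y) (S k)); try easy; [lia|].
      unfold shifted_exponent; simpl; rewrite Nat.sub_0_r, Hgap; lia.
Qed.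

(** * Poisson summation of the jump chain *)

Definition exp_partial (n : nat) (w : C) : C :=
  Csum (seq 0 n) (fun k => w ^ k * RtoC (/ INR (fact k)))%C.

Lemma exp_partial_succ n w :
  exp_partial (S n) w = (exp_partial n w + w ^ n * RtoC (/ INR (fact n)))%C.
Proof.
  unfold exp_partial; rewrite seq_S, Csum_app, Csum_cons; change (Csum [] _) with (RtoC 0).
  rewrite Nat.add_0_l; ring.
Qed.

Lemma is_RInt_zero a b : is_RInt (fun _ : R => 0) a b 0.
Proof.
  assert (H0 := @is_RInt_const R_NormedModule a b 0).
  match type of H0 with is_RInt _ _ _ ?x =>
    replace x with 0 in H0 by exact (eq_sym (Rmult_0_r (b - a))) end.
  exact H0.
Qed.

Lemma is_RInt_RtoC f a b v : is_RInt f a b v ->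
  @is_RInt C_R_NormedModule (fun u => RtoC (f u)) a b (RtoC v).
Proof.
  intros H.
  exact (@is_RInt_fct_extend_pair R_NormedModule R_NormedModule
    (fun u => RtoC (f u)) a b v 0 H (is_RInt_zero a b)).
Qed.

Lemma is_RInt_cexp w s :
  @is_RInt C_R_NormedModule (fun u => w * cexp (RtoC u * w))%C 0 s (cexp (RtoC s * w) - 1)%C.
Proof.
  destruct w as [a b].
  assert (D : forall u, cexp (RtoC u * (a, b))%C = (exp (u * a) * cos (u * b), exp (u * a) * sin (u * b))).
  { intros u; unfold cexp; simpl; f_equal; do 2 f_equal; ring. }
  rewrite D.
  apply (@is_RInt_ext C_R_NormedModule (fun u =>
    (a * (exp (u * a) * cos (u * b)) - b * (exp (u * a) * sin (u * b)),
     a * (exp (u * a) * sin (u * b)) + b * (exp (u * a) * cos (u * b))))).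
  { intros u _; now rewrite D. }
  apply (@is_RInt_fct_extend_pair R_NormedModule R_NormedModule _ 0 s
    (exp (s * a) * cos (s * b) + - (1)) (exp (s * a) * sin (s * b) + - 0)); simpl.
  - replace (exp (s * a) * cos (s * b) + - (1)) with
      (minus (exp (s * a) * cos (s * b)) (exp (0 * a) * cos (0 * b))).
    + apply (is_RInt_derive (fun u => exp (u * a) * cos (u * b))).
      * intros u _; auto_derive; [easy | ring].
      * intros u _; apply (ex_derive_continuous (fun u =>
          a * (exp (u * a) * cos (u * b)) - b * (exp (u * a) * sin (u * b)))); auto_derive; easy.
    + rewrite !Rmult_0_l, exp_0, cos_0; unfold minus, plus, opp; simpl; ring.
  - replace (exp (s * a) * sin (s * b) + - 0) with
      (minus (exp (s * a) * sin (s * b)) (exp (0 * a) * sin (0 * b))).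
    + apply (is_RInt_derive (fun u => exp (u * a) * sin (u * b))).
      * intros u _; auto_derive; [easy | ring].
      * intros u _; apply (ex_derive_continuous (fun u =>
          a * (exp (u * a) * sin (u * b)) + b * (exp (u * a) * cos (u * b)))); auto_derive; easy.
    + rewrite !Rmult_0_l, exp_0, sin_0; unfold minus, plus, opp; simpl; ring.
Qed.

Lemma is_RInt_pow_fact n s :
  is_RInt (fun u => u ^ n * / INR (fact n)) 0 s (s ^ S n * / INR (fact (S n))).
Proof.
  assert (Ec : INR (S n) * / INR (fact (S n)) = / INR (fact n)).
  { rewrite fact_simpl, mult_INR; field; split; [apply INR_fact_neq_0 | apply not_0_INR; lia]. }
  set (c := / INR (fact (S n))) in *; set (d := / INR (fact n)) in *; clearbody c d.
  replace (s ^ S n * c) with (minus (s ^ S n * c) (0 ^ S n * c)).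
  - apply (is_RInt_derive (fun u => u ^ S n * c)).
    + intros u _; auto_derive; [easy|]; rewrite <- Ec; cbn [pred]; change (match n with 0%nat => 1 | S _ => INR n + 1 end) with (INR (S n)); ring.
    + intros u _; apply (ex_derive_continuous (fun u => u ^ n * d)); auto_derive; easy.
  - unfold minus, plus, opp; simpl; ring.
Qed.

Lemma is_RInt_exp_partial n w s :
  @is_RInt C_R_NormedModule (fun u => w * exp_partial n (RtoC u * w))%C 0 s
    (exp_partial (S n) (RtoC s * w) - 1)%C.
Proof.
  induction n as [|n IH].
  - replace (exp_partial 1 (RtoC s * w) - 1)%C with (RtoC 0).
    + apply (@is_RInt_ext C_R_NormedModule (fun u => RtoC 0)).
      { intros u _; change (RtoC 0 = w * 0)%C; ring. }
      apply (is_RInt_RtoC (fun _ => 0)), is_RInt_zero.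
    + unfold exp_partial, Csum; simpl; rewrite Rinv_1; ring.
  - rewrite exp_partial_succ.
    replace (_ - _)%C with ((exp_partial (S n) (RtoC s * w) - 1) +
      w ^ S n * RtoC (s ^ S n * / INR (fact (S n))))%C
      by (rewrite Cpow_mult_l, RtoC_mult, RtoC_pow; ring).
    eapply is_RInt_ext; [|apply (@is_RInt_plus C_R_NormedModule _ _ _ _ _ _ IH
      (is_RInt_Cscal (w ^ S n) _ _ _ _ (is_RInt_RtoC _ _ _ _ (is_RInt_pow_fact n s))))].
    intros u _; rewrite exp_partial_succ, Cpow_mult_l, Cpow_S, RtoC_mult, RtoC_pow.
    change (w * exp_partial n (RtoC u * w) + w * w ^ n * (RtoC u ^ n * RtoC (/ INR (fact n))) =
      w * (exp_partial n (RtoC u * w) + RtoC u ^ n * w ^ n * RtoC (/ INR (fact n))))%C; ring.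
Qed.

Lemma Cmod_cexp w : Cmod (cexp w) = exp (fst w).
Proof.
  change (cexp w) with (polar (exp (fst w)) (snd w)); apply Cmod_polar; left; apply exp_pos.
Qed.

(** Taylor remainder by induction: as a function of s, the remainder for n + 1 is the integral of w
    times the remainder for n, and the bound is integrated along with it. *)
Lemma cexp_approx w n s : 0 <= s <= 1 ->
  Cmod (cexp (RtoC s * w) - exp_partial n (RtoC s * w))%C <=
  exp (Cmod w) * (Cmod w ^ n * (s ^ n * / INR (fact n))).
Proof.
  revert s; induction n as [|n IH]; intros s Hs.
  - replace (cexp (RtoC s * w) - exp_partial 0 (RtoC s * w))%C with (cexp (RtoC s * w))
      by (unfold exp_partial, Csum; simpl; ring).
    rewrite Cmod_cexp; simpl; rewrite Rinv_1, !Rmult_1_r.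
    assert (H : s * fst w - 0 * snd w <= Cmod w).
    { assert (H1 := Rle_abs (fst w)).
      assert (H2 : Rabs (fst w) <= Cmod w).
      { eapply Rle_trans; [apply Rmax_l | apply Rmax_Cmod]. }
      assert (H3 := Cmod_ge_0 w); nra. }
    destruct (Rle_lt_or_eq_dec _ _ H) as [Hlt|Heq]; [left; now apply exp_increasing | right; now rewrite Heq].
  - set (M := exp (Cmod w)).
    assert (HI : @is_RInt C_R_NormedModule
      (fun u => w * (cexp (RtoC u * w) - exp_partial n (RtoC u * w)))%C 0 s
      (cexp (RtoC s * w) - exp_partial (S n) (RtoC s * w))%C).
    { replace (cexp (RtoC s * w) - exp_partial (S n) (RtoC s * w))%C with
        ((cexp (RtoC s * w) - 1) - (exp_partial (S n) (RtoC s * w) - 1))%C by ring.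
      eapply is_RInt_ext; [|apply (@is_RInt_minus C_R_NormedModule _ _ _ _ _ _
        (is_RInt_cexp w s) (is_RInt_exp_partial n w s))].
      intros u _; change (w * cexp (RtoC u * w) - w * exp_partial n (RtoC u * w) =
        w * (cexp (RtoC u * w) - exp_partial n (RtoC u * w)))%C; ring. }
    assert (HR := is_RInt_scal _ _ _ (M * Cmod w ^ S n) _ (is_RInt_pow_fact n s)).
    apply Rle_trans with (scal (M * Cmod w ^ S n) (s ^ S n * / INR (fact (S n)))).
    + rewrite Cmod_norm.
      refine (@norm_RInt_le C_R_NormedModule _ _ 0 s _ _ (proj1 Hs) _ HI HR).
      intros u Hu.
      apply Rle_trans with (Cmod (w * (cexp (RtoC u * w) - exp_partial n (RtoC u * w)))%C);
        [right; exact (eq_sym (Cmod_norm _))|].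
      rewrite Cmod_mult.
      apply Rle_trans with (Cmod w * (M * (Cmod w ^ n * (u ^ n * / INR (fact n))))).
      * apply Rmult_le_compat_l; [apply Cmod_ge_0 | apply IH; lra].
      * right; change (Cmod w * (M * (Cmod w ^ n * (u ^ n * / INR (fact n)))) =
          M * (Cmod w * Cmod w ^ n) * (u ^ n * / INR (fact n))); ring.
    + right; unfold scal; simpl; unfold mult; simpl; ring.
Qed.

Lemma cexp_approx_bounded w n G : Cmod w <= G ->
  Cmod (cexp w - exp_partial n w)%C <= exp G * (G ^ n / INR (fact n)).
Proof.
  intros HG; assert (H := cexp_approx w n 1 ltac:(lra)).
  replace (RtoC 1 * w)%C with w in H by ring; rewrite pow1, Rmult_1_l in H.
  eapply Rle_trans; [exact H|].
  assert (Hf : 0 < / INR (fact n)) by (apply Rinv_0_lt_compat, INR_fact_lt_0).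
  apply Rmult_le_compat.
  - left; apply exp_pos.
  - apply Rmult_le_pos; [apply pow_le, Cmod_ge_0 | lra].
  - destruct (Rle_lt_or_eq_dec _ _ HG) as [Hlt|Heq]; [left; now apply exp_increasing | right; now rewrite Heq].
  - apply Rmult_le_compat_r; [lra|]; apply pow_incr; split; [apply Cmod_ge_0 | easy].
Qed.

Lemma exp_bound_small K G eps : 0 < eps -> 0 <= K ->
  exists n0, forall n, (n0 <= n)%nat -> K * (G ^ n / INR (fact n)) <= eps.
Proof.
  intros Heps HK; destruct (cv_speed_pow_fact G (eps / (K + 1))) as [n0 Hn0].
  { apply Rdiv_lt_0_compat; lra. }
  exists n0; intros n Hn; specialize (Hn0 n Hn).
  unfold Rdist in Hn0; rewrite Rminus_0_r in Hn0.
  assert (H := Rle_abs (G ^ n / INR (fact n))).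
  apply Rle_trans with (K * (eps / (K + 1))); [apply Rmult_le_compat_l; lra|].
  apply (Rmult_le_reg_r (K + 1)); [lra|].
  replace (K * (eps / (K + 1)) * (K + 1)) with (K * eps) by (field; lra); nra.
Qed.

Lemma nice_exp_partial r N E F n : 0 < r -> addclosed E ->
  nice r N E F -> nice r N E (fun xi => exp_partial n (F xi)).
Proof.
  intros Hr HE HF.
  apply nice_Csum.
  intros k _; apply nice_ext with (fun xi => RtoC (/ INR (fact k)) * F xi ^ k)%C; [intros; ring|].
  apply nice_scal; now apply nice_pow.
Qed.

(** A [nice] function is bounded on the torus, so the Taylor polynomials of its exponential converge
    uniformly there. *)
Lemma nice_cexp r N E F : 0 < r -> addclosed E ->
  nice r N E F -> nice r N E (fun xi => cexp (F xi)).
Proof.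
  intros Hr HE HF; apply nice_lim; intros eps Heps.
  destruct (nice_bounded r N E F Hr HF) as (G & HG & HB).
  destruct (exp_bound_small (exp G) G eps) as [n Hn]; [easy | left; apply exp_pos |].
  exists (fun xi => exp_partial n (F xi)); split; [now apply nice_exp_partial|].
  intros xi Ht; eapply Rle_trans; [apply cexp_approx_bounded, HB, Ht | apply Hn; lia].
Qed.

Lemma cexp_add_real z c : cexp (z + RtoC c)%C = (RtoC (exp c) * cexp z)%C.
Proof.
  destruct z as [a b]; unfold cexp; simpl.
  rewrite Rplus_0_r, exp_plus; unfold Cmult; simpl; f_equal; ring.
Qed.

Lemma nice_epsq_sum p r N : 0 < r ->
  nice r N anyE (fun xi => Csum (seq 1 N) (fun i => epsq p (xi i))).
Proof.
  intros Hr; apply nice_Csum.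
  intros i Hi; apply in_seq in Hi.
  apply nice_ext with (fun xi => RtoC p * / xi i + (RtoC (1 - p) * xi i + RtoC (-1)))%C.
  { intros; unfold epsq; ring. }
  nice_any; now apply nice_const.
Qed.

(** Uniformization on the level of symbols: the generator is N times the difference of one jump
    attempt and the identity. *)
Lemma epsq_sum_one_step p N xi : (1 <= N)%nat ->
  Csum (seq 1 N) (fun i => epsq p (xi i)) = (RtoC (INR N) * one_step p N xi - RtoC (INR N))%C.
Proof.
  intros HN; unfold one_step.
  assert (HNz : RtoC (INR N) <> 0%C).
  { intros A; apply RtoC_inj in A; revert A; apply not_0_INR; lia. }
  rewrite Csum_scal, Cmult_assoc, Cinv_r, Cmult_1_l by easy.
  rewrite (Csum_ext _ _ (fun i => (RtoC p * / xi i + RtoC (1 - p) * xi i) - 1)%C)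
    by (intros; unfold epsq; ring).
  rewrite Csum_minus; f_equal; f_equal.
  rewrite <- (length_seq N 1) at 2; generalize (seq 1 N); intros l; induction l as [|a l IH]; [reflexivity|].
  rewrite Csum_cons, IH; cbn [length]; rewrite S_INR, RtoC_plus; ring.
Qed.

(** The partial sums of the Poisson series are contour integrals of Taylor polynomials of the
    exponential, which converge uniformly on the torus. *)
Lemma poisson_contour p r N ns e t (s : nat -> R) : admissible p r -> (1 <= N)%nat ->
  (forall n, RtoC (s n) = bethe p r N ns n e) ->
  RtoC (Series (fun n => exp (- (INR N * t)) * (INR N * t) ^ n / INR (fact n) * s n)) =
  contour_n r N (fun xi => amplitude p ns (seq 1 N) xi * mono N e xi *
    cexp (Csum (seq 1 N) (fun i => epsq p (xi i)) * RtoC t))%C.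
Proof.
  intros Ha HN Hs; assert (Hr := proj1 (proj2 Ha)).
  set (lam := INR N * t).
  pose (A := fun xi => (amplitude p ns (seq 1 N) xi * mono N e xi)%C).
  assert (HA : nice r N anyE A) by (unfold A; nice_any).
  assert (Hg := nice_one_step p r N Hr).
  assert (Hlg : nice r N anyE (fun xi => RtoC lam * one_step p N xi)%C) by now apply nice_scal.
  destruct (nice_bounded r N anyE _ Hr HA) as (B & HB0 & HB).
  destruct (nice_bounded r N anyE _ Hr Hlg) as (G & HG0 & HG).
  assert (HE : nice r N anyE (fun xi => A xi * (RtoC (exp (- lam)) * cexp (RtoC lam * one_step p N xi)))%C)
    by (nice_any; now apply nice_cexp).
  rewrite <- (contour_n_ext r N anyE (fun xi => A xi *
    (RtoC (exp (- lam)) * cexp (RtoC lam * one_step p N xi)))%C); [|easy|easy|].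
  2:{ intros xi _; unfold A; f_equal; rewrite <- cexp_add_real; f_equal.
      rewrite epsq_sum_one_step by easy; unfold lam; rewrite RtoC_opp, RtoC_mult; ring. }
  set (V := contour_n r N _).
  set (a := fun n => exp (- lam) * lam ^ n / INR (fact n) * s n).
  assert (HS : forall n, Csum (seq 0 n) (fun k => RtoC (a k)) =
    contour_n r N (fun xi => A xi * (RtoC (exp (- lam)) * exp_partial n (RtoC lam * one_step p N xi)))%C).
  { intros n.
    rewrite (contour_n_ext_all r N _ (fun xi => Csum (seq 0 n) (fun k =>
       RtoC (exp (- lam) * lam ^ k / INR (fact k)) *
       bethe_integrand p N ns k e xi))%C).
    - rewrite (contour_n_Csum r N anyE); [|easy|].
      + apply Csum_ext; intros k _; rewrite (contour_n_scal r N anyE); [|easy | now apply nice_bethe].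
        unfold a; now rewrite RtoC_mult, Hs.
      + intros k _; apply nice_scal; now apply nice_bethe.
    - intros xi; unfold A, exp_partial, bethe_integrand; rewrite <- !Csum_scal; apply Csum_ext; intros k _.
      unfold Rdiv; rewrite !RtoC_mult, RtoC_pow, Cpow_mult_l; ring. }
  assert (HL : forall eps, 0 < eps -> exists n0, forall n, (n0 <= n)%nat ->
    Cmod (V - Csum (seq 0 n) (fun k => RtoC (a k)))%C <= eps).
  { intros eps Heps.
    destruct (exp_bound_small (r ^ N * (B * (exp (- lam) * exp G))) G eps Heps) as [n0 Hn0].
    { apply Rmult_le_pos; [apply pow_le; lra|]; apply Rmult_le_pos; [lra|].
      left; apply Rmult_lt_0_compat; apply exp_pos. }
    exists n0; intros n Hn; eapply Rle_trans; [|apply (Hn0 n Hn)].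
    rewrite HS; unfold V.
    replace (_ - _)%C with (contour_n r N (fun xi => A xi * (RtoC (exp (- lam)) * cexp (RtoC lam * one_step p N xi)) +
      RtoC (-1) * (A xi * (RtoC (exp (- lam)) * exp_partial n (RtoC lam * one_step p N xi))))%C).
    - rewrite !Rmult_assoc; apply (contour_n_bound r N anyE); [easy| |].
      + nice_any; now apply nice_exp_partial.
      + intros xi Ht.
        replace (_ + _)%C with (A xi * (RtoC (exp (- lam)) *
          (cexp (RtoC lam * one_step p N xi) - exp_partial n (RtoC lam * one_step p N xi))))%C by ring.
        rewrite !Cmod_mult, Cmod_R, Rabs_right by (left; apply exp_pos).
        apply Rmult_le_compat; [apply Cmod_ge_0 | | now apply HB |].
        * apply Rmult_le_pos; [left; apply exp_pos | apply Cmod_ge_0].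
        * apply Rmult_le_compat_l; [left; apply exp_pos | apply cexp_approx_bounded, HG, Ht].
    - rewrite (contour_n_plus r N anyE); [|easy|easy|].
      + rewrite (contour_n_scal r N anyE); [ring | easy | nice_any; now apply nice_exp_partial].
      + nice_any; now apply nice_exp_partial. }
  assert (HR : forall n, Csum (seq 0 (S n)) (fun k => RtoC (a k)) = RtoC (sum_n a n)).
  { induction n as [|n IH].
    - rewrite sum_O; unfold Csum; simpl; ring.
    - rewrite seq_S, Csum_app, IH, sum_Sn, Csum_cons; change (Csum [] _) with (RtoC 0).
      change (plus (sum_n a n) (a (S n))) with (sum_n a n + a (S n)); rewrite RtoC_plus.
      rewrite Nat.add_0_l; ring. }
  (* [Series] is real: the imaginary part of the integral vanishes as a limit of real partial sums,
     and its real part is the sum. *)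
  assert (HIm : snd V = 0).
  { apply Rabs_eq_0; apply Rle_antisym; [|apply Rabs_pos].
    apply le_epsilon; intros eps Heps; rewrite Rplus_0_l.
    destruct (HL eps Heps) as [n0 Hn0]; specialize (Hn0 (S n0) ltac:(lia)); rewrite HR in Hn0.
    eapply Rle_trans; [|exact Hn0].
    eapply Rle_trans; [|apply Rmax_Cmod].
    eapply Rle_trans; [|apply Rmax_r]; simpl; right; f_equal; ring. }
  assert (HSer : is_series a (fst V)).
  { apply filterlim_locally; intros eps.
    destruct (HL (eps / 2)) as [n0 Hn0]; [apply Rdiv_lt_0_compat; [apply cond_pos | lra]|].
    exists n0; intros n Hn; specialize (Hn0 (S n) ltac:(lia)); rewrite HR in Hn0.
    apply (@norm_compat1 R_AbsRing R_NormedModule).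
    change (Rabs (sum_n a n - fst V) < eps); rewrite Rabs_minus_sym.
    apply Rle_lt_trans with (eps / 2); [|assert (H := cond_pos eps); lra].
    eapply Rle_trans; [|exact Hn0].
    eapply Rle_trans; [|apply Rmax_Cmod].
    eapply Rle_trans; [|apply Rmax_l]; simpl; right; f_equal; ring. }
  change (RtoC (Series a) = V); rewrite (is_series_unique _ _ HSer).
  destruct V as [v1 v2]; simpl in *; now rewrite HIm.
Qed.

(** * The sum over [Lambda] *)

Notation rm := (remove Nat.eq_dec).

(** Repetition-free tuples produced by deleting each chosen entry, which is the recursion of
    [numerator]; [Lambdas] instead filters all tuples. *)
Fixpoint arrangements (S0 : list nat) (k : nat) : list (list nat) :=
  match k with
  | O => [[]]
  | S k' => flat_map (fun a => map (cons a) (arrangements (rm a S0) k')) S0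
  end.

Lemma Csum_filter {A} (P : A -> bool) (l : list A) (F : A -> C) :
  Csum (filter P l) F = Csum l (fun a => if P a then F a else 0%C).
Proof.
  induction l as [|a l IH]; [reflexivity|].
  cbn [filter]; destruct (P a) eqn:E; rewrite !Csum_cons, ?IH, E; ring.
Qed.

Lemma filter_remove (A0 : list nat) a l :
  filter (fun x => negb (inL (a :: A0) x)) l = rm a (filter (fun x => negb (inL A0 x)) l).
Proof.
  induction l as [|b l IH]; [reflexivity|].
  cbn [filter]; change (inL (a :: A0) b) with (Nat.eqb b a || inL A0 b).
  destruct (inL A0 b); rewrite ?orb_true_r, ?orb_false_r; cbn [negb]; [exact IH|].
  cbn [remove]; destruct (Nat.eqb_spec b a); destruct (Nat.eq_dec a b); subst; try easy; cbn [negb].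
  now rewrite IH.
Qed.

(** [A0] collects the entries already chosen, so that the condition on the tail has the same form
    again. *)
Lemma Csum_tuples (F : list nat -> C) A0 dom k :
  Csum (filter (fun l => nodupb l && forallb (fun x => negb (inL A0 x)) l) (tuples dom k)) F =
  Csum (arrangements (filter (fun x => negb (inL A0 x)) dom) k) F.
Proof.
  revert F A0; induction k as [|k IH]; intros F A0; [reflexivity|].
  cbn [tuples arrangements]; rewrite Csum_filter, !Csum_flat_map, Csum_filter.
  apply Csum_ext; intros a _; rewrite !Csum_map.
  destruct (inL A0 a) eqn:Ea; cbn [negb].
  - apply Csum_zero; intros l _; cbn [forallb]; rewrite Ea; cbn [negb]; now rewrite andb_false_r.
  - rewrite <- filter_remove, <- (IH (fun l => F (a :: l))), Csum_filter; apply Csum_ext; intros l _.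
    replace (nodupb (a :: l) && forallb (fun x => negb (inL A0 x)) (a :: l)) with
      (nodupb l && forallb (fun x => negb (inL (a :: A0) x)) l); [easy|].
    cbn [forallb]; rewrite Ea; cbn [negb andb nodupb].
    replace (forallb (fun x => negb (inL (a :: A0) x)) l) with
      (negb (existsb (Nat.eqb a) l) && forallb (fun x => negb (inL A0 x)) l).
    + destruct (negb _), (nodupb l); reflexivity.
    + clear; induction l as [|b l IHl]; [reflexivity|].
      cbn [forallb existsb]; rewrite <- IHl; change (inL (a :: A0) b) with (Nat.eqb b a || inL A0 b).
      rewrite (Nat.eqb_sym b a); destruct (Nat.eqb a b), (existsb _ l), (inL A0 b); reflexivity.
Qed.

Lemma Csum_Lambdas N k F : Csum (Lambdas N k) F = Csum (arrangements (seq 1 N) k) F.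
Proof.
  unfold Lambdas; rewrite (filter_ext _ (fun l => nodupb l && forallb (fun x => negb (inL [] x)) l)).
  - rewrite Csum_tuples; f_equal; f_equal.
    exact (filter_true (seq 1 N)).
  - intros l; replace (forallb _ l) with true; [now rewrite andb_true_r|].
    induction l; easy.
Qed.

Lemma inL_spec L i : inL L i = true <-> In i L.
Proof.
  unfold inL; rewrite existsb_exists; split.
  - intros (x & Hx & E); apply Nat.eqb_eq in E; now subst.
  - intros H; exists i; split; [easy | apply Nat.eqb_refl].
Qed.

Lemma NoDup_rm a (l : list nat) : NoDup l -> NoDup (rm a l).
Proof.
  induction 1 as [|b l Hb Hd IH]; [constructor|]; cbn [remove].
  destruct (Nat.eq_dec a b); [easy|]; constructor; [|easy].
  intros H; apply in_remove in H; now apply Hb.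
Qed.

Lemma arrangements_spec S0 k L : NoDup S0 -> In L (arrangements S0 k) ->
  NoDup L /\ incl L S0 /\ length L = k.
Proof.
  revert S0 L; induction k as [|k IH]; intros S0 L Hd HL.
  - destruct HL as [<-|[]]; repeat split; [constructor | intros x []].
  - cbn [arrangements] in HL; apply in_flat_map in HL; destruct HL as (a & Ha & HL).
    apply in_map_iff in HL; destruct HL as (L' & <- & HL').
    destruct (IH (rm a S0) L') as (H1 & H2 & H3); [now apply NoDup_rm | easy |].
    repeat split.
    + constructor; [|easy]; intros H; apply H2, in_remove in H; easy.
    + intros x [<-|Hx]; [easy|]; apply H2, in_remove in Hx; easy.
    + simpl; now rewrite H3.
Qed.

Definition outside (S0 L : list nat) : list nat := filter (fun j => negb (inL L j)) S0.

Lemma outside_perm S0 L : NoDup S0 -> NoDup L -> incl L S0 -> Permutation S0 (L ++ outside S0 L).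
Proof.
  intros HS HL Hi; apply NoDup_Permutation; [easy | |].
  - apply NoDup_app; [easy | now apply NoDup_filter |].
    intros x Hx Hx'; apply filter_In in Hx'; destruct Hx' as [_ H].
    apply inL_spec in Hx; rewrite Hx in H; easy.
  - intros x; rewrite in_app_iff; unfold outside; rewrite filter_In; split.
    + intros Hx; destruct (inL L x) eqn:E; [left; now apply inL_spec | now right].
    + intros [Hx|[Hx _]]; auto.
Qed.

(** * Sign and closed form of the term of one arrangement *)

Definition rank (a : nat) (S0 : list nat) : nat := length (filter (fun b => Nat.ltb b a) S0).

(** In an increasing list the position of an entry is the number of smaller entries, and this
    determines the sign of the pick. *)
Lemma picks_sorted S0 : StronglySorted lt S0 ->
  picks S0 = map (fun a => (signC (rank a S0), a, rm a S0)) S0.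
Proof.
  induction 1 as [|a l Hs IH Ha]; [reflexivity|].
  rewrite Forall_forall in Ha; cbn [picks map]; f_equal.
  - replace (rank a (a :: l)) with 0%nat.
    + cbn [remove]; destruct (Nat.eq_dec a a); [|easy].
      rewrite notin_remove; [reflexivity|]; intros H; specialize (Ha a H); lia.
    + unfold rank; cbn [filter]; rewrite Nat.ltb_irrefl; symmetry.
      rewrite (filter_ext_in _ (fun _ => false)); [now rewrite filter_false|].
      intros b Hb; apply Nat.ltb_ge; specialize (Ha b Hb); lia.
  - rewrite IH, map_map; apply map_ext_in; intros b Hb; cbn [fst snd].
    specialize (Ha b Hb); unfold rank; cbn [filter remove].
    replace (a <? b)%nat with true by (symmetry; apply Nat.ltb_lt; lia).
    destruct (Nat.eq_dec b a); [lia|]; cbn [length]; unfold signC; rewrite Cpow_S.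
    do 2 f_equal; ring.
Qed.

Fixpoint arrangement_sign (S0 L : list nat) : C :=
  match L with
  | [] => 1%C
  | a :: L' => (signC (rank a S0) * arrangement_sign (rm a S0) L')%C
  end.

(** The unsigned contribution of the tuple [L] to [numerator], with the picks unrolled along [L]. *)
Fixpoint lambda_term (p : R) (ns S0 L : list nat) (xi : nat -> C) {struct L} : C :=
  match L, ns with
  | a :: L', n :: ns' => (xi a ^ n * (1 - xi a) * Cprod (rm a S0) (fun j => fpq p (xi a) (xi j)) *
      lambda_term p ns' (rm a S0) L' xi)%C
  | _, _ => numerator p [last ns 0%nat] (map xi S0)
  end.

Lemma rm_sorted a S0 : StronglySorted lt S0 -> StronglySorted lt (rm a S0).
Proof.
  induction 1 as [|b l Hs IH Hb]; [constructor|]; cbn [remove].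
  destruct (Nat.eq_dec a b); [easy|]; constructor; [easy|].
  rewrite Forall_forall in *; intros x Hx; apply in_remove in Hx; now apply Hb.
Qed.

Lemma numerator_arrangements p ns S0 xi : ns <> [] -> StronglySorted lt S0 ->
  numerator p ns (map xi S0) = Csum (arrangements S0 (length ns - 1))
    (fun L => arrangement_sign S0 L * lambda_term p ns S0 L xi)%C.
Proof.
  intros Hns; revert S0; induction ns as [|n ns IH]; [easy|]; intros S0 Hs.
  destruct ns as [|n' ns].
  - cbn [length Nat.sub arrangements]; rewrite Csum_cons; change (Csum [] _) with (RtoC 0).
    cbn [arrangement_sign lambda_term last]; ring.
  - rewrite numerator_cons_map, picks_sorted, Csum_map by easy.
    replace (length (n :: n' :: ns) - 1)%nat with (S (length (n' :: ns) - 1)) by (cbn [length]; lia).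
    cbn [arrangements]; rewrite Csum_flat_map; apply Csum_ext; intros a Ha; cbn [fst snd].
    rewrite Csum_map, IH by (easy || now apply rm_sorted).
    rewrite <- !Csum_scal; apply Csum_ext; intros L _; cbn [arrangement_sign lambda_term]; ring.
Qed.

(** When [a] is picked, the factors f(a, .) over everything left split into those over the later
    entries of [L] and those over the complement of [L]: these are the two f-products in the
    numerator of the integrand. *)
Lemma lambda_term_closed p ns S0 L xi : NoDup S0 -> NoDup L -> incl L S0 ->
  length ns = S (length L) ->
  lambda_term p ns S0 L xi =
  (Cprod L (fun i => Cprod (outside S0 L) (fun j => fpq p (xi i) (xi j))) *
   Cprod (pairs_lt L) (fun ij => fpq p (xi (fst ij)) (xi (snd ij))) *
   Cprod (combine L ns) (fun an => xi (fst an) ^ snd an) * Cprod L (fun a => 1 - xi a) *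
   numerator p [last ns 0%nat] (map xi (outside S0 L)))%C.
Proof.
  revert ns S0; induction L as [|a L IH]; intros ns S0 HS HL Hi Hlen.
  - replace (outside S0 []) with S0.
    + cbn [combine pairs_lt lambda_term]; rewrite !Cprod_nil; ring.
    + exact (eq_sym (filter_true S0)).
  - destruct ns as [|n ns]; [easy|]; cbn [lambda_term combine pairs_lt].
    inversion HL as [|? ? Ha HL']; subst.
    assert (Hi' : incl L (rm a S0)).
    { intros x Hx; apply in_in_remove; [now intros -> | apply Hi; now right]. }
    assert (HS' : NoDup (rm a S0)) by now apply NoDup_rm.
    assert (EO : outside (rm a S0) L = outside S0 (a :: L)).
    { unfold outside; rewrite filter_remove; clear.
      induction S0 as [|b S0 IH]; [reflexivity|]; cbn [filter remove].
      destruct (Nat.eq_dec a b) as [<-|n].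
      - destruct (negb (inL L a)); cbn [filter remove]; [destruct (Nat.eq_dec a a); [easy|easy] | easy].
      - cbn [filter]; destruct (negb (inL L b)); cbn [remove]; [destruct (Nat.eq_dec a b); [easy|] | easy].
        now rewrite IH. }
    assert (HP := outside_perm (rm a S0) L HS' HL' Hi').
    rewrite EO in HP.
    rewrite (Cprod_perm _ _ _ HP), Cprod_app, IH, EO by (easy || (simpl in Hlen; lia)).
    destruct ns as [|n' ns]; [easy|]; change (last (n :: n' :: ns) 0%nat) with (last (n' :: ns) 0%nat).
    rewrite !Cprod_cons, Cprod_app, Cprod_map; cbn [fst snd]; ring.
Qed.

Lemma Pol_lambda_term p ns S0 L T : incl S0 T -> incl L T ->
  Pol T (lambda_term p ns S0 L).
Proof.
  revert ns S0; induction L as [|a L IH]; intros ns S0 HS HL.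
  - apply Pol_ext with (fun xi => numerator p [last ns 0%nat] (map xi S0)); [easy | now apply Pol_numerator].
  - destruct ns as [|n ns].
    + apply Pol_ext with (fun xi => numerator p [last [] 0%nat] (map xi S0)); [easy | now apply Pol_numerator].
    + assert (Ha : In a T) by (apply HL; now left).
      assert (HS' : incl (rm a S0) T) by (intros x Hx; apply in_remove in Hx; now apply HS).
      pol; apply IH; [easy | intros x Hx; apply HL; now right].
Qed.

Lemma signC_add a b : signC (a + b) = (signC a * signC b)%C.
Proof. apply Cpow_add_r. Qed.

Lemma signC_even n : signC n = if Nat.even n then RtoC 1 else RtoC (-1).
Proof.
  induction n as [|n IH]; [reflexivity|].
  unfold signC in *; rewrite Cpow_S, IH, Nat.even_succ, <- Nat.negb_even.
  destruct (Nat.even n); simpl negb; cbv iota; rewrite <- RtoC_mult; f_equal; ring.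
Qed.

Lemma signC_double n : signC (2 * n) = RtoC 1.
Proof. now rewrite signC_even, Nat.even_mul. Qed.

Lemma rank_rm a S0 l : NoDup S0 -> In a S0 ->
  rank l S0 = (rank l (rm a S0) + if Nat.ltb a l then 1 else 0)%nat.
Proof.
  intros Hd Ha; destruct (in_split _ _ Ha) as (S1 & S2 & ->).
  assert (Hn : ~ In a (S1 ++ S2)) by now apply NoDup_remove_2.
  rewrite remove_app; cbn [remove]; destruct (Nat.eq_dec a a); [|easy].
  rewrite !notin_remove by (intros H; apply Hn, in_or_app; auto).
  unfold rank; rewrite !filter_app, !length_app; cbn [filter].
  destruct (Nat.ltb a l); cbn [length]; lia.
Qed.

Lemma list_sum_cons a l : list_sum (a :: l) = (a + list_sum l)%nat.
Proof. reflexivity. Qed.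

(** A count modulo 2. Deleting the head [a] lowers the rank of exactly those later entries that
    exceed it; their number is that of all later entries minus the inversions caused by [a]. *)
Lemma arrangement_sign_rank S0 L : NoDup S0 -> NoDup L -> incl L S0 ->
  arrangement_sign S0 L =
  signC (list_sum (map (fun l => rank l S0) L) + inversions L + length L * (length L - 1) / 2).
Proof.
  revert S0; induction L as [|a L IH]; intros S0 HS HL Hi; [reflexivity|].
  inversion HL as [|? ? Ha HL']; subst.
  assert (Ha0 : In a S0) by (apply Hi; now left).
  cbn [arrangement_sign]; rewrite IH; [|now apply NoDup_rm | easy |].
  2:{ intros x Hx; apply in_in_remove; [now intros -> | apply Hi; now right]. }
  rewrite <- signC_add; cbn [map inversions length]; rewrite half_succ.
  assert (E : (list_sum (map (fun l => rank l S0) L) + length (filter (fun b => Nat.ltb b a) L) =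
    list_sum (map (fun l => rank l (rm a S0)) L) + length L)%nat).
  { clear IH Hi HL; induction L as [|l L IHL]; [reflexivity|].
    cbn [map filter length]; rewrite !list_sum_cons, (rank_rm a S0 l HS Ha0).
    assert (l <> a) by (intros ->; apply Ha; now left).
    assert (IH' := IHL ltac:(intros H'; apply Ha; now right) ltac:(now inversion HL')).
    destruct (Nat.ltb_spec a l); destruct (Nat.ltb_spec l a); cbn [length]; lia. }
  set (h := (length L * (length L - 1) / 2)%nat).
  replace (list_sum (rank a S0 :: map (fun l => rank l S0) L) + (length (filter (fun b => (b <? a)%nat) L) + inversions L) + (h + length L))%nat
    with ((rank a S0 + (list_sum (map (fun l => rank l (rm a S0)) L) + inversions L + h)) + 2 * length L)%nat.
  - rewrite (signC_add _ (2 * length L)), signC_double; ring.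
  - rewrite list_sum_cons; lia.
Qed.

Lemma rank_seq N l : (1 <= l <= N)%nat -> rank l (seq 1 N) = (l - 1)%nat.
Proof.
  intros Hl; unfold rank; replace N with ((l - 1) + (N - (l - 1)))%nat by lia.
  rewrite seq_app, filter_app, length_app.
  rewrite (filter_ext_in _ (fun _ => true) (seq 1 (l - 1))), filter_true, length_seq.
  - rewrite (filter_ext_in _ (fun _ => false)), filter_false; [simpl; lia|].
    intros b Hb; apply in_seq in Hb; apply Nat.ltb_ge; lia.
  - intros b Hb; apply in_seq in Hb; apply Nat.ltb_lt; lia.
Qed.

Lemma sgnZ_opp_nat a b : sgnZ (Z.of_nat a - Z.of_nat b) = signC (a + b).
Proof.
  unfold sgnZ; rewrite signC_even, Nat.even_add, Z.even_sub.
  assert (H : forall n, Z.even (Z.of_nat n) = Nat.even n).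
  { intros n; induction n as [|n IH]; [reflexivity|].
    rewrite Nat2Z.inj_succ, Z.even_succ, Nat.even_succ, <- Z.negb_even, <- Nat.negb_even, IH; reflexivity. }
  now rewrite !H.
Qed.

Lemma fold_right_Zadd_app l1 l2 :
  fold_right Z.add 0%Z (l1 ++ l2) = (fold_right Z.add 0 l1 + fold_right Z.add 0 l2)%Z.
Proof. induction l1 as [|a l1 IH]; simpl; [easy | rewrite IH; lia]. Qed.

(** Since l_i has rank l_i - 1, the sum of the l_i - i is the sum of the ranks minus 0 + 1 + ... +
    (m - 2), and minus equals plus modulo 2. *)
Lemma lambda_sign_rank N m L : incl L (seq 1 N) -> length L = (m - 1)%nat ->
  lambda_sign m L =
  signC (list_sum (map (fun l => rank l (seq 1 N)) L) + length L * (length L - 1) / 2).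
Proof.
  intros Hi Hlen; unfold lambda_sign; rewrite <- Hlen, <- sgnZ_opp_nat; f_equal; clear Hlen.
  induction L as [|a L IH] using rev_ind; [reflexivity|].
  rewrite length_app; cbn [length]; rewrite Nat.add_1_r, half_succ, seq_S, !map_app, fold_right_Zadd_app, list_sum_app.
  cbn [map fold_right].
  assert (Ha : In a (seq 1 N)) by (apply Hi, in_or_app; right; now left).
  apply in_seq in Ha.
  replace (map _ (seq 1 (length L))) with
    (map (fun i => (Z.of_nat (nth (i - 1) L 0%nat) - Z.of_nat i)%Z) (seq 1 (length L))).
  - rewrite IH by (intros x Hx; apply Hi, in_or_app; now left).
    rewrite app_nth2 by lia; replace (1 + length L - 1 - length L)%nat with 0%nat by lia.
    rewrite list_sum_cons; change (list_sum []) with 0%nat; cbn [nth]; rewrite rank_seq by lia; lia.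
  - apply map_ext_in; intros i Hin; apply in_seq in Hin; rewrite app_nth1 by lia; reflexivity.
Qed.

Lemma arrangement_sign_lambda N m L : NoDup L -> incl L (seq 1 N) -> length L = (m - 1)%nat ->
  (lambda_sign m L * sgnLambda L)%C = arrangement_sign (seq 1 N) L.
Proof.
  intros HL Hi Hlen; rewrite arrangement_sign_rank by (easy || apply seq_NoDup).
  rewrite (lambda_sign_rank N) by easy; unfold sgnLambda; rewrite <- signC_even, <- signC_add.
  f_equal; lia.
Qed.

(** * Matching the given integrand with the amplitude *)

Lemma Cprod_nth_combine {B} (d : B) (g : nat -> B -> C) L (xs : list B) : (length L <= length xs)%nat ->
  Cprod (seq 1 (length L)) (fun i => g (nth (i - 1) L 0%nat) (nth (i - 1) xs d)) =
  Cprod (combine L xs) (fun an => g (fst an) (snd an)).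
Proof.
  revert xs; induction L as [|a L IH]; intros xs Hl; [reflexivity|].
  destruct xs as [|x xs]; [simpl in Hl; lia|].
  cbn [length seq combine]; rewrite !Cprod_cons, <- seq_shift, Cprod_map; f_equal.
  rewrite <- IH by (simpl in Hl; lia).
  apply Cprod_ext; intros i Hi; apply in_seq in Hi.
  replace (S i - 1)%nat with (S (i - 1)) by lia; reflexivity.
Qed.

Lemma map_nth_seq (L : list nat) : map (fun i => nth (i - 1) L 0%nat) (seq 1 (length L)) = L.
Proof.
  induction L as [|a L IH]; [reflexivity|].
  cbn [length seq map]; f_equal; rewrite <- seq_shift, map_map; rewrite <- IH at 2.
  apply map_ext_in; intros i Hi; apply in_seq in Hi.
  replace (S i - 1)%nat with (S (i - 1)) by lia; reflexivity.
Qed.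

Lemma filter_inL_perm N L : NoDup L -> incl L (seq 1 N) -> Permutation (filter (inL L) (seq 1 N)) L.
Proof.
  intros HL Hi; apply NoDup_Permutation; [apply NoDup_filter, seq_NoDup | easy |].
  intros x; rewrite filter_In, inL_spec; split; [easy | intros Hx; split; auto].
Qed.

Lemma Cprod_pairs_map (g : nat -> nat) (F : nat * nat -> C) l :
  Cprod (pairs_lt (map g l)) F = Cprod (pairs_lt l) (fun ij => F (g (fst ij), g (snd ij))).
Proof.
  induction l as [|a l IH]; [reflexivity|].
  cbn [map pairs_lt]; rewrite !Cprod_app, !Cprod_map, IH; reflexivity.
Qed.

Lemma vd_pairs xi l : Cprod (pairs_lt l) (fun ij => xi (snd ij) - xi (fst ij))%C = vd (map xi l).
Proof.
  induction l as [|a l IH]; [reflexivity|].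
  cbn [pairs_lt map vd]; rewrite Cprod_app, IH, !Cprod_map; reflexivity.
Qed.

Lemma seq_sorted a n : StronglySorted lt (seq a n).
Proof.
  revert a; induction n as [|n IH]; intros a; constructor; [apply IH|].
  apply Forall_forall; intros x Hx; apply in_seq in Hx; lia.
Qed.

Definition offsets (x0 : Z) (xs : list Z) : list nat := map (fun x => Z.to_nat (x - x0)) xs.

Lemma Cpowz_offset (z : C) x0 x : z <> 0%C -> (x0 <= x)%Z ->
  Cpowz z x = (Cpowz z x0 * z ^ Z.to_nat (x - x0))%C.
Proof. intros Hz Hx; rewrite <- Cpowz_add_nat by easy; f_equal; lia. Qed.

Lemma Cprod_combine_offsets x0 L xs (xi : nat -> C) : (length L <= length xs)%nat ->
  (forall l, In l L -> xi l <> 0%C) -> (forall x, In x xs -> (x0 <= x)%Z) ->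
  Cprod (combine L xs) (fun an => Cpowz (xi (fst an)) (snd an)) =
  (Cprod L (fun l => Cpowz (xi l) x0) * Cprod (combine L (offsets x0 xs)) (fun an => xi (fst an) ^ snd an))%C.
Proof.
  revert xs; induction L as [|a L IH]; intros xs Hl Hx H0; [cbn [combine]; rewrite !Cprod_nil; ring|].
  destruct xs as [|x xs]; [simpl in Hl; lia|].
  cbn [combine offsets map]; rewrite !Cprod_cons; cbn [fst snd].
  rewrite IH by (simpl in Hl; try lia; intros; (apply Hx || apply H0); now right).
  rewrite (Cpowz_offset _ x0 x) by ((apply Hx || apply H0); now left).
  unfold offsets. ring.
Qed.

(** The factors 1 - xi_l over [L] in [lambda_term] cancel against the full denominator and leave
    only those outside [L]. Each variable carries exactly one target exponent, so xi_i^x0 is split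
    off once for every i. *)
Lemma integrand_lambda_term p t r N m Y xs x0 L xi : admissible p r -> torus r N xi ->
  (1 <= m <= N)%nat -> length xs = m -> (forall x, In x xs -> (x0 <= x)%Z) ->
  NoDup L -> incl L (seq 1 N) -> length L = (m - 1)%nat ->
  (RtoC (p ^ ((N - m + 1) * (N - m) / 2)) * integrand p t N m Y xs L xi)%C =
  (lambda_term p (offsets x0 xs) (seq 1 N) L xi * / denominator p (seq 1 N) xi *
    (mono N (shifted_exponent x0 Y) xi * cexp (Csum (seq 1 N) (fun i => epsq p (xi i)) * RtoC t)))%C.
Proof.
  intros Ha Ht Hm Hxs Hx0 HL Hi Hlen; assert (Hr := proj1 (proj2 Ha)).
  assert (Hnz : forall i, In i (seq 1 N) -> xi i <> 0%C) by (intros; now apply (torus_nz_seq r N)).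
  assert (Hno : length (offsets x0 xs) = S (length L)) by (unfold offsets; rewrite length_map; lia).
  assert (HP := outside_perm (seq 1 N) L (seq_NoDup N 1) HL Hi).
  rewrite lambda_term_closed by (easy || apply seq_NoDup).
  unfold integrand; fold (outside (seq 1 N) L).
  set (B := outside (seq 1 N) L) in *.
  assert (HBi : incl B (seq 1 N)) by (intros x Hx; apply filter_In in Hx; easy).
  rewrite (Cprod_perm _ _ _ (filter_inL_perm N L HL Hi)).
  rewrite <- Hlen.
  rewrite <- (Cprod_pairs_map (fun i => nth (i - 1) L 0%nat) (fun ij => fpq p (xi (fst ij)) (xi (snd ij)))).
  rewrite map_nth_seq.
  rewrite (Cprod_nth_combine 0%Z (fun a x => Cpowz (xi a) x)) by lia.
  rewrite (Cprod_combine_offsets x0) by (easy || lia || (intros; apply Hnz, Hi; easy)).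
  rewrite vd_pairs.
  assert (Hlast : nth (length L) xs 0%Z = (x0 + Z.of_nat (last (offsets x0 xs) 0%nat))%Z /\
    In (nth (length L) xs 0%Z) xs).
  { split; [|apply nth_In; lia].
    destruct (exists_last (l := xs)) as (xs' & x & ->); [intros ->; simpl in Hxs; lia|].
    unfold offsets; rewrite map_app; cbn [map]; rewrite last_last.
    rewrite length_app in Hxs; cbn [length] in Hxs.
    rewrite app_nth2 by lia; replace (length L - length xs')%nat with 0%nat by lia; cbn [nth].
    assert (x0 <= x)%Z by (apply Hx0, in_or_app; right; now left); lia. }
  rewrite (proj1 Hlast).
  rewrite (Cprod_ext B (fun j => Cpowz (xi j) _) (fun j => Cpowz (xi j) x0 * xi j ^ last (offsets x0 xs) 0%nat)%C)
    by (intros; apply Cpowz_add_nat, Hnz, HBi; easy).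
  rewrite Cprod_mult.
  unfold mono.
  rewrite (Cprod_ext (seq 1 N) (fun i => Cpowz (xi i) (shifted_exponent x0 Y i))
    (fun i => Cpowz (xi i) x0 * Cpowz (xi i) (- nth (i - 1) Y 0 - 1)%Z)%C).
  2:{ intros i Hin; rewrite <- Cpowz_add by now apply Hnz.
      f_equal; unfold shifted_exponent; lia. }
  rewrite Cprod_mult, (Cprod_perm _ _ (fun i => Cpowz (xi i) x0) HP), Cprod_app.
  unfold denominator; rewrite (Cprod_perm _ _ (fun i => 1 - xi i)%C HP), Cprod_app.
  cbn [numerator]; rewrite length_map, !Cprod_map.
  (* The complement of [L] has N - (m - 1) elements, which turns the exponent of p in [numerator]
     into (N-m+1)(N-m)/2. *)
  assert (HB : length B = S (N - m)).
  { apply Permutation_length in HP; rewrite length_app, length_seq in HP; lia. }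
  rewrite HB; replace (S (N - m) * (S (N - m) - 1))%nat with ((N - m + 1) * (N - m))%nat
    by (rewrite Nat.sub_succ, Nat.sub_0_r, Nat.add_1_r; reflexivity).
  rewrite RtoC_pow.
  assert (H1 : forall l, incl l (seq 1 N) -> Cprod l (fun i => 1 - xi i)%C <> 0%C).
  { intros l Hl; apply Cprod_nz; intros i Hin; apply Hl, in_seq in Hin.
    apply (one_sub_torus_nz p r N); auto; lia. }
  assert (HD : Cprod (pairs_lt (seq 1 N)) (fun ij => fpq p (xi (fst ij)) (xi (snd ij))) <> 0%C).
  { apply Cprod_nz; intros [i j] Hij; apply pairs_lt_in in Hij; destruct Hij as [Hi1 Hj1].
    apply in_seq in Hi1; apply in_seq in Hj1; cbn [fst snd]; apply (fpq_torus_nz p r N); auto; lia. }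
  assert (HLz := H1 L Hi); assert (HBz := H1 B HBi).
  field; easy.
Qed.

Lemma asep_formula_amplitude p t r N m Y xs x0 : admissible p r ->
  (1 <= m <= N)%nat -> length xs = m -> (forall x, In x xs -> (x0 <= x)%Z) ->
  asep_formula p t r N m Y xs =
  contour_n r N (fun xi => amplitude p (offsets x0 xs) (seq 1 N) xi * mono N (shifted_exponent x0 Y) xi *
    cexp (Csum (seq 1 N) (fun i => epsq p (xi i)) * RtoC t))%C.
Proof.
  intros Ha Hm Hxs Hx0; assert (Hr := proj1 (proj2 Ha)).
  pose (J := fun xi => (mono N (shifted_exponent x0 Y) xi *
    cexp (Csum (seq 1 N) (fun i => epsq p (xi i)) * RtoC t))%C).
  assert (HJ : nice r N anyE J).
  { unfold J; nice_any; apply nice_cexp; try easy.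
    apply nice_ext with (fun xi => RtoC t * Csum (seq 1 N) (fun i => epsq p (xi i)))%C; [intros; ring|].
    apply nice_scal; now apply nice_epsq_sum. }
  pose (c := RtoC (p ^ ((N - m + 1) * (N - m) / 2))).
  assert (Hc : c <> 0%C).
  { intros A; apply RtoC_inj in A; revert A; apply pow_nonzero; destruct Ha; lra. }
  assert (HT : forall L, incl L (seq 1 N) -> nice r N anyE (fun xi =>
    lambda_term p (offsets x0 xs) (seq 1 N) L xi * / denominator p (seq 1 N) xi * J xi)%C).
  { intros L Hi; nice_any; apply nice_any_Pol with (seq 1 N); try easy;
      [now apply in_range_seq | now apply Pol_lambda_term]. }
  assert (Hno : offsets x0 xs <> []).
  { intros A; apply (f_equal (@length nat)) in A; unfold offsets in A; rewrite length_map in A.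
    simpl in A; lia. }
  rewrite (contour_n_ext_all r N _ (fun xi => Csum (arrangements (seq 1 N) (m - 1)) (fun L =>
    arrangement_sign (seq 1 N) L *
      (lambda_term p (offsets x0 xs) (seq 1 N) L xi * / denominator p (seq 1 N) xi * J xi)))%C).
  - rewrite (contour_n_Csum r N anyE); [|easy|].
    + unfold asep_formula; rewrite Csum_Lambdas; apply Csum_ext; intros L HL.
      destruct (arrangements_spec _ _ _ (seq_NoDup N 1) HL) as (Hd & Hi & Hlen).
      rewrite (contour_n_scal r N anyE), (arrangement_sign_lambda N) by (easy || now apply HT).
      f_equal; fold c.
      rewrite <- (contour_n_scal r N anyE); [|easy|].
      * symmetry; apply (contour_n_ext r N anyE); [easy | now apply HT |].
        intros xi Ht; symmetry; unfold J, c; now apply integrand_lambda_term with r.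
      (* The integrand gets its regularity from [lambda_term] by division by the power [c] of p,
         which is nonzero because p > 0. *)
      * apply nice_ext with (fun xi => / c * (lambda_term p (offsets x0 xs) (seq 1 N) L xi *
          / denominator p (seq 1 N) xi * J xi))%C.
        -- intros xi Ht; unfold J; rewrite <- (integrand_lambda_term p t r N m Y xs x0 L xi) by easy.
           fold c; field; easy.
        -- apply nice_scal; now apply HT.
    + intros L HL; apply nice_scal, HT.
      now destruct (arrangements_spec _ _ _ (seq_NoDup N 1) HL) as (_ & Hi & _).
  - intros xi; unfold amplitude.
    rewrite numerator_arrangements by (easy || (apply seq_sorted)).
    replace (length (offsets x0 xs) - 1)%nat with (m - 1)%nat
      by (unfold offsets; rewrite length_map; lia).
    rewrite (Csum_ext _ (fun L => _ * (_ * J xi))%C (fun L => (/ denominator p (seq 1 N) xi * J xi) *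
      (arrangement_sign (seq 1 N) L * lambda_term p (offsets x0 xs) (seq 1 N) L xi))%C) by (intros; ring).
    rewrite Csum_scal; unfold J; ring.
Qed.

Theorem theorem1 (N : nat) (p : R) (Y : list Z) (t : R) (m : nat)
    (xs : list Z) (r : R) :
  (1 <= N)%nat -> 0 < p <= 1 ->
  length Y = N -> StronglySorted Z.lt Y ->
  0 <= t ->
  (1 <= m <= N)%nat ->
  length xs = m -> StronglySorted Z.lt xs ->
  small_radius p r ->
  RtoC (asep_prob p N Y t (first_positions_event xs)) =
  asep_formula p t r N m Y xs.
Proof.
  intros HN Hp HY HYs _ Hm Hxs Hxss Hr.
  assert (Ha : admissible p r) by now split.
  (* The least target position; [xs] has length m >= 1, so the default 0 is never taken. *)
  set (x0 := hd 0%Z xs).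
  assert (Hx0 : forall x, In x xs -> (x0 <= x)%Z).
  { intros x Hx; destruct xs as [|x1 xs]; [easy|]; unfold x0; simpl.
    apply StronglySorted_inv in Hxss; destruct Hxss as [_ Hf]; rewrite Forall_forall in Hf.
    destruct Hx as [->|Hx]; [lia | specialize (Hf x Hx); lia]. }
  rewrite (asep_formula_amplitude p t r N m Y xs x0) by easy.
  unfold asep_prob; apply poisson_contour; try easy.
  intros n; apply asep_steps_bethe; try easy.
  - intros A; apply (f_equal (@length nat)) in A; unfold offsets in A; rewrite length_map in A.
    simpl in A; lia.
  - clear - Hxss Hx0; unfold offsets; clearbody x0; induction Hxss as [|x xs Hs IH Hf]; [constructor|].
    cbn [map]; constructor; [apply IH; intros; apply Hx0; now right|].
    rewrite Forall_forall in *; intros k Hk; apply in_map_iff in Hk; destruct Hk as (y & <- & Hy).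
    specialize (Hf y Hy); assert (x0 <= x)%Z by (apply Hx0; now left); lia.
  - unfold offsets; rewrite length_map; lia.
  - intros X; unfold first_positions_event.
    replace (map (fun k => x0 + Z.of_nat k)%Z (offsets x0 xs)) with xs.
    + unfold offsets; now rewrite length_map.
    + unfold offsets; rewrite map_map, <- (map_id xs) at 1; apply map_ext_in; intros x Hx.
      specialize (Hx0 x Hx); lia.
  - now apply increasing_of_sorted.
Qed.
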